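(* The moduli space of isometric immersions $\mathrm{IsoImm}(S^1,\mathbb{R}^3)$ is obtained as a symplectic reduction of either component of $\mathcal{M}$ by the action of $\mathcal{L}\mathbb{S}^1/\mathbb{S}^1$. The induced symplectic structure on $\mathrm{IsoImm}(S^1,\mathbb{R}^3)$ agrees with the Millson–Zombro symplectic form up to a constant.
   Context: Let $S^1=[0,2]/(0\sim 2)$, $\mathbb{S}^n$ the unit sphere in $\mathbb{R}^{n+1}$, $\mathcal{P}M=C^\infty([0,2],M)$, $\mathcal{L}M=C^\infty(S^1,M)$, and let $\mathcal{A}\mathbb{C}$ be the space of $\phi\in\mathcal{P}\mathbb{C}$ with $\phi^{(k)}(2)=-\phi^{(k)}(0)$ for all $k\ge0$. $\mathcal{L}\mathbb{S}^1/\mathbb{S}^1$ is the quotient of the loop group of the circle by the constant loops; its Lie algebra is $\mathcal{L}\mathbb{R}/\mathbb{R}$. Framed loops. A framed path is a pair $(\gamma,V)$ of smooth maps $[0,2]\to\mathbb{R}^3$, $\gamma$ an immersion and $V$ a unit field normal to $\gamma'$. $\mathcal{O}$ is the space of framed paths modulo translation (represented by $\gamma(0)=\vec0$), a Fréchet manifold via $\mathrm{F}:\mathcal{O}\to\mathcal{P}(\mathrm{SO}(3)\times\mathbb{R}^+)$, $\mathrm{F}(\gamma,V)=((T,V,T\times V),\|\gamma'\|)$, $T=\gamma'/\|\gamma'\|$. $\mathcal{C}\subset\mathcal{O}$ consists of framed loops: $\gamma',V$ smooth on $S^1$ and $\gamma(0)=\gamma(2)$. $\mathcal{M}=\mathcal{C}/(\mathrm{SO}(3)\times\mathbb{R}^+\times\mathbb{S}^1)$,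 with rotations $(A\gamma,AV)$, scalings $(r\gamma,V)$ and constant frame twists $(\gamma,\cos(2\theta)V+\sin(2\theta)T\times V)$. Elements are represented by $[\gamma,V]$ with $\gamma(0)=\vec0$ and $\mathrm{length}(\gamma)=2$. $\mathcal{M}$ has two components $\mathcal{M}_{od},\mathcal{M}_{ev}$ (parity of the linking number of $\gamma$ with $\gamma+\epsilon V$ when $\gamma$ is embedded). Kähler structure. For $\mathcal{V}=\mathcal{L}\mathbb{C}$ or $\mathcal{A}\mathbb{C}$ let $\mathrm{St}_2(\mathcal{V})$ be the set of $L^2$-orthonormal pairs $\Phi=(\phi,\psi)\in\mathcal{V}^2$ (with $\langle\phi,\psi\rangle_{L^2}=\int_0^2\phi\bar\psi\,dt$), $\mathrm{Gr}_2(\mathcal{V})=\mathrm{St}_2(\mathcal{V})/\mathrm{U}(2)$ (right multiplication), and $\mathrm{Gr}^\circ_2(\mathcal{V})$ the open subset of classes with $\Phi(t)\neq\vec0$ for all $t$. $\mathrm{Gr}_2(\mathcal{V})$ carries the Kähler structure obtained by reduction from $\mathcal{V}^2$ with metric $\mathrm{Re}\langle\cdot,\cdot\rangle_{L^2}$, symplectic form $\omega^{L^2}=-\mathrm{Im}\langle\cdot,\cdot\rangle_{L^2}$ and complex structure $i$. Identify $\mathbb{C}^2$ with the quaternions by $(z,w)\leftrightarrow q=z+w\mathbf{j}$, let $\mathrm{Hopf}(q)=(\bar q\mathbf{i}q,\bar q\mathbf{j}q,\bar q\mathbf{k}q)$, $\mathrm{H}(\Phi)=(\|\Phi\|^{-2}\mathrm{Hopf}(\Phi),\|\Phi\|^2)$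 (pointwise in $t$) and $\widehat{\mathrm{H}}=\mathrm{F}^{-1}\circ\mathrm{H}$. The map $\widehat{\mathrm{H}}$ induces diffeomorphisms $\mathrm{Gr}_2^\circ(\mathcal{L}\mathbb{C})\approx\mathcal{M}_{od}$ and $\mathrm{Gr}_2^\circ(\mathcal{A}\mathbb{C})\approx\mathcal{M}_{ev}$, and $\mathcal{M}$ carries the transferred Kähler structure. Action and reduction. $[e^{i\alpha}]\in\mathcal{L}\mathbb{S}^1/\mathbb{S}^1$ acts on the Grassmannians by $[e^{i\alpha}]\cdot[\Phi]=[e^{i\alpha}\Phi]$; on $\mathcal{M}$ this is frame twisting (rotating the framing about $\gamma'$ through angle $2\alpha(t)$, up to sign convention). The action is Hamiltonian with momentum map $\mu([\phi,\psi])=[|\phi|^2+|\psi|^2]\in\mathcal{L}\mathbb{R}/\mathbb{R}$, where $\mathcal{L}\mathbb{R}/\mathbb{R}$ is mapped into its dual by $\langle[\alpha],[\beta]\rangle=\frac12\int_0^2\alpha\beta\,dt-\frac14\int_0^2\alpha\,dt\int_0^2\beta\,dt$; in terms of framed loops $\mu([\gamma,V])=[\|\gamma'\|]$. The symplectic reduction is taken at the value $[\mathbf{1}]$ (the class of the constant loop $1$): $\mu^{-1}([\mathbf{1}])/(\mathcal{L}\mathbb{S}^1/\mathbb{S}^1)$ with the induced form; $\mu^{-1}([\mathbf 1])$ corresponds to the framed loops with $\|\gamma'\|\equiv1$. Isometric immersions. $\mathrm{IsoImm}(S^1,\mathbb{R}^3)=\{\gamma\in\mathrm{Imm}(S^1,\mathbb{R}^3):\|\gamma'(t)\|=1\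 \forall t,\ \gamma(0)=\vec0\}/\mathrm{SO}(3)$. Via $\gamma\mapsto\gamma'$ it is the symplectic reduction of $\mathcal{L}\mathbb{S}^2$ by the rotation action of $\mathrm{SO}(3)$ (at the zero level of $\sigma\mapsto\int_{S^1}\sigma\,dt$), where $\mathcal{L}\mathbb{S}^2$ has the symplectic form $\Omega_\sigma(u,v)=\int_{S^1}\langle\sigma,u\times v\rangle\,dt$ for $u,v$ vector fields along $\sigma$ tangent to $\mathbb{S}^2$; the Millson–Zombro symplectic form is the resulting reduced form. ''Up to a constant'' means up to multiplication by a nonzero real constant. *)

(* Defs.v *)
From Stdlib Require Import Reals ZArith Lra Lia.
From Coquelicot Require Import Coquelicot.
Open Scope R_scope.

(** * Smooth functions, loops and families

    S^1 = [0,2]/(0 ~ 2) is R/2Z: maps on S^1 are 2-periodic maps on R.  In the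
    same way an element of AC, a smooth path on [0,2] whose derivatives satisfy
    phi^(k)(2) = - phi^(k)(0), is represented by its unique smooth extension to
    R with phi (t + 2) = - phi t; [closing_extension] and [closing_derivatives]
    below justify both representations. *)

Definition smooth (f : R -> R) : Prop := forall n t, ex_derive_n f n t.

Definition within_0_2 (t : R) : (R -> Prop) -> Prop :=
  within (fun x => 0 <= x <= 2) (locally t).

Lemma closing_derivatives (sg : R) (f : R -> R) :
  smooth f -> (forall t, f (t + 2) = sg * f t) ->
  forall k, Derive_n f k 2 = sg * Derive_n f k 0.
Proof.
  intros _ Hf k.
  replace (Derive_n f k 2) with (Derive_n f k (0 + 2)) by (f_equal; ring).
  rewrite <- (Derive_n_comp_trans f k 0 2), <- Derive_n_scal_l.
  now apply Derive_n_ext.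
Qed.

Lemma closing_extension (sg : R) (phi : nat -> R -> R) :
  sg * sg = 1 ->
  (forall k t, 0 <= t <= 2 ->
     filterdiff (phi k) (within_0_2 t) (fun h => scal h (phi (S k) t))) ->
  (forall k, phi k 2 = sg * phi k 0) ->
  exists f, smooth f /\ (forall t, f (t + 2) = sg * f t) /\
    forall k t, 0 <= t <= 2 -> Derive_n f k t = phi k t.
Proof.
  intros Hsg Hd Hcl.
  set (n := fun t => Int_part (t / 2)).
  set (sn := fun m : Z => if Z.even m then 1 else sg).
  set (E := fun k t => sn (n t) * phi k (t - 2 * IZR (n t))).
  assert (Hn : forall t, 0 <= t - 2 * IZR (n t) < 2).
  { intros t. unfold n. destruct (base_Int_part (t / 2)). lra. }
  assert (Hu : forall t m, 0 <= t - 2 * IZR m < 2 -> n t = m).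
  { intros t m Hm. specialize (Hn t).
    assert (-1 < IZR (n t - m) < 1) as [H1 H2] by (rewrite minus_IZR; lra).
    apply (lt_IZR (-1)) in H1. apply (lt_IZR _ 1) in H2. lia. }
  assert (HE : forall k m t, E k (t + 2 * IZR m) = sn m * E k t).
  { intros k m t. unfold E.
    assert (Hm : n (t + 2 * IZR m) = (n t + m)%Z).
    { apply Hu. rewrite plus_IZR. specialize (Hn t). lra. }
    rewrite Hm, plus_IZR.
    replace (t + 2 * IZR m - 2 * (IZR (n t) + IZR m)) with (t - 2 * IZR (n t)) by ring.
    unfold sn. rewrite Z.even_add.
    destruct (Z.even (n t)), (Z.even m); simpl; try ring.
    replace (sg * (sg * phi k (t - 2 * IZR (n t))))
      with (sg * sg * phi k (t - 2 * IZR (n t))) by ring.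
    rewrite Hsg; ring. }
  assert (HE0 : forall k t, 0 <= t <= 2 -> E k t = phi k t).
  { intros k t Ht. destruct (Req_dec t 2) as [-> | Hne].
    - replace 2 with (0 + 2 * IZR 1) at 1 by ring. rewrite HE. unfold E.
      rewrite (Hu 0 0%Z) by (simpl; lra).
      unfold sn; simpl. rewrite Hcl. replace (0 - 2 * 0) with 0 by ring. ring.
    - unfold E. rewrite (Hu t 0%Z) by (simpl; lra).
      unfold sn; simpl. replace (t - 2 * 0) with t by ring. ring. }
  assert (Hw : forall k t, 0 <= t <= 2 -> forall eps : posreal,
    exists del : posreal, forall y, 0 <= y <= 2 -> Rabs (y - t) < del ->
      Rabs (phi k y - phi k t - (y - t) * phi (S k) t) <= eps * Rabs (y - t)).
  { intros k t Ht eps. destruct (Hd k t Ht) as [_ Hdom].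
    specialize (Hdom t). destruct (Hdom) with (eps := eps) as [del Hdel].
    { intros P [d HP]. exists d. intros y Hy _. now apply HP. }
    exists del. intros y Hy Hyt. exact (Hdel y Hyt Hy). }
  assert (HD0 : forall k t, 0 <= t < 2 -> is_derive (E k) t (E (S k) t)).
  { intros k t Ht.
    assert (forall eps : posreal, exists del : posreal, forall y, Rabs (y - t) < del ->
      Rabs (E k y - E k t - (y - t) * E (S k) t) <= eps * Rabs (y - t)) as HL.
    { intros eps.
      destruct (Hw k t ltac:(lra) eps) as [d1 H1].
      destruct (Rle_lt_or_eq_dec 0 t (proj1 Ht)) as [Hp | <-].
      - assert (Hm : 0 < Rmin d1 (Rmin t (2 - t))).
        { repeat apply Rmin_pos; try lra. apply cond_pos. }
        exists (mkposreal _ Hm). simpl. intros y Hy.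
        pose proof (Rmin_l d1 (Rmin t (2 - t))). pose proof (Rmin_r d1 (Rmin t (2 - t))).
        pose proof (Rmin_l t (2 - t)). pose proof (Rmin_r t (2 - t)).
        assert (0 <= y <= 2) by (apply Rabs_lt_between in Hy; lra).
        rewrite !HE0 by lra. apply H1; lra.
      - destruct (Hw k 2 ltac:(lra) eps) as [d2 H2].
        assert (Hm : 0 < Rmin d1 (Rmin d2 1)).
        { repeat apply Rmin_pos; try lra; apply cond_pos. }
        exists (mkposreal _ Hm). simpl. intros y Hy.
        pose proof (Rmin_l d1 (Rmin d2 1)). pose proof (Rmin_r d1 (Rmin d2 1)).
        pose proof (Rmin_l d2 1). pose proof (Rmin_r d2 1).
        assert (-1 < y < 1) by (apply Rabs_lt_between in Hy; lra).
        destruct (Rle_lt_dec 0 y) as [Hy0 | Hy0].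
        + rewrite !HE0 by lra. apply H1; lra.
        + assert (Hyy : E k y = sg * phi k (y + 2)).
          { replace y with (y + 2 + 2 * IZR (-1)) at 1 by ring.
            rewrite HE, HE0 by lra. reflexivity. }
          assert (Hz : forall j, E j 0 = sg * phi j 2).
          { intros j. rewrite HE0 by lra. rewrite Hcl, <- Rmult_assoc, Hsg. ring. }
          rewrite Hyy, !Hz.
          replace (sg * phi k (y + 2) - sg * phi k 2 - (y - 0) * (sg * phi (S k) 2))
            with (sg * (phi k (y + 2) - phi k 2 - (y + 2 - 2) * phi (S k) 2)) by ring.
          rewrite Rabs_mult.
          replace (Rabs sg) with 1.
          2:{ assert (Rabs sg * Rabs sg = 1) by (rewrite <- Rabs_mult, Hsg; apply Rabs_R1).
              pose proof (Rabs_pos sg). nra. }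
          rewrite Rmult_1_l. replace (y - 0) with (y + 2 - 2) by ring.
          apply H2; [lra |]. replace (y + 2 - 2) with (y - 0) by ring. lra. }
    split; [apply is_linear_scal_l |].
    intros x Hx. apply (is_filter_lim_locally_unique (V := R_NormedModule)) in Hx. subst x.
    intros eps. destruct (HL eps) as [del Hdel]. exists del. intros y Hy.
    exact (Hdel y Hy). }
  assert (HD : forall k t, is_derive (E k) t (E (S k) t)).
  { intros k t.
    set (m := n t). set (x := t - 2 * IZR m).
    apply is_derive_ext with (f := fun y => sn m * E k (y - 2 * IZR m)).
    { intros y. rewrite <- HE. f_equal. ring. }
    replace (E (S k) t) with (sn m * (1 * E (S k) x)).
    2:{ rewrite Rmult_1_l, <- HE. f_equal. unfold x. ring. }
    apply (is_derive_scal (fun y => E k (y - 2 * IZR m)) t (sn m)).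
    apply (is_derive_comp (E k) (fun y => y - 2 * IZR m)).
    - apply HD0. apply Hn.
    - auto_derive; [trivial | ring]. }
  assert (HDn : forall k t, Derive_n (E O) k t = E k t).
  { induction k; intros t; [reflexivity |]. simpl.
    rewrite (Derive_ext _ (E k)) by assumption. apply is_derive_unique, HD. }
  exists (E O). split; [| split].
  - intros k t. destruct k as [| k]; [exact I |]. simpl.
    apply ex_derive_ext with (f := E k); [intros; symmetry; apply HDn |].
    exists (E (S k) t). apply HD.
  - intros t. replace (t + 2) with (t + 2 * IZR 1) by ring. apply HE.
  - intros k t Ht. rewrite HDn. now apply HE0.
Qed.

(** A curve in a space of smooth maps is a map of two variables, smooth jointly
    in the parameter [s] and in [t] (exponential law).  Curves are given as
    germs at a parameter value [s0]. *)

Definition partial_s (f : R -> R -> R) : R -> R -> R :=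
  fun s t => Derive (fun s' => f s' t) s.

Definition partial_t (f : R -> R -> R) : R -> R -> R :=
  fun s t => Derive (f s) t.

Fixpoint Ck_strip (D : R -> Prop) (n : nat) (f : R -> R -> R) : Prop :=
  match n with
  | O => forall s t, D s -> continuity_2d_pt f s t
  | S m =>
      (forall s t, D s -> ex_derive (fun s' => f s' t) s /\ ex_derive (f s) t) /\
      Ck_strip D m (partial_s f) /\ Ck_strip D m (partial_t f)
  end.

Definition smooth_family (s0 : R) (f : R -> R -> R) : Prop :=
  exists eps : posreal, forall n, Ck_strip (ball s0 eps) n f.

(** * Vectors of R^3, rotations *)

Definition V3 : Type := R * R * R.
Definition vx (v : V3) : R := fst (fst v).
Definition vy (v : V3) : R := snd (fst v).
Definition vz (v : V3) : R := snd v.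

Definition v0 : V3 := (0, 0, 0).
Definition vadd (u v : V3) : V3 := (vx u + vx v, vy u + vy v, vz u + vz v).
Definition vscal (r : R) (v : V3) : V3 := (r * vx v, r * vy v, r * vz v).
Definition dot (u v : V3) : R := vx u * vx v + vy u * vy v + vz u * vz v.
Definition cross (u v : V3) : V3 :=
  (vy u * vz v - vz u * vy v,
   vz u * vx v - vx u * vz v,
   vx u * vy v - vy u * vx v).
Definition vnorm (v : V3) : R := sqrt (dot v v).

Definition vderive (g : R -> V3) (t : R) : V3 :=
  (Derive (fun x => vx (g x)) t,
   Derive (fun x => vy (g x)) t,
   Derive (fun x => vz (g x)) t).

Definition vRInt (g : R -> V3) (a b : R) : V3 :=
  (RInt (fun t => vx (g t)) a b,
   RInt (fun t => vy (g t)) a b,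
   RInt (fun t => vz (g t)) a b).

Definition smooth_loop_V3 (g : R -> V3) : Prop :=
  smooth (fun t => vx (g t)) /\ smooth (fun t => vy (g t)) /\
  smooth (fun t => vz (g t)) /\ forall t, g (t + 2) = g t.

Definition smooth_family_V3 (s0 : R) (c : R -> R -> V3) : Prop :=
  smooth_family s0 (fun s t => vx (c s t)) /\
  smooth_family s0 (fun s t => vy (c s t)) /\
  smooth_family s0 (fun s t => vz (c s t)).

(** 3 x 3 matrices are triples of columns. *)
Definition M3 : Type := V3 * V3 * V3.

Definition mapp (A : M3) (v : V3) : V3 :=
  vadd (vscal (vx v) (fst (fst A)))
    (vadd (vscal (vy v) (snd (fst A))) (vscal (vz v) (snd A))).

Definition SO3 (A : M3) : Prop :=
  let '(a, b, c) := A in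
  dot a a = 1 /\ dot b b = 1 /\ dot c c = 1 /\
  dot a b = 0 /\ dot a c = 0 /\ dot b c = 0 /\
  dot (cross a b) c = 1.

(** * C^2, quaternions and the Hopf map *)

Definition C2 : Type := C * C.

(** [(z, w)] is the quaternion z + w j; recall that j z = (Cconj z) j. *)
Definition qmul (p q : C2) : C2 :=
  (fst p * fst q - snd p * Cconj (snd q), fst p * snd q + snd p * Cconj (fst q))%C.
Definition qconj (q : C2) : C2 := (Cconj (fst q), Copp (snd q)).
Definition qi : C2 := (Ci, RtoC 0).
Definition qj : C2 := (RtoC 0, RtoC 1).
Definition qk : C2 := (RtoC 0, Ci).

(** Coordinates on i, j, k: for w = x + y i, w j = x j + y k. *)
Definition qvec (q : C2) : V3 := (Im (fst q), Re (snd q), Im (snd q)).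

Definition Hopf (q : C2) : M3 :=
  (qvec (qmul (qconj q) (qmul qi q)),
   qvec (qmul (qconj q) (qmul qj q)),
   qvec (qmul (qconj q) (qmul qk q))).

Definition sqnorm (q : C2) : R := Cmod (fst q) ^ 2 + Cmod (snd q) ^ 2.

Definition mscal (r : R) (A : M3) : M3 :=
  (vscal r (fst (fst A)), vscal r (snd (fst A)), vscal r (snd A)).

Definition H (Phi : R -> C2) (t : R) : M3 * R :=
  (mscal (/ sqnorm (Phi t)) (Hopf (Phi t)), sqnorm (Phi t)).

(** * Spaces with a 2-form

    A space is given by representatives, a membership predicate, the relation
    "represent the same point" and the germs of smooth curves ([curve s0 c]: [c]
    is smooth near [s0]).  Tangent vectors are velocities of smooth curves, so a
    2-form is evaluated on two curves with the same value at 0: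
    [form c1 c2 w] says that its value on the velocities at 0 is [w]. *)

Record space := mkSpace {
  pt : Type;
  mem : pt -> Prop;
  same : pt -> pt -> Prop;
  curve : R -> (R -> pt) -> Prop;
  form : (R -> pt) -> (R -> pt) -> R -> Prop
}.

(** The reduced space level/G.  Its smooth curves are locally projections of
    smooth curves in the level set, and its form omega_red is characterized by
    pi^* omega_red = iota^* omega. *)
Definition reduction (X : space) (G : Type) (inG : G -> Prop)
    (act : G -> pt X -> pt X) (level : pt X -> Prop) : space :=
  let mem' x := mem X x /\ level x in
  let same' x y := exists g, inG g /\ same X (act g x) y in
  let lift s0 (c d : R -> pt X) :=
    curve X s0 c /\
    locally s0 (fun s => mem' (c s) /\ mem' (d s) /\ same' (c s) (d s)) in
  mkSpace (pt X) mem' same'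
    (fun s0 d => exists c, lift s0 c d)
    (fun d1 d2 w => exists c1 c2,
       lift 0 c1 d1 /\ lift 0 c2 d2 /\ same X (c1 0) (c2 0) /\ form X c1 c2 w).

Definition open_subspace (X : space) (P : pt X -> Prop) : space :=
  mkSpace (pt X) (fun x => mem X x /\ P x) (same X)
    (fun s0 c => curve X s0 c /\ locally s0 (fun s => P (c s)))
    (form X).

(** A bijection under which the smooth curves of both spaces correspond. *)
Definition diffeomorphism (X Y : space) (f : pt X -> pt Y) : Prop :=
  (forall x, mem X x -> mem Y (f x)) /\
  (forall x x', mem X x -> mem X x' -> (same X x x' <-> same Y (f x) (f x'))) /\
  (forall y, mem Y y -> exists x, mem X x /\ same Y (f x) y) /\
  (forall s0 d, locally s0 (fun s => mem X (d s)) ->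
     (curve X s0 d <-> curve Y s0 (fun s => f (d s)))).

(** * The Grassmannians Gr_2(LC) and Gr_2(AC) *)

(** The two components of the moduli space of framed loops. *)
Inductive component := od | ev.

Definition smooth_C (phi : R -> C) : Prop :=
  smooth (fun t => Re (phi t)) /\ smooth (fun t => Im (phi t)).

Definition LC (phi : R -> C) : Prop :=
  smooth_C phi /\ forall t, phi (t + 2) = phi t.
Definition AC (phi : R -> C) : Prop :=
  smooth_C phi /\ forall t, phi (t + 2) = Copp (phi t).

Definition in_V (K : component) : (R -> C) -> Prop :=
  match K with od => LC | ev => AC end.

Definition smooth_family_C (s0 : R) (c : R -> R -> C) : Prop :=
  smooth_family s0 (fun s t => Re (c s t)) /\
  smooth_family s0 (fun s t => Im (c s t)).

Definition L2 (phi psi : R -> C) : C :=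
  RInt (V := C_R_CompleteNormedModule)
    (fun t => Cmult (phi t) (Cconj (psi t))) 0 2.

Definition comp1 (Phi : R -> C2) : R -> C := fun t => fst (Phi t).
Definition comp2 (Phi : R -> C2) : R -> C := fun t => snd (Phi t).

(** The velocity at [s = 0]. *)
Definition velocity_C (c : R -> R -> C) (t : R) : C :=
  (Derive (fun s => Re (c s t)) 0, Derive (fun s => Im (c s t)) 0).
Definition velocity_C2 (c : R -> R -> C2) (t : R) : C2 :=
  (velocity_C (fun s x => fst (c s x)) t, velocity_C (fun s x => snd (c s x)) t).
Definition velocity_V3 (c : R -> R -> V3) (t : R) : V3 :=
  vderive (fun s => c s t) 0.

Definition omega_L2 (X Y : R -> C2) : R :=
  - Im (Cplus (L2 (comp1 X) (comp1 Y)) (L2 (comp2 X) (comp2 Y))).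

Definition mem_V2 (K : component) (Phi : R -> C2) : Prop :=
  in_V K (comp1 Phi) /\ in_V K (comp2 Phi).

Definition V2 (K : component) : space :=
  mkSpace (R -> C2) (mem_V2 K)
    (fun Phi Psi => forall t, Phi t = Psi t)
    (fun s0 c =>
       locally s0 (fun s => mem_V2 K (c s)) /\
       smooth_family_C s0 (fun s => comp1 (c s)) /\
       smooth_family_C s0 (fun s => comp2 (c s)))
    (fun c1 c2 w => w = omega_L2 (velocity_C2 c1) (velocity_C2 c2)).

Definition St2 (Phi : R -> C2) : Prop :=
  L2 (comp1 Phi) (comp1 Phi) = RtoC 1 /\
  L2 (comp2 Phi) (comp2 Phi) = RtoC 1 /\
  L2 (comp1 Phi) (comp2 Phi) = RtoC 0.

(** 2 x 2 complex matrices [((a, b), (c, d))], by columns. *)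
Definition U2 (U : C2 * C2) : Prop :=
  let '((a, b), (c, d)) := U in
  (Cconj a * a + Cconj b * b)%C = RtoC 1 /\
  (Cconj c * c + Cconj d * d)%C = RtoC 1 /\
  (Cconj a * c + Cconj b * d)%C = RtoC 0.

Definition right_mul (U : C2 * C2) (Phi : R -> C2) : R -> C2 :=
  let '((a, b), (c, d)) := U in
  fun t => (fst (Phi t) * a + snd (Phi t) * b, fst (Phi t) * c + snd (Phi t) * d)%C.

Definition Gr2 (K : component) : space :=
  reduction (V2 K) (C2 * C2) U2 right_mul St2.

Definition Gr2o (K : component) : space :=
  open_subspace (Gr2 K) (fun Phi => forall t, Phi t <> (RtoC 0, RtoC 0)).

(** * Framed loops and their moduli space *)

Definition framed : Type := (R -> V3) * (R -> V3).

Definition tangent (g : R -> V3) (t : R) : V3 :=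
  vscal (/ vnorm (vderive g t)) (vderive g t).

Definition framed_loop (x : framed) : Prop :=
  let '(g, V) := x in
  smooth_loop_V3 g /\ smooth_loop_V3 V /\
  (forall t, vderive g t <> v0) /\
  (forall t, vnorm (V t) = 1) /\
  (forall t, dot (V t) (vderive g t) = 0) /\
  g 0 = v0.

Definition F (x : framed) (t : R) : M3 * R :=
  let '(g, V) := x in
  ((tangent g t, V t, cross (tangent g t) (V t)), vnorm (vderive g t)).

(** [Hhat Phi x]: x = F^-1 (H Phi). *)
Definition Hhat (Phi : R -> C2) (x : framed) : Prop :=
  framed_loop x /\ forall t, F x t = H Phi t.

Definition length (g : R -> V3) : R := RInt (fun t => vnorm (vderive g t)) 0 2.

(** Equality modulo SO(3) x R^+ x S^1. *)
Definition same_framed (x y : framed) : Prop :=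
  let '(g, V) := x in
  let '(g', V') := y in
  exists A r theta, SO3 A /\ 0 < r /\
    (forall t, g' t = mapp A (vscal r (g t))) /\
    (forall t, V' t =
       mapp A (vadd (vscal (cos (2 * theta)) (V t))
                    (vscal (sin (2 * theta)) (cross (tangent g t) (V t))))).

(** [M od] and [M ev] are the images of Gr_2°(LC) and Gr_2°(AC) under Hhat, with
    the 2-form transferred from the Grassmannian. *)
Definition rep_by (Phi : R -> C2) (x : framed) : Prop :=
  exists y, Hhat Phi y /\ same_framed y x.

Definition mem_M (K : component) (x : framed) : Prop :=
  framed_loop x /\ exists Phi, mem (Gr2o K) Phi /\ rep_by Phi x.

Definition M (K : component) : space :=
  mkSpace framed (mem_M K) same_framed
    (fun s0 d => exists c : R -> framed,
       smooth_family_V3 s0 (fun s => fst (c s)) /\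
       smooth_family_V3 s0 (fun s => snd (c s)) /\
       locally s0 (fun s => mem_M K (c s) /\ mem_M K (d s) /\ same_framed (c s) (d s)))
    (fun d1 d2 w => exists Phi1 Phi2 : R -> (R -> C2),
       curve (Gr2o K) 0 Phi1 /\ curve (Gr2o K) 0 Phi2 /\
       locally 0 (fun s => rep_by (Phi1 s) (d1 s)) /\
       locally 0 (fun s => rep_by (Phi2 s) (d2 s)) /\
       same (Gr2o K) (Phi1 0) (Phi2 0) /\
       form (Gr2o K) Phi1 Phi2 w).

(** * The action of LS^1/S^1 and its momentum map *)

Definition LS1 (u : R -> C) : Prop := LC u /\ forall t, Cmod (u t) = 1.

(** For u = e^(i alpha), multiplication of Phi by u turns the framing of
    Hhat Phi through the angle -2 alpha, since j e^(i alpha) = e^(-i alpha) j.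
    Constant loops act trivially on [M K], so that the orbits of LS^1 are those
    of LS^1/S^1. *)
Definition twist (u : R -> C) (x : framed) : framed :=
  let '(g, V) := x in
  (g, fun t => vadd (vscal (Re (u t * u t)%C) (V t))
                    (vscal (- Im (u t * u t)%C) (cross (tangent g t) (V t)))).

(** The representative of length 2 of the similarity class of a loop. *)
Definition normalize (g : R -> V3) : R -> V3 := fun t => vscal (2 / length g) (g t).

Definition same_LR_mod_R (f h : R -> R) : Prop := exists k, forall t, f t - h t = k.

Definition mu (x : framed) : R -> R := fun t => vnorm (vderive (normalize (fst x)) t).

Definition level_one (x : framed) : Prop := same_LR_mod_R (mu x) (fun _ => 1).

Definition M_red (K : component) : space :=
  reduction (M K) (R -> C) LS1 twist level_one.

(** * Isometric immersions and the Millson-Zombro form *)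

Definition mem_LS2 (sigma : R -> V3) : Prop :=
  smooth_loop_V3 sigma /\ forall t, vnorm (sigma t) = 1.

Definition Omega (sigma u v : R -> V3) : R :=
  RInt (fun t => dot (sigma t) (cross (u t) (v t))) 0 2.

Definition LS2 : space :=
  mkSpace (R -> V3) mem_LS2
    (fun sigma tau => forall t, sigma t = tau t)
    (fun s0 c => locally s0 (fun s => mem_LS2 (c s)) /\ smooth_family_V3 s0 c)
    (fun c1 c2 w => w = Omega (c1 0) (velocity_V3 c1) (velocity_V3 c2)).

Definition LS2_red : space :=
  reduction LS2 M3 SO3 (fun A sigma t => mapp A (sigma t))
    (fun sigma => vRInt sigma 0 2 = v0).

Definition mem_IsoImm (g : R -> V3) : Prop :=
  smooth_loop_V3 g /\ (forall t, vnorm (vderive g t) = 1) /\ g 0 = v0.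

Definition same_SO3 (g h : R -> V3) : Prop :=
  exists A, SO3 A /\ forall t, h t = mapp A (g t).

(** The form is the Millson-Zombro form, obtained from [LS2_red] through
    the identification of a loop with its derivative. *)
Definition IsoImm : space :=
  mkSpace (R -> V3) mem_IsoImm same_SO3
    (fun s0 d => exists c : R -> (R -> V3),
       smooth_family_V3 s0 c /\
       locally s0 (fun s => mem_IsoImm (c s) /\ mem_IsoImm (d s) /\ same_SO3 (c s) (d s)))
    (fun d1 d2 w =>
       form LS2_red (fun s => vderive (d1 s)) (fun s => vderive (d2 s)) w).

(** [gamma, V] |-> [gamma] *)
Definition forget (x : framed) : R -> V3 := normalize (fst x).

(* Main.v *)
Require Import Defs.
From Stdlib Require Import Reals.
From Coquelicot Require Import Coquelicot.
From Stdlib Require Import Lra Lia ZArith Classical ClassicalEpsilon FunctionalExtensionality.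
From Stdlib Require List.
Open Scope R_scope.

(** A framed loop of unit speed comes from a curve [q] of unit quaternions with
    [Hopf q = (T, V, cross T V)], periodic or antiperiodic according to the component. Two lifts of
    congruent tangent curves differ by a rotation of R^3 and by a factor [u] in LS^1, since a
    unit quaternion [y] with [conj y * i * y = i] is complex; hence forgetting the frame is
    injective on the quotient. For surjectivity, and for smooth families, a smooth loop on S^2
    misses a direction, so that it has an explicit periodic lift, which the factor
    [e^(i pi t / 2)] makes antiperiodic. Writing the velocities of the lifts as [x * q] and
    [y * q] with [x], [y] imaginary quaternions, the integrand of [Omega] is [4 <i, cross x y>], which
    is four times that of [omega_L2], whence the constant 1/4. That the reduced form on
    loops in S^2 does not depend on the representatives is checked directly: two curves of
    congruent loops have velocities differing by [cross x sigma] for a constant vector [x], and such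
    a term contributes only multiples of the integrals of [sigma] and of its variations. *)

(** * Smooth families *)

(** In a reduced space two curves are identified for each parameter value separately: the relating
    rotation, unitary matrix or circle-valued loop need not depend smoothly on [s], so it can never
    be differentiated. On the Grassmannian side the form is therefore evaluated on the smooth lift
    in [V2] itself, whose image under the first vector of [Hopf] is a smooth curve in [LS2]; on the
    sphere side congruence is exploited only through dot and triple products, which are smooth and
    invariant. Uniqueness of the value on [M_red] is not examined modulo circle-valued loops: it is
    inherited from [IsoImm], where only rotations act. The factor four is two times two: if
    [q' = x q] with [x] imaginary, the derivative of [conj q i q] is [2 conj q (cross i x) q], and
    [cross (cross i x) (cross i y)] equals [<i, cross x y> i]. On the other side the Hermitian
    product of [x q] and [y q] is the complex part of [- x y], so minus its imaginary part is
    [<i, cross x y>]. *)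

Lemma locally_2d_strip (D : R -> Prop) (P : R -> R -> Prop) s t :
  open D -> D s -> (forall u v, D u -> P u v) -> locally_2d P s t.
Proof.
  intros oD Hs HP. destruct (oD s Hs) as [d Hd].
  exists d. intros u v Hu _. apply HP, Hd, Hu.
Qed.

(** Openness of [D] gives equality on a neighbourhood in [s], as the derivative in [s] needs; in [t]
    the strip is the whole line. *)
Lemma Ck_ext (D : R -> Prop) (n : nat) : open D -> forall f g,
  (forall s t, D s -> f s t = g s t) -> Ck_strip D n f -> Ck_strip D n g.
Proof.
  intros oD. induction n as [|n IH]; intros f g Hfg Hf.
  - intros s t Hs. apply continuity_2d_pt_ext_loc with (2 := Hf s t Hs).
    now apply (locally_2d_strip D).
  - destruct Hf as [Hd [Hs Ht]].
    assert (Hl : forall s t, D s -> locally s (fun s' => f s' t = g s' t)).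
    { intros s t Ds. apply filter_imp with (2 := oD s Ds). intros; now apply Hfg. }
    split; [intros s t Ds; split | split].
    + apply (ex_derive_ext_loc (fun x => f x t) (fun x => g x t)); [now apply Hl | exact (proj1 (Hd s t Ds))].
    + apply (ex_derive_ext (f s) (g s)); [| exact (proj2 (Hd s t Ds))]. intros x; now apply Hfg.
    + apply IH with (2 := Hs). intros s t Ds. unfold partial_s.
      now apply Derive_ext_loc, Hl.
    + apply IH with (2 := Ht). intros s t Ds. unfold partial_t.
      apply Derive_ext. intros x; now apply Hfg.
Qed.

(** [Ck_strip] demands continuity only of the partial derivatives of top order. It descends to [f]
    because the existence of both partials, one of them (here [partial_s f]) being continuous,
    already gives differentiability. *)
Lemma Ck_continuous (D : R -> Prop) (f : R -> R -> R) :
  open D -> Ck_strip D 1 f -> Ck_strip D 0 f.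
Proof.
  intros oD [Hd [Hs _]] s t Ds.
  apply differentiable_continuity_pt.
  exists (partial_s f s t), (partial_t f s t).
  apply filterdiff_differentiable_pt_lim.
  apply (is_derive_filterdiff f s t (partial_s f) (partial_t f s t)).
  - destruct (oD s Ds) as [d Hb]. exists d. intros [u v] [Hu _].
    apply Derive_correct. exact (proj1 (Hd u v (Hb u Hu))).
  - apply Derive_correct. exact (proj2 (Hd s t Ds)).
  - apply continuity_2d_pt_filterlim, Hs, Ds.
Qed.

Lemma Ck_pred (D : R -> Prop) (n : nat) : open D -> forall f,
  Ck_strip D (S n) f -> Ck_strip D n f.
Proof.
  intros oD. induction n as [|n IH]; intros f Hf.
  - now apply Ck_continuous.
  - destruct Hf as [Hd [Hs Ht]]. split; [exact Hd |].
    split; now apply IH.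
Qed.

Lemma Ck_const (D : R -> Prop) (n : nat) : open D -> forall c,
  Ck_strip D n (fun _ _ => c).
Proof.
  intros oD. induction n as [|n IH]; intros c.
  - intros s t _. apply continuity_2d_pt_const.
  - split; [intros s t Ds; split; apply ex_derive_const | split].
    + apply (Ck_ext D n oD (fun _ _ => 0)); [| apply IH].
      intros s t _. unfold partial_s. now rewrite Derive_const.
    + apply (Ck_ext D n oD (fun _ _ => 0)); [| apply IH].
      intros s t _. unfold partial_t. now rewrite Derive_const.
Qed.

Lemma Ck_plus (D : R -> Prop) (n : nat) : open D -> forall f g,
  Ck_strip D n f -> Ck_strip D n g -> Ck_strip D n (fun s t => f s t + g s t).
Proof.
  intros oD. induction n as [|n IH]; intros f g Hf Hg.
  - intros s t Ds. apply continuity_2d_pt_plus; [now apply Hf | now apply Hg].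
  - destruct Hf as [Df [Fs Ft]], Hg as [Dg [Gs Gt]].
    split; [intros s t Ds; split | split].
    + apply (ex_derive_plus (fun s' => f s' t) (fun s' => g s' t)); [exact (proj1 (Df s t Ds)) | exact (proj1 (Dg s t Ds))].
    + apply (ex_derive_plus (f s) (g s)); [exact (proj2 (Df s t Ds)) | exact (proj2 (Dg s t Ds))].
    + apply (Ck_ext D n oD (fun s t => partial_s f s t + partial_s g s t)).
      * intros s t Ds. unfold partial_s.
        rewrite (Derive_plus (fun s' => f s' t) (fun s' => g s' t)); [reflexivity | exact (proj1 (Df s t Ds)) | exact (proj1 (Dg s t Ds))].
      * now apply IH.
    + apply (Ck_ext D n oD (fun s t => partial_t f s t + partial_t g s t)).
      * intros s t Ds. unfold partial_t.
        rewrite (Derive_plus (f s) (g s)); [reflexivity | exact (proj2 (Df s t Ds)) | exact (proj2 (Dg s t Ds))].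
      * now apply IH.
Qed.

(** Each term of the product rule still contains an undifferentiated factor, so the induction needs
    [f] and [g] themselves one order lower, which is [Ck_pred]. *)
Lemma Ck_mult (D : R -> Prop) (n : nat) : open D -> forall f g,
  Ck_strip D n f -> Ck_strip D n g -> Ck_strip D n (fun s t => f s t * g s t).
Proof.
  intros oD. induction n as [|n IH]; intros f g Hf Hg.
  - intros s t Ds. apply continuity_2d_pt_mult; [now apply Hf | now apply Hg].
  - pose proof (Ck_pred D n oD f Hf) as Pf. pose proof (Ck_pred D n oD g Hg) as Pg.
    destruct Hf as [Df [Fs Ft]], Hg as [Dg [Gs Gt]].
    split; [intros s t Ds; split | split].
    + apply (ex_derive_mult (fun s' => f s' t) (fun s' => g s' t)); [exact (proj1 (Df s t Ds)) | exact (proj1 (Dg s t Ds))].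
    + apply (ex_derive_mult (f s) (g s)); [exact (proj2 (Df s t Ds)) | exact (proj2 (Dg s t Ds))].
    + apply (Ck_ext D n oD (fun s t => partial_s f s t * g s t + f s t * partial_s g s t)).
      * intros s t Ds. unfold partial_s.
        rewrite (Derive_mult (fun s' => f s' t) (fun s' => g s' t)); [reflexivity | exact (proj1 (Df s t Ds)) | exact (proj1 (Dg s t Ds))].
      * apply Ck_plus; trivial; now apply IH.
    + apply (Ck_ext D n oD (fun s t => partial_t f s t * g s t + f s t * partial_t g s t)).
      * intros s t Ds. unfold partial_t.
        rewrite (Derive_mult (f s) (g s)); [reflexivity | exact (proj2 (Df s t Ds)) | exact (proj2 (Dg s t Ds))].
      * apply Ck_plus; trivial; now apply IH.
Qed.

Lemma Ck_inv (D : R -> Prop) (n : nat) : open D -> forall f,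
  (forall s t, D s -> f s t <> 0) ->
  Ck_strip D n f -> Ck_strip D n (fun s t => / f s t).
Proof.
  intros oD. induction n as [|n IH]; intros f Hn Hf.
  - intros s t Ds. apply continuity_2d_pt_inv; [now apply Hf | now apply Hn].
  - pose proof (IH f Hn (Ck_pred D n oD f Hf)) as Pf.
    destruct Hf as [Df [Fs Ft]].
    split; [intros s t Ds; split | split].
    + apply (ex_derive_inv (fun s' => f s' t)); [exact (proj1 (Df s t Ds)) | now apply Hn].
    + apply (ex_derive_inv (f s)); [exact (proj2 (Df s t Ds)) | now apply Hn].
    (* The derivative is written as a product, to which [Ck_mult] and the induction hypothesis for
       the reciprocal apply. *)
    + apply (Ck_ext D n oD (fun s t => -1 * partial_s f s t * (/ f s t * / f s t))).
      * intros s t Ds. unfold partial_s.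
        rewrite (Derive_inv (fun s' => f s' t)); [field | |]; try (now apply Hn). exact (proj1 (Df s t Ds)).
      * repeat apply Ck_mult; trivial. now apply Ck_const.
    + apply (Ck_ext D n oD (fun s t => -1 * partial_t f s t * (/ f s t * / f s t))).
      * intros s t Ds. unfold partial_t.
        rewrite (Derive_inv (f s)); [field | |]; try (now apply Hn). exact (proj2 (Df s t Ds)).
      * repeat apply Ck_mult; trivial. now apply Ck_const.
Qed.

Lemma Ck_sqrt (D : R -> Prop) (n : nat) : open D -> forall f,
  (forall s t, D s -> 0 < f s t) ->
  Ck_strip D n f -> Ck_strip D n (fun s t => sqrt (f s t)).
Proof.
  intros oD.
  assert (Hd : forall (h : R -> R) x, 0 < h x -> ex_derive h x ->
    is_derive (fun y => sqrt (h y)) x (/ 2 * Derive h x * / sqrt (h x))).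
  { intros h x Hp He. assert (0 < sqrt (h x)) by now apply sqrt_lt_R0.
    auto_derive; [now split | change (Derive (fun x0 => h x0) x) with (Derive h x); field; lra]. }
  induction n as [|n IH]; intros f Hp Hf.
  - intros s t Ds. apply (continuity_1d_2d_pt_comp sqrt f); [| now apply Hf].
    apply continuity_pt_sqrt. left. now apply Hp.
  - pose proof (IH f Hp (Ck_pred D n oD f Hf)) as Pf.
    destruct Hf as [Df [Fs Ft]].
    assert (Hn : forall s t, D s -> sqrt (f s t) <> 0).
    { intros s t Ds. apply Rgt_not_eq, sqrt_lt_R0. now apply Hp. }
    split; [intros s t Ds; split | split].
    + eexists. apply (Hd (fun s' => f s' t)); [now apply Hp | exact (proj1 (Df s t Ds))].
    + eexists. apply (Hd (f s)); [now apply Hp | exact (proj2 (Df s t Ds))].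
    + apply (Ck_ext D n oD (fun s t => / 2 * partial_s f s t * / sqrt (f s t))).
      * intros s t Ds. unfold partial_s. symmetry. apply is_derive_unique.
        apply (Hd (fun s' => f s' t)); [now apply Hp | exact (proj1 (Df s t Ds))].
      * repeat apply Ck_mult; trivial; [now apply Ck_const | now apply Ck_inv].
    + apply (Ck_ext D n oD (fun s t => / 2 * partial_t f s t * / sqrt (f s t))).
      * intros s t Ds. unfold partial_t. symmetry. apply is_derive_unique.
        apply (Hd (f s)); [now apply Hp | exact (proj2 (Df s t Ds))].
      * repeat apply Ck_mult; trivial; [now apply Ck_const | now apply Ck_inv].
Qed.

Lemma smooth_Derive f : smooth f -> smooth (Derive f).
Proof.
  intros Hf n t. destruct n as [|n]; [exact I |].
  apply ex_derive_ext with (Derive_n f (S n)); [| apply (Hf (S (S n)))].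
  intros x. change (Derive f) with (Derive_n f 1).
  rewrite Derive_n_comp. f_equal. lia.
Qed.

Lemma smooth_ex_derive f t : smooth f -> ex_derive f t.
Proof. intros Hf. exact (Hf 1%nat t). Qed.

Lemma smooth_continuous f t : smooth f -> continuous f t.
Proof.
  intros Hf. apply (ex_derive_continuous (K := R_AbsRing) (V := R_NormedModule)).
  now apply smooth_ex_derive.
Qed.

Lemma Ck_slice (D : R -> Prop) (n : nat) : open D -> forall f s t,
  D s -> Ck_strip D n f -> ex_derive_n (f s) n t.
Proof.
  intros oD. induction n as [|n IH]; intros f s t Ds Hf; [exact I |].
  destruct Hf as [Hd [_ Ht]].
  destruct n as [|n]; [exact (proj2 (Hd s t Ds)) |].
  specialize (IH _ s t Ds Ht). simpl in IH |- *.
  apply ex_derive_ext with (2 := IH).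
  intros x. change (partial_t f s) with (Derive_n (f s) 1).
  rewrite Derive_n_comp. replace (n + 1)%nat with (S n) by lia. reflexivity.
Qed.

Lemma Ck_of_smooth (D : R -> Prop) (n : nat) : open D -> forall f,
  smooth f -> Ck_strip D n (fun _ t => f t).
Proof.
  intros oD. induction n as [|n IH]; intros f Hf.
  - intros s t Ds. apply (continuity_1d_2d_pt_comp f (fun _ v => v)).
    + apply continuity_pt_filterlim. apply (smooth_continuous f t Hf).
    + apply continuity_2d_pt_id2.
  - split; [intros s t Ds; split | split].
    + apply ex_derive_const.
    + now apply smooth_ex_derive.
    + apply (Ck_ext D n oD (fun _ _ => 0)); [| now apply Ck_const].
      intros s t _. unfold partial_s. now rewrite Derive_const.
    + apply (IH (Derive f)). now apply smooth_Derive.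
Qed.

Lemma Ck_subset (D E : R -> Prop) (n : nat) : (forall s, E s -> D s) -> forall f,
  Ck_strip D n f -> Ck_strip E n f.
Proof.
  intros HDE. induction n as [|n IH]; intros f Hf.
  - intros s t Es. now apply Hf, HDE.
  - destruct Hf as [Hd [Hs Ht]]. split; [intros s t Es; exact (Hd s t (HDE s Es)) | split; now apply IH].
Qed.

(** Regularity of every order is assumed because the two partials behave differently: the one in [s]
    passes under the integral and uses up an order of [f], while the one in [t] gives back [f]. Only
    the base case, joint continuity, requires an estimate. *)
Lemma Ck_RInt (D : R -> Prop) (n : nat) : open D -> forall f,
  (forall k, Ck_strip D k f) -> Ck_strip D n (fun s t => RInt (f s) 0 t).
Proof.
  intros oD.
  assert (Hc : forall f s t, Ck_strip D 0 f -> D s -> continuous (f s) t).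
  { intros f s t Hf Ds. apply continuity_pt_filterlim. intros e He.
    destruct (Hf s t Ds (mkposreal e He)) as [d Hd].
    exists d. split; [apply cond_pos |]. intros x [_ Hx].
    apply (Hd s x); [rewrite Rminus_diag, Rabs_R0; apply cond_pos | exact Hx]. }
  assert (Hi : forall f s a b, Ck_strip D 0 f -> D s -> ex_RInt (f s) a b).
  { intros f s a b Hf Ds. apply (ex_RInt_continuous (V := R_CompleteNormedModule)). intros; now apply Hc. }
  assert (Hds : forall f s t, Ck_strip D 1 f -> D s ->
    is_derive (fun s' => RInt (f s') 0 t) s (RInt (partial_s f s) 0 t)).
  { intros f s t Hf Ds. pose proof (Ck_pred D 0 oD f Hf) as Pf.
    destruct Hf as [Df [Fs Ft]].
    apply (is_derive_RInt_param f 0 t s).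
    - apply filter_imp with (2 := oD s Ds). intros x Dx u _. exact (proj1 (Df x u Dx)).
    - intros u _. now apply Fs.
    - apply filter_imp with (2 := oD s Ds). intros x Dx. now apply Hi. }
  assert (Hdt : forall f s t, Ck_strip D 0 f -> D s ->
    is_derive (fun x => RInt (f s) 0 x) t (f s t)).
  { intros f s t Hf Ds. apply (is_derive_RInt (f s) _ 0 t).
    - apply filter_forall. intros x. apply (RInt_correct (V := R_CompleteNormedModule)). now apply Hi.
    - now apply Hc. }
  induction n as [|n IH]; intros f Hf.
  - intros s t Ds eps.
    pose proof (Hf 0%nat s t Ds (mkposreal 1 Rlt_0_1)) as [d1 Hd1]. simpl in Hd1.
    assert (Hcs : continuous (fun s' => RInt (f s') 0 t) s).
    { apply (ex_derive_continuous (K := R_AbsRing) (V := R_NormedModule)). eexists. apply Hds; trivial. }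
    assert (He2 : 0 < eps / 2) by (pose proof (cond_pos eps); lra).
    apply continuity_pt_filterlim in Hcs.
    destruct (Hcs (eps / 2) He2) as [d2 [Hd2p Hd2]].
    destruct (oD s Ds) as [d3 Hd3].
    (* [m] bounds [f] near [(s, t)], where [f] moves by less than 1. The increment splits into a
       change of [u] with fixed bounds, controlled by differentiability in the parameter, and an
       integral from [t] to [v], at most [m] times the length of that interval. *)
    set (m := 1 + Rabs (f s t)).
    assert (Hm : 0 < m) by (unfold m; pose proof (Rabs_pos (f s t)); lra).
    assert (Hd : 0 < Rmin (Rmin d1 d2) (Rmin d3 (eps / 2 / m))).
    { repeat apply Rmin_pos; trivial; try apply cond_pos. now apply Rdiv_lt_0_compat. }
    exists (mkposreal _ Hd). simpl. intros u v Hu Hv.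
    pose proof (Rmin_l (Rmin d1 d2) (Rmin d3 (eps / 2 / m))).
    pose proof (Rmin_r (Rmin d1 d2) (Rmin d3 (eps / 2 / m))).
    pose proof (Rmin_l d1 d2). pose proof (Rmin_r d1 d2).
    pose proof (Rmin_l d3 (eps / 2 / m)). pose proof (Rmin_r d3 (eps / 2 / m)).
    assert (Du : D u). { apply Hd3. apply Rlt_le_trans with (1 := Hu). lra. }
    assert (HA : Rabs (RInt (f u) 0 t - RInt (f s) 0 t) < eps / 2).
    { destruct (Req_dec u s) as [-> | Hne].
      - rewrite Rminus_diag, Rabs_R0. lra.
      - apply (Hd2 u). split; [split; [exact I | congruence] |].
        apply Rlt_le_trans with (1 := Hu). lra. }
    assert (HB : Rabs (RInt (f u) t v) <= Rabs (v - t) * m).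
    { assert (Hb : forall x, Rmin t v <= x <= Rmax t v -> Rabs (f u x) <= m).
      { intros x Hx. unfold m.
        assert (Rabs (f u x - f s t) < 1).
        { apply Hd1; [lra |].
          apply Rle_lt_trans with (Rabs (v - t)); [| lra].
          unfold Rmin, Rmax in Hx. destruct (Rle_dec t v); unfold Rabs; repeat destruct Rcase_abs; lra. }
        replace (f u x) with (f u x - f s t + f s t) by ring.
        eapply Rle_trans; [apply Rabs_triang |]. lra. }
      destruct (Rle_dec t v) as [Htv | Htv].
      - rewrite (Rabs_right (v - t)) by lra.
        apply abs_RInt_le_const; trivial; [now apply Hi |].
        intros x Hx. apply Hb. rewrite Rmin_left, Rmax_right; lra.
      - rewrite <- opp_RInt_swap by now apply Hi.
        unfold opp; simpl. rewrite Rabs_Ropp, Rabs_minus_sym, (Rabs_right (t - v)) by lra.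
        apply abs_RInt_le_const; [lra | now apply Hi |].
        intros x Hx. apply Hb. rewrite Rmin_right, Rmax_left; lra. }
    replace (RInt (f u) 0 v) with (RInt (f u) 0 t + RInt (f u) t v).
    2:{ apply (RInt_Chasles (V := R_CompleteNormedModule)); now apply Hi. }
    replace (RInt (f u) 0 t + RInt (f u) t v - RInt (f s) 0 t)
      with ((RInt (f u) 0 t - RInt (f s) 0 t) + RInt (f u) t v) by ring.
    eapply Rle_lt_trans; [apply Rabs_triang |].
    assert (Rabs (v - t) * m < eps / 2).
    { replace (eps / 2) with (eps / 2 / m * m) by (field; lra).
      apply Rmult_lt_compat_r; lra. }
    lra.
  - split; [intros s t Ds; split | split].
    + eexists. apply Hds; trivial.
    + eexists. apply Hdt; trivial.
    + apply (Ck_ext D n oD (fun s t => RInt (partial_s f s) 0 t)).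
      * intros s t Ds. symmetry. apply is_derive_unique, Hds; trivial.
      * apply IH. intros k. apply (Hf (S k)).
    + apply (Ck_ext D n oD f); trivial.
      intros s t Ds. symmetry. apply is_derive_unique, Hdt; trivial.
Qed.

Lemma open_ball_R (s0 : R) (eps : posreal) : open (ball s0 eps : R -> Prop).
Proof.
  intros s Hs. unfold ball in *; simpl in *. unfold AbsRing_ball, abs, minus, plus, opp in *; simpl in *.
  assert (Hp : 0 < eps - Rabs (s + - s0)) by lra.
  exists (mkposreal _ Hp). intros y Hy. unfold ball in *; simpl in *.
  unfold AbsRing_ball, abs, minus, plus, opp in *; simpl in *.
  replace (y + - s0) with ((y + - s) + (s + - s0)) by ring.
  eapply Rle_lt_trans; [apply Rabs_triang |]. lra.
Qed.

Lemma ball_shrink (s0 : R) (e1 e2 : posreal) (s : R) :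
  e2 <= e1 -> ball s0 e2 s -> ball s0 e1 s.
Proof. intros He Hs. apply ball_le with (2 := Hs). exact He. Qed.

Definition posmin (e1 e2 : posreal) : posreal :=
  mkposreal (Rmin e1 e2) (Rmin_stable_in_posreal e1 e2).

Lemma smooth_family_shrink s0 f (P : R -> Prop) :
  smooth_family s0 f -> locally s0 P ->
  exists eps : posreal, (forall s, ball s0 eps s -> P s) /\ forall n, Ck_strip (ball s0 eps) n f.
Proof.
  intros [e1 H1] [e2 H2]. exists (posmin e1 e2). split.
  - intros s Hs. apply H2. apply (ball_shrink s0 e2 (posmin e1 e2)); trivial. apply Rmin_r.
  - intros n. apply Ck_subset with (2 := H1 n). intros s Hs.
    apply (ball_shrink s0 e1 (posmin e1 e2)); trivial. apply Rmin_l.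
Qed.

Lemma smooth_family_pair s0 f g :
  smooth_family s0 f -> smooth_family s0 g ->
  exists eps : posreal, (forall n, Ck_strip (ball s0 eps) n f) /\
    (forall n, Ck_strip (ball s0 eps) n g).
Proof.
  intros [e1 H1] [e2 H2]. exists (posmin e1 e2). split.
  - intros n. apply Ck_subset with (2 := H1 n). intros s Hs.
    apply (ball_shrink s0 e1 (posmin e1 e2)); trivial. apply Rmin_l.
  - intros n. apply Ck_subset with (2 := H2 n). intros s Hs.
    apply (ball_shrink s0 e2 (posmin e1 e2)); trivial. apply Rmin_r.
Qed.

Lemma smooth_family_ext s0 f g :
  locally s0 (fun s => forall t, f s t = g s t) -> smooth_family s0 f -> smooth_family s0 g.
Proof.
  intros He Hf. destruct (smooth_family_shrink _ _ _ Hf He) as [e [H1 H2]].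
  exists e. intros n. apply (Ck_ext _ _ (open_ball_R s0 e) f); [| apply H2].
  intros s t Hs. now apply H1.
Qed.

Lemma smooth_family_of_smooth s0 f : smooth f -> smooth_family s0 (fun _ t => f t).
Proof. intros Hf. exists (mkposreal 1 Rlt_0_1). intros n. apply Ck_of_smooth; trivial. apply open_ball_R. Qed.

Lemma smooth_family_const s0 c : smooth_family s0 (fun _ _ => c).
Proof. exists (mkposreal 1 Rlt_0_1). intros n. apply Ck_const. apply open_ball_R. Qed.

Lemma smooth_family_plus s0 f g : smooth_family s0 f -> smooth_family s0 g ->
  smooth_family s0 (fun s t => f s t + g s t).
Proof.
  intros Hf Hg. destruct (smooth_family_pair _ _ _ Hf Hg) as [e [H1 H2]].
  exists e. intros n. apply Ck_plus; trivial. apply open_ball_R.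
Qed.

Lemma smooth_family_mult s0 f g : smooth_family s0 f -> smooth_family s0 g ->
  smooth_family s0 (fun s t => f s t * g s t).
Proof.
  intros Hf Hg. destruct (smooth_family_pair _ _ _ Hf Hg) as [e [H1 H2]].
  exists e. intros n. apply Ck_mult; trivial. apply open_ball_R.
Qed.

Lemma smooth_family_opp s0 f : smooth_family s0 f -> smooth_family s0 (fun s t => - f s t).
Proof.
  intros Hf. apply smooth_family_ext with (fun s t => (-1) * f s t).
  - apply filter_forall. intros; ring.
  - apply smooth_family_mult; trivial. apply smooth_family_const.
Qed.

Lemma smooth_family_minus s0 f g : smooth_family s0 f -> smooth_family s0 g ->
  smooth_family s0 (fun s t => f s t - g s t).
Proof. intros Hf Hg. apply smooth_family_plus; trivial. now apply smooth_family_opp. Qed.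

Lemma smooth_family_inv s0 f : smooth_family s0 f ->
  locally s0 (fun s => forall t, f s t <> 0) -> smooth_family s0 (fun s t => / f s t).
Proof.
  intros Hf He. destruct (smooth_family_shrink _ _ _ Hf He) as [e [H1 H2]].
  exists e. intros n. apply Ck_inv; trivial; [apply open_ball_R |]. intros; now apply H1.
Qed.

Lemma smooth_family_sqrt s0 f : smooth_family s0 f ->
  locally s0 (fun s => forall t, 0 < f s t) -> smooth_family s0 (fun s t => sqrt (f s t)).
Proof.
  intros Hf He. destruct (smooth_family_shrink _ _ _ Hf He) as [e [H1 H2]].
  exists e. intros n. apply Ck_sqrt; trivial; [apply open_ball_R |]. intros; now apply H1.
Qed.

Lemma smooth_family_partial_s s0 f : smooth_family s0 f -> smooth_family s0 (partial_s f).
Proof. intros [e H1]. exists e. intros n. apply (H1 (S n)). Qed.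

Lemma smooth_family_partial_t s0 f : smooth_family s0 f -> smooth_family s0 (partial_t f).
Proof. intros [e H1]. exists e. intros n. apply (H1 (S n)). Qed.

Lemma smooth_family_RInt s0 f : smooth_family s0 f ->
  smooth_family s0 (fun s t => RInt (f s) 0 t).
Proof. intros [e H1]. exists e. intros n. apply Ck_RInt; trivial. apply open_ball_R. Qed.

(** Freezing [t] keeps the speed at one time smooth in [s]; this provides the smooth rescaling
    factor for curves of framed loops. *)
Lemma Ck_at (D : R -> Prop) (n : nat) t0 : open D -> forall f,
  Ck_strip D n f -> Ck_strip D n (fun s _ => f s t0).
Proof.
  intros oD. induction n as [|n IH]; intros f Hf.
  - intros s t Ds eps. destruct (Hf s t0 Ds eps) as [d Hd]. exists d.
    intros u v Hu _. apply Hd; trivial. rewrite Rminus_diag, Rabs_R0. apply cond_pos.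
  - destruct Hf as [Hd [Hs Ht]]. split; [intros s t Ds; split | split].
    + exact (proj1 (Hd s t0 Ds)).
    + apply ex_derive_const.
    + apply (IH _ Hs).
    + apply (Ck_ext D n oD (fun _ _ => 0)); [| now apply Ck_const].
      intros s t _. unfold partial_t. now rewrite Derive_const.
Qed.

Lemma smooth_family_at s0 f t0 : smooth_family s0 f -> smooth_family s0 (fun s _ => f s t0).
Proof. intros [e H1]. exists e. intros n. apply Ck_at; trivial. apply open_ball_R. Qed.

Lemma locally_ball_R (s0 : R) (e : posreal) : locally s0 (ball s0 e : R -> Prop).
Proof. now exists e. Qed.

Lemma smooth_family_slice s0 f : smooth_family s0 f -> locally s0 (fun s => smooth (f s)).
Proof.
  intros [e H1]. exists e. intros s Hs n t.
  apply (Ck_slice _ n (open_ball_R s0 e)); trivial.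
Qed.

Lemma smooth_family_slice0 s0 f : smooth_family s0 f -> smooth (f s0).
Proof. intros Hf. exact (locally_singleton _ _ (smooth_family_slice s0 f Hf)). Qed.

Lemma smooth_family_continuity s0 f t : smooth_family s0 f -> continuity_2d_pt f s0 t.
Proof. intros [e H1]. apply (H1 0%nat). apply ball_center. Qed.

Lemma smooth_family_ex_derive s0 f t : smooth_family s0 f -> ex_derive (fun s => f s t) s0.
Proof. intros [e H1]. exact (proj1 (proj1 (H1 1%nat) s0 t (ball_center s0 e))). Qed.

Lemma smooth_family_is_derive_RInt s0 f a b : smooth_family s0 f ->
  is_derive (fun s => RInt (f s) a b) s0 (RInt (fun t => Derive (fun s => f s t) s0) a b).
Proof.
  intros [e H1]. apply (is_derive_RInt_param f a b s0).
  - exists e. intros s Hs t _. exact (proj1 (proj1 (H1 1%nat) s t Hs)).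
  - intros t _. exact (proj1 (proj2 (H1 1%nat)) s0 t (ball_center s0 e)).
  - exists e. intros s Hs. apply (ex_RInt_continuous (V := R_CompleteNormedModule)).
    intros t _. apply smooth_continuous. intros n x.
    apply (Ck_slice _ n (open_ball_R s0 e)); trivial.
Qed.

(** The rules for one variable are read off those for families, applied to families constant in
    [s]. *)
Lemma smooth_const c : smooth (fun _ => c).
Proof. exact (smooth_family_slice0 0 _ (smooth_family_const 0 c)). Qed.

Lemma smooth_plus f g : smooth f -> smooth g -> smooth (fun t => f t + g t).
Proof.
  intros Hf Hg. apply (smooth_family_slice0 0 (fun _ t => f t + g t)).
  apply smooth_family_plus; now apply smooth_family_of_smooth.
Qed.

Lemma smooth_mult f g : smooth f -> smooth g -> smooth (fun t => f t * g t).
Proof.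
  intros Hf Hg. apply (smooth_family_slice0 0 (fun _ t => f t * g t)).
  apply smooth_family_mult; now apply smooth_family_of_smooth.
Qed.

Lemma smooth_opp f : smooth f -> smooth (fun t => - f t).
Proof.
  intros Hf. apply (smooth_family_slice0 0 (fun _ t => - f t)).
  apply smooth_family_opp; now apply smooth_family_of_smooth.
Qed.

Lemma smooth_minus f g : smooth f -> smooth g -> smooth (fun t => f t - g t).
Proof. intros Hf Hg. apply smooth_plus; trivial. now apply smooth_opp. Qed.

Lemma smooth_ext f g : (forall t, f t = g t) -> smooth f -> smooth g.
Proof. intros He Hf n t. apply ex_derive_n_ext with (2 := Hf n t). exact He. Qed.

Lemma smooth_continuity f : smooth f -> continuity f.
Proof. intros Hf t. apply continuity_pt_filterlim, (smooth_continuous f t Hf). Qed.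

Lemma smooth_ex_RInt f a b : smooth f -> ex_RInt f a b.
Proof.
  intros Hf. apply (ex_RInt_continuous (V := R_CompleteNormedModule)).
  intros t _. now apply smooth_continuous.
Qed.

Ltac smf := repeat match goal with
  | H : smooth_family ?s0 ?f |- smooth_family ?s0 ?f => exact H
  | |- smooth_family _ (fun _ _ => ?c) => apply (smooth_family_const _ c)
  | |- smooth_family _ (fun s t => @?f s t + @?g s t) => apply (smooth_family_plus _ f g)
  | |- smooth_family _ (fun s t => @?f s t - @?g s t) => apply (smooth_family_minus _ f g)
  | |- smooth_family _ (fun s t => @?f s t * @?g s t) => apply (smooth_family_mult _ f g)
  | |- smooth_family _ (fun s t => - @?f s t) => apply (smooth_family_opp _ f)
  end; try assumption.

Ltac sm1 := repeat match goal with
  | H : smooth ?f |- smooth ?f => exact H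
  | |- smooth (fun _ => ?c) => apply (smooth_const c)
  | |- smooth (fun t => @?f t + @?g t) => apply (smooth_plus f g)
  | |- smooth (fun t => @?f t - @?g t) => apply (smooth_minus f g)
  | |- smooth (fun t => @?f t * @?g t) => apply (smooth_mult f g)
  | |- smooth (fun t => - @?f t) => apply (smooth_opp f)
  end; try assumption.

(** Unification would otherwise unfold these down to [is_derive]. *)
Opaque smooth smooth_family.

(** * Rotations of R^3 *)

Tactic Notation "vunfold" :=
  unfold Hopf, qvec, qmul, qconj, qi, qj, qk, mapp, mscal, vadd, vscal, dot, cross, v0, vx, vy, vz,
    Cmult, Cminus, Cplus, Copp, Cconj, Ci, RtoC, Re, Im; simpl.
Tactic Notation "vunfold" "in" hyp(h) :=
  unfold Hopf, qvec, qmul, qconj, qi, qj, qk, mapp, mscal, vadd, vscal, dot, cross, v0, vx, vy, vz,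
    Cmult, Cminus, Cplus, Copp, Cconj, Ci, RtoC, Re, Im in h; simpl in h.
Ltac pairs := repeat match goal with |- (_, _) = (_, _) => apply f_equal2 end.
Ltac veq := vunfold; pairs; ring.

Definition col1 (A : M3) : V3 := fst (fst A).
Definition col2 (A : M3) : V3 := snd (fst A).
Definition col3 (A : M3) : V3 := snd A.

Definition mmul (A B : M3) : M3 := (mapp A (col1 B), mapp A (col2 B), mapp A (col3 B)).

Definition mtrans (A : M3) : M3 :=
  let '((a1, a2, a3), (b1, b2, b3), (c1, c2, c3)) := A in
  ((a1, b1, c1), (a2, b2, c2), (a3, b3, c3)).

Lemma V3_ext (u v : V3) : vx u = vx v -> vy u = vy v -> vz u = vz v -> u = v.
Proof. destruct u as [[a b] c], v as [[a' b'] c']. unfold vx, vy, vz; simpl. congruence. Qed.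

Lemma dot_comm (u v : V3) : dot u v = dot v u.
Proof. unfold dot. ring. Qed.

Lemma dot_self_eq0 (v : V3) : dot v v = 0 -> v = v0.
Proof.
  destruct v as [[a b] c]. vunfold. intros Hd.
  assert (a = 0) by nra. assert (b = 0) by nra. assert (c = 0) by nra. now subst.
Qed.

(** Equality case of Cauchy-Schwarz: the three values make [u - v] a vector of length zero. *)
Lemma V3_eq_of_dot (u v : V3) : dot u u = 1 -> dot v v = 1 -> dot u v = 1 -> u = v.
Proof.
  intros Hu Hv Huv.
  assert (Hd : vadd u (vscal (-1) v) = v0).
  { apply dot_self_eq0.
    replace (dot _ _) with (dot u u + dot v v - 2 * dot u v) by (vunfold; ring). lra. }
  destruct u as [[a b] c], v as [[a' b'] c']. vunfold in Hd.
  injection Hd. intros. pairs; lra.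
Qed.

Lemma mapp_vadd A u v : mapp A (vadd u v) = vadd (mapp A u) (mapp A v).
Proof. veq. Qed.

Lemma mapp_vscal A r v : mapp A (vscal r v) = vscal r (mapp A v).
Proof. veq. Qed.

Lemma mapp_mmul A B v : mapp (mmul A B) v = mapp A (mapp B v).
Proof. unfold mmul, col1, col2, col3. veq. Qed.

Lemma dot_mapp A u v : SO3 A -> dot (mapp A u) (mapp A v) = dot u v.
Proof.
  destruct A as [[a b] c]. intros (Ha & Hb & Hc & Hab & Hac & Hbc & _).
  transitivity (vx u * vx v * dot a a + vy u * vy v * dot b b + vz u * vz v * dot c c
    + (vx u * vy v + vy u * vx v) * dot a b + (vx u * vz v + vz u * vx v) * dot a c
    + (vy u * vz v + vz u * vy v) * dot b c).
  - vunfold. ring.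
  - rewrite Ha, Hb, Hc, Hab, Hac, Hbc. unfold dot. ring.
Qed.

Lemma dot_cross_self (a b : V3) : dot (cross a b) (cross a b) = dot a a * dot b b - dot a b * dot a b.
Proof. vunfold. ring. Qed.

(** [cross a b] is a unit vector by the Lagrange identity and has product 1 with [c] by the
    determinant condition, so [V3_eq_of_dot] identifies them; the cyclic versions have the same
    triple product. *)
Lemma SO3_cross a b c : SO3 (a, b, c) -> cross a b = c /\ cross b c = a /\ cross c a = b.
Proof.
  intros (Ha & Hb & Hc & Hab & Hac & Hbc & Hd).
  repeat split; apply V3_eq_of_dot; trivial;
    try (rewrite dot_cross_self).
  - rewrite Ha, Hb, Hab. ring.
  - rewrite Hb, Hc, Hbc. ring.
  - rewrite <- Hd. vunfold; ring.
  - rewrite (dot_comm c a). rewrite Ha, Hc, Hac. ring.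
  - rewrite <- Hd. vunfold; ring.
Qed.

(** For any matrix, the product of two images is the cofactor matrix applied to [cross u v]. The
    columns of the cofactor matrix are the cross products of the columns, which for a rotation are
    the columns of [A] again. *)
Lemma cross_mapp A u v : SO3 A -> cross (mapp A u) (mapp A v) = mapp A (cross u v).
Proof.
  intros HA. destruct A as [[a b] c]. destruct (SO3_cross a b c HA) as (Hc & Ha & Hb).
  transitivity (mapp (cross b c, cross c a, cross a b) (cross u v)).
  - veq.
  - now rewrite Hc, Ha, Hb.
Qed.

Lemma SO3_mmul A B : SO3 A -> SO3 B -> SO3 (mmul A B).
Proof.
  intros HA HB. destruct B as [[a b] c]. unfold mmul, col1, col2, col3; simpl.
  destruct HB as (Ha & Hb & Hc & Hab & Hac & Hbc & Hd).
  unfold SO3. now rewrite cross_mapp, !dot_mapp.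
Qed.

Lemma mapp_mtrans_l A v : SO3 A -> mapp (mtrans A) (mapp A v) = v.
Proof.
  destruct A as [[a b] c]. intros (Ha & Hb & Hc & Hab & Hac & Hbc & _).
  apply V3_ext.
  - transitivity (dot a a * vx v + dot a b * vy v + dot a c * vz v).
    + destruct a as [[a1 a2] a3], b as [[b1 b2] b3], c as [[c1 c2] c3]. unfold mtrans. vunfold. ring.
    + rewrite Ha, Hab, Hac. ring.
  - transitivity (dot a b * vx v + dot b b * vy v + dot b c * vz v).
    + destruct a as [[a1 a2] a3], b as [[b1 b2] b3], c as [[c1 c2] c3]. unfold mtrans. vunfold. ring.
    + rewrite Hab, Hb, Hbc. ring.
  - transitivity (dot a c * vx v + dot b c * vy v + dot c c * vz v).
    + destruct a as [[a1 a2] a3], b as [[b1 b2] b3], c as [[c1 c2] c3]. unfold mtrans. vunfold. ring.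
    + rewrite Hac, Hbc, Hc. ring.
Qed.

(** Orthonormal columns only give the left inverse. On the other side [A] is replaced by its
    cofactor matrix, whose product with the transpose is the determinant times the identity. *)
Lemma mapp_mtrans_r A v : SO3 A -> mapp A (mapp (mtrans A) v) = v.
Proof.
  intros HA. destruct A as [[a b] c]. destruct (SO3_cross a b c HA) as (Hc & Ha & Hb).
  destruct HA as (_ & _ & _ & _ & _ & _ & Hd).
  transitivity (mapp (cross b c, cross c a, cross a b) (mapp (mtrans (a, b, c)) v)).
  { now rewrite Hc, Ha, Hb. }
  transitivity (vscal (dot (cross a b) c) v).
  - destruct a as [[a1 a2] a3], b as [[b1 b2] b3], c as [[c1 c2] c3]. unfold mtrans. veq.
  - rewrite Hd. destruct v as [[x y] z]. veq.
Qed.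

Lemma dot_mtrans A u v : dot (mapp (mtrans A) u) v = dot u (mapp A v).
Proof. destruct A as [[[[a1 a2] a3] [[b1 b2] b3]] [[c1 c2] c3]]. unfold mtrans. vunfold. ring. Qed.

Lemma SO3_mtrans A : SO3 A -> SO3 (mtrans A).
Proof.
  intros HA.
  assert (Hd : forall u v, dot (mapp (mtrans A) u) (mapp (mtrans A) v) = dot u v).
  { intros u v. rewrite dot_mtrans. now rewrite mapp_mtrans_r. }
  assert (He : mtrans A = (mapp (mtrans A) (1, 0, 0), mapp (mtrans A) (0, 1, 0), mapp (mtrans A) (0, 0, 1))).
  { destruct (mtrans A) as [[[[a1 a2] a3] [[b1 b2] b3]] [[c1 c2] c3]]. veq. }
  rewrite He. unfold SO3. rewrite !Hd.
  repeat split; try (vunfold; ring).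
  destruct A as [[a b] c]. destruct HA as (_ & _ & _ & _ & _ & _ & HA).
  transitivity (dot (cross a b) c); [clear | exact HA].
  destruct a as [[a1 a2] a3], b as [[b1 b2] b3], c as [[c1 c2] c3].
  unfold mtrans. vunfold. ring.
Qed.

Lemma vnorm_mapp A v : SO3 A -> vnorm (mapp A v) = vnorm v.
Proof. intros HA. unfold vnorm. now rewrite dot_mapp. Qed.

Lemma vnorm_eq1 v : vnorm v = 1 <-> dot v v = 1.
Proof.
  unfold vnorm. split; intros E.
  - assert (Hp : 0 <= dot v v) by (destruct v as [[a b] c]; vunfold; nra).
    rewrite <- (sqrt_sqrt _ Hp), E. ring.
  - rewrite E. apply sqrt_1.
Qed.

Lemma vnorm_vscal r v : vnorm (vscal r v) = Rabs r * vnorm v.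
Proof.
  unfold vnorm. replace (dot (vscal r v) (vscal r v)) with (Rsqr r * dot v v) by (unfold Rsqr; vunfold; ring).
  rewrite sqrt_mult_alt by apply Rle_0_sqr. now rewrite sqrt_Rsqr_abs.
Qed.

Lemma SO3_1 : SO3 ((1, 0, 0), (0, 1, 0), (0, 0, 1)).
Proof. unfold SO3. repeat split; vunfold; ring. Qed.

Lemma mapp_1 v : mapp ((1, 0, 0), (0, 1, 0), (0, 0, 1)) v = v.
Proof. destruct v as [[a b] c]. veq. Qed.

Lemma vadd_1_0 v w : vadd (vscal 1 v) (vscal 0 w) = v.
Proof. destruct v as [[a b] c], w as [[d e] f]. veq. Qed.

Lemma vscal_1 v : vscal 1 v = v.
Proof. destruct v as [[a b] c]. veq. Qed.

Lemma vscal_vscal r s v : vscal r (vscal s v) = vscal (r * s) v.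
Proof. veq. Qed.

(** * Unit quaternions and frames *)

(** Left multiplication by the quaternion [u + 0 j]; it commutes with right multiplication by
    quaternions. *)
Definition umul (u : C) (q : C2) : C2 := (Cmult u (fst q), Cmult u (snd q)).

Lemma Hopf_coord (a b c d : R) : Hopf ((a, b), (c, d)) =
  ((a * a + b * b - c * c - d * d, 2 * (b * c - a * d), 2 * (b * d + a * c)),
   (2 * (b * c + a * d), a * a - b * b + c * c - d * d, 2 * (c * d - a * b)),
   (2 * (b * d - a * c), 2 * (c * d + a * b), a * a - b * b - c * c + d * d)).
Proof. veq. Qed.

Lemma qmul_coord (a b c d a' b' c' d' : R) : qmul ((a, b), (c, d)) ((a', b'), (c', d')) =
  ((a * a' - b * b' - c * c' - d * d', a * b' + b * a' + c * d' - d * c'),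
   (a * c' - b * d' + c * a' + d * b', a * d' + b * c' - c * b' + d * a')).
Proof. veq. Qed.

Lemma sqnorm_coord (a b c d : R) : sqnorm ((a, b), (c, d)) = a * a + b * b + c * c + d * d.
Proof.
  unfold sqnorm, Cmod. simpl fst; simpl snd.
  rewrite !pow2_sqrt by nra. ring.
Qed.

Lemma sqnorm_qmul p q : sqnorm (qmul p q) = sqnorm p * sqnorm q.
Proof.
  destruct p as [[a b] [c d]], q as [[a' b'] [c' d']]. rewrite qmul_coord, !sqnorm_coord. ring.
Qed.

Lemma sqnorm_umul u q : sqnorm (umul u q) = Cmod u ^ 2 * sqnorm q.
Proof. unfold sqnorm, umul; simpl fst; simpl snd. rewrite !Cmod_mult. ring. Qed.

Lemma sqnorm_qconj q : sqnorm (qconj q) = sqnorm q.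
Proof. unfold sqnorm, qconj; simpl fst; simpl snd. now rewrite Cmod_conj, Cmod_opp. Qed.

Lemma Cmod_sqr (u : C) : Cmod u ^ 2 = Re u * Re u + Im u * Im u.
Proof. unfold Cmod, Re, Im. rewrite pow2_sqrt by nra. ring. Qed.

(** Conjugation reverses products: [conj (q p) i (q p)] is [conj p (conj q i q) p]. Hence right
    multiplication by a unit quaternion rotates the whole frame in space. *)
Lemma Hopf_qmul q p : Hopf (qmul q p) = mmul (Hopf p) (Hopf q).
Proof.
  destruct p as [[a b] [c d]], q as [[a' b'] [c' d']]. rewrite qmul_coord, !Hopf_coord.
  unfold mmul, col1, col2, col3, mapp, vadd, vscal, vx, vy, vz; simpl fst; simpl snd. pairs; ring.
Qed.

Lemma Hopf_products p :
  dot (col1 (Hopf p)) (col1 (Hopf p)) = sqnorm p ^ 2 /\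
  dot (col2 (Hopf p)) (col2 (Hopf p)) = sqnorm p ^ 2 /\
  dot (col1 (Hopf p)) (col2 (Hopf p)) = 0 /\
  cross (col1 (Hopf p)) (col2 (Hopf p)) = vscal (sqnorm p) (col3 (Hopf p)).
Proof.
  destruct p as [[a b] [c d]]. rewrite sqnorm_coord, Hopf_coord. unfold col1, col2, col3.
  repeat split; try (vunfold; ring). veq.
Qed.

Lemma SO3_of_cross a b : dot a a = 1 -> dot b b = 1 -> dot a b = 0 -> SO3 (a, b, cross a b).
Proof.
  intros Ha Hb Hab.
  assert (Hc : dot (cross a b) (cross a b) = 1) by (rewrite dot_cross_self, Ha, Hb, Hab; ring).
  unfold SO3. repeat split; trivial; vunfold; ring.
Qed.

Lemma Hopf_unit p : sqnorm p = 1 -> Hopf p = (col1 (Hopf p), col2 (Hopf p), cross (col1 (Hopf p)) (col2 (Hopf p))).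
Proof.
  intros Hp. destruct (Hopf_products p) as (_ & _ & _ & ->). rewrite Hp, vscal_1.
  unfold col1, col2, col3. now destruct (Hopf p) as [[? ?] ?].
Qed.

Lemma SO3_Hopf p : sqnorm p = 1 -> SO3 (Hopf p).
Proof.
  intros Hp. rewrite Hopf_unit by trivial. destruct (Hopf_products p) as (H1 & H2 & H3 & _).
  apply SO3_of_cross; trivial; rewrite ?H1, ?H2, Hp; ring.
Qed.

(** The number [u] commutes with [i], which fixes the first vector, and [j u = conj u j] turns [j]
    into [conj (u ^ 2) j] and [k] into [conj (u ^ 2) k]. The double angle and the minus sign of
    [twist] come from here. *)
Lemma Hopf_umul u q : Cmod u = 1 ->
  Hopf (umul u q) = (col1 (Hopf q),
    vadd (vscal (Re (u * u)%C) (col2 (Hopf q))) (vscal (- Im (u * u)%C) (col3 (Hopf q))),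
    vadd (vscal (Im (u * u)%C) (col2 (Hopf q))) (vscal (Re (u * u)%C) (col3 (Hopf q)))).
Proof.
  intros Hu. assert (Hu2 : Re u * Re u + Im u * Im u = 1) by (rewrite <- Cmod_sqr, Hu; ring).
  destruct q as [[a b] [c d]], u as [x y]. unfold umul, col1, col2, col3.
  (* With [|u|^2] kept in the first column the claim is a polynomial identity; the unit length
     enters only afterwards. *)
  transitivity (vscal (x * x + y * y) (fst (fst (Hopf ((a, b), (c, d))))),
     vadd (vscal (x * x - y * y) (snd (fst (Hopf ((a, b), (c, d)))))) (vscal (- (x * y + y * x)) (snd (Hopf ((a, b), (c, d))))),
     vadd (vscal (x * y + y * x) (snd (fst (Hopf ((a, b), (c, d)))))) (vscal (x * x - y * y) (snd (Hopf ((a, b), (c, d)))))).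
  - clear. rewrite Hopf_coord. unfold Cmult; simpl fst; simpl snd. rewrite Hopf_coord. veq.
  - unfold Re, Im in Hu2; simpl in Hu2. rewrite Hu2, vscal_1. reflexivity.
Qed.

Lemma col_Hopf_qmul q p :
  col1 (Hopf (qmul q p)) = mapp (Hopf p) (col1 (Hopf q)) /\
  col2 (Hopf (qmul q p)) = mapp (Hopf p) (col2 (Hopf q)) /\
  col3 (Hopf (qmul q p)) = mapp (Hopf p) (col3 (Hopf q)).
Proof. now rewrite Hopf_qmul. Qed.

Lemma col_Hopf_umul u q : Cmod u = 1 ->
  col1 (Hopf (umul u q)) = col1 (Hopf q) /\
  col2 (Hopf (umul u q)) =
    vadd (vscal (Re (u * u)%C) (col2 (Hopf q))) (vscal (- Im (u * u)%C) (col3 (Hopf q))).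
Proof. intros Hu. now rewrite Hopf_umul. Qed.

Lemma Csqrt_unit (w : C) : Cmod w = 1 -> exists u : C, Cmod u = 1 /\ (u * u)%C = w.
Proof.
  intros Hw. destruct w as [x y].
  assert (E : x * x + y * y = 1).
  { pose proof (Cmod_sqr (x, y)) as E. rewrite Hw in E. unfold Re, Im in E; simpl in E. lra. }
  assert (Hc : forall z : C, fst z * fst z + snd z * snd z = 1 -> Cmod z = 1).
  { intros z Hz. unfold Cmod. replace (fst z ^ 2 + snd z ^ 2) with 1 by (rewrite <- Hz; ring). apply sqrt_1. }
  (* The root of [w] is [(1 + w) / |1 + w|], with [|1 + w|^2 = 2 (1 + x)]; it breaks down only at
     [w = -1], whose root is [i]. *)
  destruct (Req_dec x (-1)) as [-> | Hx].
  - assert (y = 0) as -> by nra. exists (0, 1). split; [apply Hc; simpl; ring |].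
    unfold Cmult; simpl. f_equal; ring.
  - assert (Hp : 0 < 2 * (1 + x)) by nra.
    set (n := sqrt (2 * (1 + x))).
    assert (Hn : 0 < n) by now apply sqrt_lt_R0.
    assert (Hn2 : n * n = 2 * (1 + x)) by (apply sqrt_sqrt; lra).
    assert (Hx2 : 1 + x <> 0) by lra.
    exists ((1 + x) / n, y / n).
    assert (Hy : y * y = (1 - x) * (1 + x)) by lra.
    split.
    + apply Hc. simpl.
      replace ((1 + x) / n * ((1 + x) / n) + y / n * (y / n)) with (((1 + x) * (1 + x) + y * y) / (n * n)) by (field; lra).
      rewrite Hn2, Hy. field. lra.
    + unfold Cmult; simpl. f_equal.
      * replace ((1 + x) / n * ((1 + x) / n) - y / n * (y / n)) with (((1 + x) * (1 + x) - y * y) / (n * n)) by (field; lra).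
        rewrite Hn2, Hy. field. lra.
      * replace ((1 + x) / n * (y / n) + y / n * ((1 + x) / n)) with (2 * (1 + x) * y / (n * n)) by (field; lra).
        rewrite Hn2. field. lra.
Qed.

(** The rotation taking the x-axis to [T] about their bisector, as a unit quaternion:
    1 - iT, normalized. *)
Definition spin (T : V3) : C2 :=
  let n := sqrt (2 * (1 + vx T)) in
  (((1 + vx T) * / n, 0), (vz T * / n, - vy T * / n)).

Lemma spin_spec T : dot T T = 1 -> 0 < 1 + vx T -> sqnorm (spin T) = 1 /\ col1 (Hopf (spin T)) = T.
Proof.
  destruct T as [[x y] z]. unfold spin, dot, vx, vy, vz; simpl fst; simpl snd. intros HT Hp.
  set (n := sqrt (2 * (1 + x))).
  assert (Hn : 0 < n) by (apply sqrt_lt_R0; lra).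
  assert (Hn2 : n * n = 2 * (1 + x)) by (apply sqrt_sqrt; lra).
  assert (Hni : / n * / n = / (2 * (1 + x))) by (rewrite <- Hn2; field; lra).
  assert (Hz : z * z = (1 - x) * (1 + x) - y * y) by lra.
  split.
  - rewrite sqnorm_coord.
    transitivity (((1 + x) * (1 + x) + y * y + z * z) * (/ n * / n)); [ring |].
    rewrite Hni, Hz. field. lra.
  - rewrite Hopf_coord. unfold col1; simpl fst; simpl snd. pairs.
    + transitivity (((1 + x) * (1 + x) - y * y - z * z) * (/ n * / n)); [ring |].
      rewrite Hni, Hz. field. lra.
    + transitivity (2 * (1 + x) * y * (/ n * / n)); [ring |]. rewrite Hni. field. lra.
    + transitivity (2 * (1 + x) * z * (/ n * / n)); [ring |]. rewrite Hni. field. lra.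
Qed.

Lemma Hopf_col1_surj T : dot T T = 1 -> exists p, sqnorm p = 1 /\ col1 (Hopf p) = T.
Proof.
  intros HT. destruct (Rlt_dec 0 (1 + vx T)) as [Hp | Hp].
  - exists (spin T). now apply spin_spec.
  (* The excluded point lies on the negative x-axis and is reached by [j], because
     [conj j i j = - i]. *)
  - exists ((0, 0), (1, 0)). split; [rewrite sqnorm_coord; ring |].
    destruct T as [[x y] z]. unfold dot, vx, vy, vz in *; simpl in *.
    assert (x = -1) by nra. subst x. assert (y = 0) by nra. assert (z = 0) by nra. subst.
    unfold col1. veq.
Qed.

(** Once a quaternion has the right first vector, the second vectors differ by an angle about it,
    which left multiplication by a square root of the corresponding unit complex number corrects;
    the third vector is then forced. *)
Lemma Hopf_surj A : SO3 A -> exists p, sqnorm p = 1 /\ Hopf p = A.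
Proof.
  intros HA. destruct A as [[a b] c]. destruct (SO3_cross a b c HA) as (Hc & _ & _).
  destruct HA as (Ha & Hb & _ & Hab & _ & _ & _).
  destruct (Hopf_col1_surj a Ha) as (p & Hp & Hpa).
  destruct (Hopf_products p) as (_ & H2 & H3 & H4). rewrite Hp in *. rewrite vscal_1 in H4.
  remember (col2 (Hopf p)) as e eqn:Ee. remember (col3 (Hopf p)) as f eqn:Ef. rewrite Hpa in *.
  assert (He : dot e e = 1) by (rewrite H2; ring).
  (* b lies in the plane of e and f = cross a e *)
  assert (Hb2 : b = vadd (vscal (dot b e) e) (vscal (dot b f) f)).
  { transitivity (vadd (vscal (dot b a) a) (vadd (vscal (dot b e) e) (vscal (dot b f) f))).
    - rewrite <- (mapp_mtrans_r (a, e, f) b) at 1.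
      + destruct a as [[a1 a2] a3], e as [[e1 e2] e3], f as [[f1 f2] f3]. unfold mtrans. veq.
      + rewrite <- H4. now apply SO3_of_cross.
    - rewrite (dot_comm b a), Hab. veq. }
  assert (Hf : dot f f = 1) by (rewrite <- H4, dot_cross_self, Ha, He, H3; ring).
  assert (Hef : dot e f = 0) by (rewrite <- H4; vunfold; ring).
  (* The imaginary part is negated because [Hopf_umul] rotates by the conjugate of [u ^ 2]. *)
  assert (Hw : Cmod (dot b e, - dot b f) = 1).
  { unfold Cmod; simpl fst; simpl snd.
    replace (dot b e ^ 2 + (- dot b f) ^ 2) with (dot b b); [rewrite Hb; apply sqrt_1 |].
    rewrite Hb2 at 1 2.
    transitivity (dot b e ^ 2 * dot e e + dot b f ^ 2 * dot f f + 2 * dot b e * dot b f * dot e f).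
    - generalize (dot b e), (dot b f). intros. vunfold. ring.
    - rewrite He, Hf, Hef. ring. }
  destruct (Csqrt_unit _ Hw) as (u & Hu & Huu).
  exists (umul u p). assert (Hup : sqnorm (umul u p) = 1) by (rewrite sqnorm_umul, Hu, Hp; ring).
  split; trivial.
  rewrite (Hopf_unit _ Hup), (Hopf_umul u p Hu), Huu, <- Ee, <- Ef, Hpa.
  unfold col1, col2; simpl fst; simpl snd. rewrite Ropp_involutive, <- Hb2, Hc. reflexivity.
Qed.

(** The factor is given as an explicit polynomial in the coordinates of the two quaternions, not
    merely asserted to exist, so that along curves its smoothness and periodicity can be read
    off. *)
Lemma Hopf_col1_eq q q' : sqnorm q = 1 -> sqnorm q' = 1 -> col1 (Hopf q) = col1 (Hopf q') ->
  let u := fst (qmul q' (qconj q)) in Cmod u = 1 /\ q' = umul u q.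
Proof.
  intros Hq Hq' He u.
  set (y := qmul q' (qconj q)) in *.
  assert (Hy : sqnorm y = 1) by (unfold y; rewrite sqnorm_qmul, sqnorm_qconj, Hq, Hq'; ring).
  assert (Hyq : qmul y q = q').
  { unfold y. transitivity ((RtoC (sqnorm q) * fst q')%C, (RtoC (sqnorm q) * snd q')%C).
    - destruct q as [[a b] [c d]], q' as [[a' b'] [c' d']].
      change (qconj ((a, b), (c, d))) with (((a, - b), (- c, - d)) : C2).
      rewrite sqnorm_coord, !qmul_coord. clear. veq.
    - rewrite Hq, !Cmult_1_l. now destruct q'. }
  (* for y = z + w j, the first vectors have dot product |z|^2 - |w|^2 *)
  assert (Hw : snd y = RtoC 0).
  { assert (Hd : dot (col1 (Hopf q)) (col1 (Hopf q')) = 1).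
    { rewrite <- He. destruct (Hopf_products q) as (-> & _). rewrite Hq. ring. }
    assert (Hi : dot (col1 (Hopf q)) (col1 (Hopf q')) = Cmod (fst y) ^ 2 - Cmod (snd y) ^ 2).
    { rewrite !Cmod_sqr. unfold y, col1. clear. destruct q as [[a b] [c d]], q' as [[a' b'] [c' d']].
      change (qconj ((a, b), (c, d))) with (((a, - b), (- c, - d)) : C2).
      rewrite qmul_coord, !Hopf_coord. vunfold. ring. }
    apply Cmod_eq_0. unfold sqnorm in Hy. pose proof (Cmod_ge_0 (snd y)). nra. }
  split.
  - unfold sqnorm in Hy. rewrite Hw, Cmod_0 in Hy. fold u in Hy.
    pose proof (Cmod_ge_0 u). nra.
  - rewrite <- Hyq at 1. unfold qmul. rewrite Hw. fold u. unfold umul. f_equal; ring.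
Qed.

(** A unitary matrix is a square root [l] of its determinant times an element of SU(2), and SU(2) is
    right multiplication by unit quaternions. So U(2) acts on frames by a rotation of space and a
    constant twist. *)
Lemma U2_factor U : U2 U -> exists (l : C) (p : C2), Cmod l = 1 /\ sqnorm p = 1 /\
  forall Phi t, right_mul U Phi t = umul l (qmul (Phi t) p).
Proof.
  destruct U as [[a b] [c d]]. intros (H1 & H2 & H3).
  assert (Hcc : forall z : C, (Cconj z * z)%C = RtoC (Cmod z ^ 2)).
  { intros z. rewrite Cmod_sqr. destruct z as [x y]. vunfold. f_equal; ring. }
  (* (c, d) = det U * (- conj b, conj a) *)
  set (D := (a * d - b * c)%C).
  assert (Hc : c = Copp (D * Cconj b)).
  { transitivity ((Cconj a * a + Cconj b * b) * c)%C; [rewrite H1; ring |].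
    transitivity ((Cconj a * c + Cconj b * d) * a - D * Cconj b)%C; [unfold D; ring |].
    rewrite H3. ring. }
  assert (Hd : d = (D * Cconj a)%C).
  { transitivity ((Cconj a * a + Cconj b * b) * d)%C; [rewrite H1; ring |].
    transitivity ((Cconj a * c + Cconj b * d) * b + D * Cconj a)%C; [unfold D; ring |].
    rewrite H3. ring. }
  rewrite !Hcc, <- RtoC_plus in H1, H2. apply RtoC_inj in H1, H2.
  assert (HD : Cmod D = 1).
  { rewrite Hc, Hd, Cmod_opp, !Cmod_mult, !Cmod_conj in H2. pose proof (Cmod_ge_0 D). nra. }
  destruct (Csqrt_unit D HD) as (l & Hl & Hll).
  assert (Hl1 : (l * Cconj l)%C = RtoC 1) by (rewrite Cmult_comm, Hcc, Hl; f_equal; ring).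
  exists l, (Cconj l * a, Cconj l * c)%C. split; [exact Hl | split].
  - unfold sqnorm; simpl fst; simpl snd. rewrite !Cmod_mult, Cmod_conj, Hl.
    rewrite Hc, Cmod_opp, Cmod_mult, HD, Cmod_conj. transitivity (Cmod a ^ 2 + Cmod b ^ 2); [ring | exact H1].
  - intros Phi t. unfold right_mul, umul, qmul; simpl fst; simpl snd.
    rewrite !Cmult_conj, Cconj_conj. f_equal.
    + rewrite Hc, Copp_conj, Cmult_conj, Cconj_conj.
      transitivity (fst (Phi t) * a + snd (Phi t) * b)%C; [reflexivity |].
      replace (l * (fst (Phi t) * (Cconj l * a) - snd (Phi t) * (l * - (Cconj D * b))))%C
        with ((l * Cconj l) * fst (Phi t) * a + snd (Phi t) * ((l * l) * Cconj D * b))%C by ring.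
      rewrite Hl1, Hll. rewrite (Cmult_comm D), Hcc, HD. replace (1 ^ 2) with 1 by ring. ring.
    + rewrite Hd, <- Hll.
      replace (l * (fst (Phi t) * (Cconj l * c) + snd (Phi t) * (l * Cconj a)))%C
        with ((l * Cconj l) * fst (Phi t) * c + snd (Phi t) * (l * l * Cconj a))%C by ring.
      rewrite Hl1. ring.
Qed.

(** * Loops on the sphere miss a direction *)

Lemma smooth_lipschitz f : smooth f ->
  exists L, 0 < L /\ forall t u, 0 <= t <= 2 -> 0 <= u <= 2 -> Rabs (f t - f u) <= L * Rabs (t - u).
Proof.
  intros Hf.
  destruct (continuity_ab_maj (fun t => Rabs (Derive f t)) 0 2) as [m [Hm _]]; [lra | |].
  { intros c _. apply (continuity_pt_comp (Derive f) Rabs).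
    - now apply smooth_continuity, smooth_Derive.
    - apply Rcontinuity_abs. }
  exists (1 + Rabs (Derive f m)). split; [pose proof (Rabs_pos (Derive f m)); lra |].
  intros t u Ht Hu.
  destruct (MVT_gen f u t (Derive f)) as [c [Hc Hfc]].
  - intros x _. apply Derive_correct. now apply smooth_ex_derive.
  - intros x _. now apply smooth_continuity.
  - rewrite Hfc, Rabs_mult. apply Rmult_le_compat_r; [apply Rabs_pos |].
    assert (0 <= c <= 2).
    { unfold Rmin, Rmax in Hc. destruct (Rle_dec u t); lra. }
    specialize (Hm c H). simpl in Hm. lra.
Qed.

Lemma periodic_reduce {A : Type} (f : R -> A) : (forall t, f (t + 2) = f t) ->
  forall t, exists u, 0 <= u < 2 /\ f u = f t.
Proof.
  intros Hf.
  assert (Hn : forall n t, f (t + 2 * INR n) = f t).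
  { induction n as [|n IH]; intros t; [f_equal; simpl; ring |].
    rewrite S_INR, <- (IH t). replace (t + 2 * (INR n + 1)) with (t + 2 * INR n + 2) by ring. apply Hf. }
  assert (Hz : forall (z : Z) t, f (t + 2 * IZR z) = f t).
  { intros z t. destruct (Z_le_dec 0 z) as [Hz | Hz].
    - rewrite <- (Z2Nat.id z Hz), <- INR_IZR_INZ. apply Hn.
    - rewrite <- (Hn (Z.to_nat (- z)) (t + 2 * IZR z)). f_equal.
      rewrite INR_IZR_INZ, Z2Nat.id by lia. rewrite opp_IZR. ring. }
  intros t. exists (t - 2 * IZR (Int_part (t / 2))). split.
  - destruct (base_Int_part (t / 2)). lra.
  - rewrite <- (Hz (Int_part (t / 2))). f_equal. ring.
Qed.

Lemma NoDup_list_prod {A B : Type} (l : list A) (l' : list B) :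
  List.NoDup l -> List.NoDup l' -> List.NoDup (List.list_prod l l').
Proof.
  intros Hl Hl'. induction Hl as [|a l Ha Hl IH]; [constructor |]. simpl.
  apply List.NoDup_app; trivial.
  - apply List.NoDup_map_NoDup_ForallPairs; trivial. intros x y _ _ E. congruence.
  - intros [x y] Hin Hin'. apply List.in_map_iff in Hin. destruct Hin as [z [E _]].
    apply List.in_prod_iff in Hin'. injection E. intros; subst. tauto.
Qed.

(** A Lipschitz curve of bounded length cannot visit the [(n+1)^2] points over a planar grid of
    mesh [1/(2n)]: it needs time of order [1/n] between any two of them. *)
Lemma smooth_loop_misses (sigma : R -> V3) : smooth_loop_V3 sigma ->
  exists m, dot m m = 1 /\ forall t, sigma t <> m.
Proof.
  intros (Hx & Hy & _ & Hper).
  apply NNPP. intros Hall.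
  assert (Hhit : forall m, dot m m = 1 -> exists t, 0 <= t <= 2 /\ sigma t = m).
  { intros m Hm. apply NNPP. intros Hno. apply Hall. exists m. split; trivial.
    intros t Ht. destruct (periodic_reduce sigma Hper t) as [u [Hu Hut]].
    apply Hno. exists u. split; [lra | congruence]. }
  clear Hall.
  destruct (smooth_lipschitz _ Hx) as [Lx [HLx Hlipx]].
  destruct (smooth_lipschitz _ Hy) as [Ly [HLy Hlipy]].
  set (L := Lx + Ly).
  (* With [n > 4 L], the [(n + 1)^2] grid points will need distinct labels among at most
     [4 n L + 1 < n^2 + 1] values. *)
  destruct (nfloor_ex (4 * L)) as [n0 Hn0]; [unfold L; lra |].
  set (n := S n0). assert (HnL : 4 * L < INR n) by (unfold n; rewrite S_INR; lra).
  assert (Hn : 0 < INR n) by (unfold L in HnL; lra).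
  (* On the grid both coordinates lie in [[0, 1/2]], so the points can be placed on the upper
     hemisphere. *)
  set (P := fun p : nat * nat =>
    let x := INR (fst p) / (2 * INR n) in let y := INR (snd p) / (2 * INR n) in
    (x, y, sqrt (1 - x * x - y * y))).
  assert (Hc : forall i, (i <= n)%nat -> 0 <= INR i / (2 * INR n) <= / 2).
  { intros i Hi. pose proof (pos_INR i). apply le_INR in Hi. split.
    - apply Rmult_le_pos; [lra |]. left; apply Rinv_0_lt_compat; lra.
    - apply Rmult_le_reg_r with (2 * INR n); [lra |]. field_simplify; lra. }
  (* The index bounds are premises inside the existential, so that a total choice function exists;
     off the grid the time 0 is a dummy. *)
  assert (Htau : forall p, exists t, (fst p <= n)%nat -> (snd p <= n)%nat ->
     0 <= t <= 2 /\ sigma t = P p).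
  { intros [i j]. simpl.
    destruct (le_dec i n) as [Hi |], (le_dec j n) as [Hj |]; try (exists 0; lia).
    destruct (Hhit (P (i, j))) as [t Ht]; [| exists t; now intros].
    pose proof (Hc i Hi). pose proof (Hc j Hj).
    unfold P, dot, vx, vy, vz; simpl. rewrite sqrt_sqrt; [ring |].
    assert (Hs : forall a b, 0 <= a <= / 2 -> 0 <= b <= / 2 -> 0 <= 1 - a * a - b * b) by (intros; nra).
    now apply Hs. }
  set (tau := fun p => proj1_sig (constructive_indefinite_description _ (Htau p))).
  assert (Hts : forall i j, (i <= n)%nat -> (j <= n)%nat -> 0 <= tau (i, j) <= 2 /\ sigma (tau (i, j)) = P (i, j)).
  { intros i j Hi Hj. unfold tau. destruct (constructive_indefinite_description _ _) as [t Ht]. now apply Ht. }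
  clearbody tau. clear Htau Hhit.
  (* Different grid points are at least [1 / (2 n)] apart in some coordinate, so their times differ
     by at least [1 / h], and the integer part of [tau * h] tells them apart. *)
  set (h := 2 * INR n * L).
  assert (Hh : 0 < h) by (unfold h, L; apply Rmult_lt_0_compat; lra).
  assert (Hfl : forall p, exists k : nat, 0 <= tau p * h -> INR k <= tau p * h < INR k + 1).
  { intros p. destruct (Rle_dec 0 (tau p * h)) as [Hp |]; [| now exists O].
    destruct (nfloor_ex _ Hp) as [k Hk]. now exists k. }
  set (k := fun p => proj1_sig (constructive_indefinite_description _ (Hfl p))).
  assert (Hk : forall p, 0 <= tau p * h -> INR (k p) <= tau p * h < INR (k p) + 1).
  { intros p. unfold k. now destruct (constructive_indefinite_description _ _). }
  clearbody k. clear Hfl.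
  set (grid := List.list_prod (List.seq 0 (S n)) (List.seq 0 (S n))).
  assert (Hgrid : forall i j, List.In (i, j) grid -> (i <= n)%nat /\ (j <= n)%nat).
  { intros i j Hij. apply List.in_prod_iff in Hij. rewrite !List.in_seq in Hij. lia. }
  destruct (nfloor_ex (2 * h)) as [N HN]; [lra |].
  assert (Hgap : forall i i', i <> i' -> 1 <= Rabs (INR i - INR i')).
  { intros i i' Hne. rewrite !INR_IZR_INZ, <- minus_IZR, <- abs_IZR. apply (IZR_le 1). lia. }
  assert (Hlen : (List.length (List.map k grid) <= List.length (List.seq 0 (S N)))%nat).
  { apply List.NoDup_incl_length.
    - apply List.NoDup_map_NoDup_ForallPairs.
      + intros [i j] [i' j'] Hp Hp' Hkk.
        apply Hgrid in Hp. apply Hgrid in Hp'. destruct Hp as [Hi Hj], Hp' as [Hi' Hj'].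
        destruct (Hts i j Hi Hj) as [Ht Hst]. destruct (Hts i' j' Hi' Hj') as [Ht' Hst'].
        assert (Hclose : Rabs (tau (i, j) - tau (i', j')) * h < 1).
        { pose proof (Hk (i, j) ltac:(nra)). pose proof (Hk (i', j') ltac:(nra)). rewrite Hkk in *.
          rewrite <- (Rabs_right h) by lra. rewrite <- Rabs_mult.
          apply Rabs_lt_between. lra. }
        pose proof (Hlipx _ _ Ht Ht') as Bx. pose proof (Hlipy _ _ Ht Ht') as By.
        rewrite Hst, Hst' in Bx, By. unfold P, vx, vy in Bx, By; simpl fst in Bx, By; simpl snd in Bx, By.
        pose proof (Rabs_pos (tau (i, j) - tau (i', j'))) as Hpos.
        assert (Hsc : forall a b, Rabs (INR a / (2 * INR n) - INR b / (2 * INR n)) * (2 * INR n) = Rabs (INR a - INR b)).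
        { intros a b. rewrite <- (Rabs_right (2 * INR n)) at 3 by lra. rewrite <- Rabs_mult. f_equal. field. lra. }
        set (d := Rabs (tau (i, j) - tau (i', j'))) in *.
        assert (Hd0 : 0 <= d * (2 * INR n)) by nra.
        assert (Hsmall : forall a b, Rabs (INR a / (2 * INR n) - INR b / (2 * INR n)) <= L * d -> a = b).
        { intros a b Hab. apply NNPP. intros Hne. specialize (Hgap a b Hne). rewrite <- Hsc in Hgap.
          apply Rmult_le_compat_r with (r := 2 * INR n) in Hab; [| lra]. unfold h in Hclose. nra. }
        f_equal; apply Hsmall; (eapply Rle_trans; [eassumption |]); unfold L; nra.
      + apply NoDup_list_prod; apply List.seq_NoDup.
    - intros m Hm. apply List.in_map_iff in Hm. destruct Hm as [[i j] [<- Hij]].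
      apply Hgrid in Hij. destruct Hij as [Hi Hj]. destruct (Hts i j Hi Hj) as [Ht _].
      apply List.in_seq. split; [lia |]. simpl.
      pose proof (Hk (i, j) ltac:(nra)) as [Hk1 _].
      apply INR_lt. rewrite S_INR. nra. }
  rewrite List.length_map, List.length_seq in Hlen. unfold grid in Hlen.
  rewrite List.length_prod, List.length_seq in Hlen.
  apply le_INR in Hlen. rewrite mult_INR, !S_INR in Hlen. unfold h in HN. nra.
Qed.

(** * Smooth loops in R^3 *)

Lemma smooth_cos_sin (a : R) : smooth (fun t => cos (a * t)) /\ smooth (fun t => sin (a * t)).
Proof.
  (* Combinations of cosine and sine form a space closed under differentiation, which makes the
     induction on the order possible. *)
  assert (Hs : forall p q, smooth (fun t => p * cos (a * t) + q * sin (a * t))).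
  { intros p q.
    assert (Hn : forall n, exists p' q', forall t,
      Derive_n (fun t => p * cos (a * t) + q * sin (a * t)) n t = p' * cos (a * t) + q' * sin (a * t)).
    { induction n as [|n [p' [q' IH]]]; [now exists p, q |].
      exists (a * q'), (- a * p'). intros t. simpl. rewrite (Derive_ext _ _ t IH).
      apply is_derive_unique. auto_derive; [trivial | ring]. }
    Transparent smooth. intros [|n] t; [exact I |]. Opaque smooth. destruct (Hn n) as [p' [q' E]].
    apply ex_derive_ext with (fun t => p' * cos (a * t) + q' * sin (a * t)); [now intros; rewrite E |].
    auto_derive; trivial. }
  split.
  - apply smooth_ext with (2 := Hs 1 0). intros; ring.
  - apply smooth_ext with (2 := Hs 0 1). intros; ring.
Qed.

Definition smooth_V3 (g : R -> V3) : Prop :=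
  smooth (fun t => vx (g t)) /\ smooth (fun t => vy (g t)) /\ smooth (fun t => vz (g t)).

Lemma smooth_loop_V3_iff g : smooth_loop_V3 g <-> smooth_V3 g /\ forall t, g (t + 2) = g t.
Proof. unfold smooth_loop_V3, smooth_V3. tauto. Qed.

Lemma smooth_V3_mapp A g : smooth_V3 g -> smooth_V3 (fun t => mapp A (g t)).
Proof.
  intros (Hx & Hy & Hz). split; [| split]; unfold mapp, vadd, vscal, vx, vy, vz in *; simpl in *; sm1.
Qed.

Lemma smooth_V3_vscal r g : smooth_V3 g -> smooth_V3 (fun t => vscal r (g t)).
Proof. intros (Hx & Hy & Hz). split; [| split]; unfold vscal, vx, vy, vz in *; simpl; sm1. Qed.

Lemma smooth_V3_vderive g : smooth_V3 g -> smooth_V3 (vderive g).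
Proof. intros (Hx & Hy & Hz). split; [| split]; now apply smooth_Derive. Qed.

Lemma smooth_loop_vderive g : smooth_loop_V3 g -> smooth_loop_V3 (vderive g).
Proof.
  rewrite !smooth_loop_V3_iff. intros [Hs Hp]. split; [now apply smooth_V3_vderive |].
  assert (Hd : forall f : R -> R, (forall t, f (t + 2) = f t) -> forall t, Derive f (t + 2) = Derive f t).
  { intros f Hf t. change (Derive_n f 1 (t + 2) = Derive_n f 1 t).
    rewrite <- Derive_n_comp_trans. now apply Derive_n_ext. }
  intros t. unfold vderive.
  rewrite (Hd (fun x => vx (g x))), (Hd (fun x => vy (g x))), (Hd (fun x => vz (g x))); trivial;
    intros; now rewrite Hp.
Qed.

(** The parenthesization is that of a coordinate of [mapp A (g x)], so the result applies to each
    coordinate by conversion. *)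
Lemma Derive_lin3 (f1 f2 f3 : R -> R) (a b c t : R) :
  ex_derive f1 t -> ex_derive f2 t -> ex_derive f3 t ->
  Derive (fun x => f1 x * a + (f2 x * b + f3 x * c)) t
  = Derive f1 t * a + (Derive f2 t * b + Derive f3 t * c).
Proof.
  intros H1 H2 H3. apply is_derive_unique. auto_derive; [tauto |].
  change (fun x => f1 x) with f1. change (fun x => f2 x) with f2. change (fun x => f3 x) with f3. ring.
Qed.

Definition ex_vderive (g : R -> V3) (t : R) : Prop :=
  ex_derive (fun x => vx (g x)) t /\ ex_derive (fun x => vy (g x)) t /\ ex_derive (fun x => vz (g x)) t.

Lemma smooth_V3_ex_vderive g t : smooth_V3 g -> ex_vderive g t.
Proof. intros (Hx & Hy & Hz). split; [| split]; now apply smooth_ex_derive. Qed.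

Lemma vderive_mapp A g t : ex_vderive g t ->
  vderive (fun x => mapp A (g x)) t = mapp A (vderive g t).
Proof.
  intros (Hx & Hy & Hz). apply V3_ext.
  - exact (Derive_lin3 _ _ _ (vx (fst (fst A))) (vx (snd (fst A))) (vx (snd A)) t Hx Hy Hz).
  - exact (Derive_lin3 _ _ _ (vy (fst (fst A))) (vy (snd (fst A))) (vy (snd A)) t Hx Hy Hz).
  - exact (Derive_lin3 _ _ _ (vz (fst (fst A))) (vz (snd (fst A))) (vz (snd A)) t Hx Hy Hz).
Qed.

Lemma vderive_vscal r g t : vderive (fun x => vscal r (g x)) t = vscal r (vderive g t).
Proof. unfold vderive, vscal, vx, vy, vz; simpl. now rewrite !Derive_scal. Qed.

Lemma vderive_ext g h t : (forall x, g x = h x) -> vderive g t = vderive h t.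
Proof. intros E. unfold vderive. f_equal; [f_equal |]; apply Derive_ext; intros; now rewrite E. Qed.

Lemma vRInt_ext g h a b : (forall x, g x = h x) -> vRInt g a b = vRInt h a b.
Proof. intros E. unfold vRInt. f_equal; [f_equal |]; apply RInt_ext; intros; now rewrite E. Qed.

Lemma RInt_lin3 (f1 f2 f3 : R -> R) (a b c s t : R) :
  smooth f1 -> smooth f2 -> smooth f3 ->
  RInt (fun x => f1 x * a + (f2 x * b + f3 x * c)) s t
  = RInt f1 s t * a + (RInt f2 s t * b + RInt f3 s t * c).
Proof.
  intros H1 H2 H3.
  assert (E1 := smooth_ex_RInt f1 s t H1). assert (E2 := smooth_ex_RInt f2 s t H2).
  assert (E3 := smooth_ex_RInt f3 s t H3).
  apply (is_RInt_unique (V := R_CompleteNormedModule)).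
  assert (Hm : forall f k, ex_RInt f s t -> is_RInt (fun x => f x * k) s t (RInt f s t * k)).
  { intros f k Hf. apply (is_RInt_ext (V := R_NormedModule) (fun x => scal k (f x))).
    - intros. apply Rmult_comm.
    - rewrite Rmult_comm. apply (is_RInt_scal (V := R_NormedModule)). now apply (RInt_correct (V := R_CompleteNormedModule)). }
  apply (is_RInt_plus (V := R_NormedModule)); [now apply Hm |].
  apply (is_RInt_plus (V := R_NormedModule)); now apply Hm.
Qed.

Lemma vRInt_mapp A g a b : smooth_V3 g -> vRInt (fun x => mapp A (g x)) a b = mapp A (vRInt g a b).
Proof.
  intros (Hx & Hy & Hz). apply V3_ext.
  - exact (RInt_lin3 _ _ _ (vx (fst (fst A))) (vx (snd (fst A))) (vx (snd A)) a b Hx Hy Hz).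
  - exact (RInt_lin3 _ _ _ (vy (fst (fst A))) (vy (snd (fst A))) (vy (snd A)) a b Hx Hy Hz).
  - exact (RInt_lin3 _ _ _ (vz (fst (fst A))) (vz (snd (fst A))) (vz (snd A)) a b Hx Hy Hz).
Qed.

Lemma mapp_v0 A : mapp A v0 = v0.
Proof. unfold v0. veq. Qed.

(** * Speed and normalization *)

Lemma smooth_vnorm_vderive g : smooth_V3 g -> (forall t, vderive g t <> v0) ->
  smooth (fun t => vnorm (vderive g t)) /\ forall t, 0 < vnorm (vderive g t).
Proof.
  intros Hg Hi. destruct (smooth_V3_vderive g Hg) as (Hx & Hy & Hz).
  assert (Hp : forall t, 0 < dot (vderive g t) (vderive g t)).
  { intros t. assert (H0 : dot (vderive g t) (vderive g t) <> 0) by (intros E; exact (Hi t (dot_self_eq0 _ E))).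
    destruct (vderive g t) as [[a b] c]. vunfold. vunfold in H0. nra. }
  split.
  - apply (smooth_family_slice0 0 (fun _ t => vnorm (vderive g t))).
    apply smooth_family_sqrt; [| apply filter_forall; intros _; exact Hp].
    apply (smooth_family_of_smooth 0 (fun t => dot (vderive g t) (vderive g t))).
    unfold dot. sm1.
  - intros t. now apply sqrt_lt_R0.
Qed.

Lemma length_mapp A r g : SO3 A -> 0 < r -> smooth_V3 g ->
  length (fun t => mapp A (vscal r (g t))) = r * length g.
Proof.
  intros HA Hr Hg. unfold length.
  rewrite <- (RInt_scal (V := R_CompleteNormedModule)) by
    (apply (ex_RInt_continuous (V := R_CompleteNormedModule)); intros t _;
     destruct (smooth_V3_vderive g Hg) as (Hx & Hy & Hz);
     apply (continuous_comp (fun t => dot (vderive g t) (vderive g t)) sqrt);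
     [apply (smooth_continuous (fun t => dot (vderive g t) (vderive g t))); unfold dot; sm1 | apply continuous_sqrt]).
  apply RInt_ext. intros t _.
  rewrite vderive_mapp by (apply smooth_V3_ex_vderive; now apply smooth_V3_vscal).
  rewrite vderive_vscal, vnorm_mapp, vnorm_vscal, Rabs_right by (trivial; lra). reflexivity.
Qed.

Lemma normalize_mapp A r g t : SO3 A -> 0 < r -> smooth_V3 g -> length g <> 0 ->
  normalize (fun t => mapp A (vscal r (g t))) t = mapp A (normalize g t).
Proof.
  intros HA Hr Hg Hl. unfold normalize. rewrite length_mapp by trivial.
  rewrite !mapp_vscal, vscal_vscal. f_equal. field. lra.
Qed.

Lemma RInt_const_R (c a b : R) : RInt (fun _ => c) a b = (b - a) * c.
Proof. apply (RInt_const (V := R_CompleteNormedModule)). Qed.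

Lemma length_const_speed g v : (forall t, vnorm (vderive g t) = v) -> length g = 2 * v.
Proof.
  intros Hv. unfold length. rewrite (RInt_ext _ (fun _ => v)) by (intros; apply Hv).
  rewrite RInt_const_R. ring.
Qed.

Lemma length_pos g : smooth_V3 g -> (forall t, vderive g t <> v0) -> 0 < length g.
Proof.
  intros Hg Hi. destruct (smooth_vnorm_vderive g Hg Hi) as [Hs Hp].
  apply RInt_gt_0; [lra | intros; apply Hp |]. intros t _. apply (smooth_continuous _ t Hs).
Qed.

(** Being in the class of 1 only makes the normalized speed constant. Its integral over an interval
    of length 2 is the normalized length 2, so the constant is 1. *)
Lemma level_one_speed x : smooth_V3 (fst x) -> (forall t, vderive (fst x) t <> v0) ->
  level_one x <-> forall t, vnorm (vderive (normalize (fst x)) t) = 1.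
Proof.
  intros Hg Hi. unfold level_one, same_LR_mod_R, mu. split.
  - intros [k Hk] t. pose proof (length_pos _ Hg Hi) as HL.
    assert (Hs : forall t, vnorm (vderive (fst x) t) = (1 + k) * length (fst x) / 2).
    { intros u. specialize (Hk u). unfold normalize in Hk. rewrite vderive_vscal, vnorm_vscal in Hk.
      rewrite Rabs_right in Hk by (apply Rle_ge, Rlt_le, Rdiv_lt_0_compat; lra).
      replace (1 + k) with (2 / length (fst x) * vnorm (vderive (fst x) u)) by lra. field. lra. }
    pose proof (length_const_speed _ _ Hs).
    assert (k = 0). { assert (k * length (fst x) = 0) by lra. destruct (Rmult_integral _ _ H0); lra. }
    subst k. specialize (Hk t). lra.
  - intros E. exists 0. intros t. rewrite E. ring.
Qed.

Lemma vderive_normalize g t : vderive (normalize g) t = vscal (2 / length g) (vderive g t).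
Proof. apply vderive_vscal. Qed.

Lemma tangent_mapp A r g t : SO3 A -> 0 < r -> smooth_V3 g ->
  tangent (fun t => mapp A (vscal r (g t))) t = mapp A (tangent g t).
Proof.
  intros HA Hr Hg. unfold tangent.
  rewrite vderive_mapp by (apply smooth_V3_ex_vderive; now apply smooth_V3_vscal).
  rewrite vderive_vscal, vnorm_mapp, vnorm_vscal, Rabs_right by (trivial; lra).
  rewrite !mapp_vscal, vscal_vscal. f_equal.
  (* Where the derivative vanishes, both factors reduce to the default value [/ 0 = 0]. *)
  destruct (Req_dec (vnorm (vderive g t)) 0) as [-> | Hn]; [| field; lra].
  rewrite Rmult_0_r, Rinv_0. ring.
Qed.

Lemma framed_loop_smooth x : framed_loop x ->
  smooth_V3 (fst x) /\ (forall t, vderive (fst x) t <> v0) /\ 0 < length (fst x).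
Proof.
  destruct x as [g V]. intros (Hg & _ & Hi & _). apply smooth_loop_V3_iff in Hg. simpl.
  destruct Hg as [Hg _]. split; [exact Hg | split; [exact Hi | now apply length_pos]].
Qed.

Lemma framed_loop_level x : framed_loop x -> level_one x ->
  forall t, vderive (forget x) t = tangent (fst x) t /\ vnorm (vderive (fst x) t) = length (fst x) / 2.
Proof.
  intros Hx Hl t. destruct (framed_loop_smooth x Hx) as (Hg & Hi & HL).
  pose proof (proj1 (level_one_speed x Hg Hi) Hl t) as Hl1. clear Hl; rename Hl1 into Hl.
  unfold forget, tangent. rewrite vderive_normalize in *. rewrite vnorm_vscal in Hl.
  rewrite Rabs_right in Hl by (apply Rle_ge, Rlt_le, Rdiv_lt_0_compat; lra).
  assert (E : vnorm (vderive (fst x) t) = length (fst x) / 2).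
  { replace (length (fst x) / 2) with (length (fst x) / 2 * (2 / length (fst x) * vnorm (vderive (fst x) t))) by (rewrite Hl; ring).
    field. lra. }
  split; trivial. rewrite E. f_equal. field. lra.
Qed.

Lemma forget_IsoImm x : framed_loop x -> level_one x -> mem_IsoImm (forget x).
Proof.
  intros Hx Hl. destruct (framed_loop_smooth x Hx) as (Hg & Hi & HL).
  pose proof (proj1 (level_one_speed x Hg Hi) Hl) as Hs.
  destruct x as [g V]. destruct Hx as (Hgl & _ & _ & _ & _ & H0).
  unfold forget in *; simpl fst in *. apply smooth_loop_V3_iff in Hgl. repeat split; trivial; try
    (apply (smooth_V3_vscal (2 / length g) g Hg)).
  - intros t. unfold normalize. now rewrite (proj2 Hgl).
  - unfold normalize. rewrite H0. unfold v0. veq.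
Qed.

Lemma same_SO3_refl g h : (forall t, g t = h t) -> same_SO3 g h.
Proof.
  intros E. exists ((1, 0, 0), (0, 1, 0), (0, 0, 1)). split; [apply SO3_1 |].
  intros t. now rewrite mapp_1.
Qed.

Lemma same_SO3_sym g h : same_SO3 g h -> same_SO3 h g.
Proof.
  intros (A & HA & E). exists (mtrans A). split; [now apply SO3_mtrans |].
  intros t. now rewrite E, mapp_mtrans_l.
Qed.

Lemma same_SO3_trans g h k : same_SO3 g h -> same_SO3 h k -> same_SO3 g k.
Proof.
  intros (A & HA & E) (B & HB & E'). exists (mmul B A). split; [now apply SO3_mmul |].
  intros t. now rewrite mapp_mmul, E', E.
Qed.

Lemma same_SO3_vderive g h : smooth_V3 g -> same_SO3 g h -> same_SO3 (vderive g) (vderive h).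
Proof.
  intros Hg (A & HA & E). exists A. split; trivial. intros t.
  rewrite (vderive_ext _ _ t E). apply vderive_mapp. now apply smooth_V3_ex_vderive.
Qed.

(** Normalization to length 2 removes the scaling and dropping the frame removes the twist, so only
    the rotation survives. *)
Lemma same_framed_forget x y : smooth_V3 (fst x) -> 0 < length (fst x) -> same_framed x y ->
  same_SO3 (forget x) (forget y).
Proof.
  intros Hg HL Hs.
  destruct x as [g V], y as [g' V'], Hs as (A & r & th & HA & Hr & Eg & _).
  exists A. split; trivial. intros t. unfold forget; simpl fst in *.
  rewrite <- (normalize_mapp A r) by (trivial; lra).
  assert (EL : length g' = length (fun t => mapp A (vscal r (g t)))).
  { apply RInt_ext. intros u _. now rewrite (vderive_ext _ _ u Eg). }
  unfold normalize. rewrite EL. now rewrite Eg.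
Qed.

Lemma same_framed_level x y : framed_loop x -> framed_loop y -> same_framed x y ->
  level_one x <-> level_one y.
Proof.
  intros Hx Hy Hs. destruct (framed_loop_smooth x Hx) as (Hg & Hi & HL).
  destruct (framed_loop_smooth y Hy) as (Hg' & Hi' & HL').
  rewrite !level_one_speed by trivial.
  destruct (same_SO3_vderive _ _ (smooth_V3_vscal (2 / length (fst x)) _ Hg) (same_framed_forget x y Hg HL Hs)) as (A & HA & E).
  assert (En : forall t, vnorm (vderive (normalize (fst y)) t) = vnorm (vderive (normalize (fst x)) t)).
  { intros t. change (normalize (fst y)) with (forget y). rewrite E. now rewrite vnorm_mapp. }
  split; intros E1 t; [rewrite En | rewrite <- En]; apply E1.
Qed.

(** * Spin lifts *)

(** The closing sign of a component, by which periodic and antiperiodic functions are treated at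
    once. *)
Definition sgn (K : component) : R := match K with od => 1 | ev => -1 end.

Definition smooth_C2 (q : R -> C2) : Prop :=
  smooth_C (comp1 q) /\ smooth_C (comp2 q).

Definition smooth_family_C2 (s0 : R) (c : R -> R -> C2) : Prop :=
  smooth_family_C s0 (fun s => comp1 (c s)) /\ smooth_family_C s0 (fun s => comp2 (c s)).

Ltac Rring := match goal with |- @eq _ ?a ?b => change (@eq R a b) end; ring.

Ltac cunfold := unfold smooth_family_C2, smooth_family_C, smooth_C2, smooth_C, comp1, comp2, umul, qmul, qconj, Cmult, Cminus, Cplus, Copp, Cconj, RtoC, Re, Im in *;
  simpl fst in *; simpl snd in *.

Lemma umul_umul u v q : umul u (umul v q) = umul (u * v)%C q.
Proof. unfold umul; simpl. now rewrite !Cmult_assoc. Qed.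

Lemma qmul_umul u q p : qmul (umul u q) p = umul u (qmul q p).
Proof. unfold qmul, umul; simpl. f_equal; ring. Qed.

Lemma in_V_iff K phi : in_V K phi <-> smooth_C phi /\ forall t, phi (t + 2) = (RtoC (sgn K) * phi t)%C.
Proof.
  destruct K; unfold in_V, LC, AC, sgn.
  - split; intros [Hs Hp]; split; trivial; intros t; rewrite Hp; ring.
  - assert (E : forall z : C, (RtoC (-1) * z)%C = Copp z) by (intros [a b]; cunfold; f_equal; ring).
    split; intros [Hs Hp]; split; trivial; intros t; rewrite Hp, E; reflexivity.
Qed.

Lemma mem_V2_iff K q : mem_V2 K q <-> smooth_C2 q /\ forall t, q (t + 2) = umul (RtoC (sgn K)) (q t).
Proof.
  unfold mem_V2. rewrite !in_V_iff. unfold smooth_C2, umul, comp1, comp2. split.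
  - intros [[H1 H2] [H3 H4]]. repeat split; try apply H1; try apply H3.
    intros t. rewrite <- H2, <- H4. now destruct (q (t + 2)).
  - intros [[H1 H3] H]. repeat split; try apply H1; try apply H3; intros t; now rewrite H.
Qed.

Lemma smooth_C2_qmul q p : smooth_C2 q -> smooth_C2 (fun t => qmul (q t) p).
Proof. intros [[H1 H2] [H3 H4]]. cunfold. repeat split; sm1. Qed.

Lemma smooth_C2_umul u q : smooth_C u -> smooth_C2 q -> smooth_C2 (fun t => umul (u t) (q t)).
Proof. intros [H5 H6] [[H1 H2] [H3 H4]]. cunfold. repeat split; sm1. Qed.

Lemma smooth_C_const c : smooth_C (fun _ => c).
Proof. split; apply smooth_const. Qed.

Lemma mem_V2_qmul K q p : mem_V2 K q -> mem_V2 K (fun t => qmul (q t) p).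
Proof.
  rewrite !mem_V2_iff. intros [Hs Hp]. split; [now apply smooth_C2_qmul |].
  intros t. now rewrite Hp, qmul_umul.
Qed.

Lemma mem_V2_umul_const K u q : mem_V2 K q -> mem_V2 K (fun t => umul u (q t)).
Proof.
  rewrite !mem_V2_iff. intros [Hs Hp]. split; [apply smooth_C2_umul; trivial; apply smooth_C_const |].
  intros t. rewrite Hp, !umul_umul. f_equal. ring.
Qed.

Lemma sgn_sqr K : sgn K * sgn K = 1.
Proof. destruct K; simpl; ring. Qed.

(** The ratio contains one factor from each lift, so the signs of the component cancel and a
    periodic function results even from antiperiodic lifts. *)
Lemma LS1_ratio K q q' : mem_V2 K q -> mem_V2 K q' -> LC (fun t => fst (qmul (q' t) (qconj (q t)))).
Proof.
  rewrite !mem_V2_iff. intros [Hs Hp] [Hs' Hp'].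
  split.
  - destruct Hs as [[H1 H2] [H3 H4]], Hs' as [[H5 H6] [H7 H8]]. cunfold. split; sm1.
  - intros t. rewrite Hp, Hp'.
    transitivity (RtoC (sgn K * sgn K) * fst (qmul (q' t) (qconj (q t))))%C.
    + generalize (sgn K), (q t), (q' t). intros r [[a b] [c d]] [[a' b'] [c' d']]. cunfold. f_equal; ring.
    + rewrite sgn_sqr. ring.
Qed.

(** [q] and [- q] have the same frame. *)
Lemma Hopf_periodic K q : mem_V2 K q -> forall t, Hopf (q (t + 2)) = Hopf (q t).
Proof.
  rewrite mem_V2_iff. intros [_ Hp] t. rewrite Hp.
  transitivity (mscal (sgn K * sgn K) (Hopf (q t))).
  - destruct (q t) as [[a b] [c d]]. unfold umul, Cmult, RtoC; simpl fst; simpl snd. rewrite !Hopf_coord.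
    unfold mscal, vscal, vx, vy, vz; simpl fst; simpl snd. pairs; ring.
  - rewrite sgn_sqr. unfold mscal. rewrite !vscal_1. now destruct (Hopf (q t)) as [[? ?] ?].
Qed.

Lemma Hopf_eta q : Hopf q = Hopf ((fst (fst q), snd (fst q)), (fst (snd q), snd (snd q))).
Proof. now destruct q as [[a b] [c d]]. Qed.

Lemma smooth_V3_Hopf q : smooth_C2 q ->
  smooth_V3 (fun t => col1 (Hopf (q t))) /\ smooth_V3 (fun t => col2 (Hopf (q t))).
Proof.
  intros [[H1 H2] [H3 H4]].
  assert (E : forall f g : R -> V3, (forall t, f t = g t) -> smooth_V3 f -> smooth_V3 g).
  { intros f g Hfg (Hx & Hy & Hz). split; [| split]; (eapply smooth_ext; [intros t; rewrite <- Hfg; reflexivity |]); assumption. }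
  split; (eapply E; [intros t; rewrite Hopf_eta, Hopf_coord; unfold col1, col2; simpl fst; simpl snd; reflexivity |]);
    cunfold; unfold smooth_V3, vx, vy, vz; simpl fst; simpl snd; repeat split; sm1.
Qed.

Lemma smooth_loop_Hopf K q : mem_V2 K q ->
  smooth_loop_V3 (fun t => col1 (Hopf (q t))) /\ smooth_loop_V3 (fun t => col2 (Hopf (q t))).
Proof.
  intros Hq. pose proof (Hopf_periodic K q Hq) as Hp. rewrite mem_V2_iff in Hq.
  destruct (smooth_V3_Hopf q (proj1 Hq)). rewrite !smooth_loop_V3_iff.
  repeat split; trivial; try (now apply H); try (now apply H0); intros; now rewrite Hp.
Qed.

(** * Orthonormality and closing *)

Lemma RInt_C_pair (f g : R -> R) a b : smooth f -> smooth g ->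
  RInt (V := C_R_CompleteNormedModule) (fun t => (f t, g t)) a b = (RInt f a b, RInt g a b).
Proof.
  intros Hf Hg. apply is_RInt_unique.
  apply (is_RInt_fct_extend_pair (U := R_NormedModule) (V := R_NormedModule) (fun t => (f t, g t)));
    simpl; apply (RInt_correct (V := R_CompleteNormedModule)); now apply smooth_ex_RInt.
Qed.

Lemma L2_coord (phi psi : R -> C) : smooth_C phi -> smooth_C psi ->
  L2 phi psi = (RInt (fun t => Re (phi t) * Re (psi t) - Im (phi t) * (- Im (psi t))) 0 2,
                RInt (fun t => Re (phi t) * (- Im (psi t)) + Im (phi t) * Re (psi t)) 0 2).
Proof.
  intros [H1 H2] [H3 H4]. unfold L2.
  rewrite <- RInt_C_pair by sm1. reflexivity.
Qed.

Lemma RInt_ext_R (f g : R -> R) a b : (forall t, f t = g t) -> RInt f a b = RInt g a b.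
Proof. intros E. apply RInt_ext. intros; apply E. Qed.

Lemma RInt_0_R a b : RInt (fun _ => 0) a b = 0.
Proof. rewrite RInt_const_R. apply Rmult_0_r. Qed.

Lemma RInt_scal_R (f : R -> R) k a b : smooth f -> RInt (fun t => k * f t) a b = k * RInt f a b.
Proof. intros Hf. apply (RInt_scal (V := R_CompleteNormedModule)). now apply smooth_ex_RInt. Qed.

Lemma RInt_plus_R (f g : R -> R) a b : smooth f -> smooth g ->
  RInt (fun t => f t + g t) a b = RInt f a b + RInt g a b.
Proof. intros Hf Hg. apply (RInt_plus (V := R_CompleteNormedModule)); now apply smooth_ex_RInt. Qed.

(** For [q = (phi, psi)] the first vector of [Hopf q] has coordinates [|phi|^2 - |psi|^2],
    [2 Im (phi conj psi)] and [2 Re (phi conj psi)]. Closing the curve thus means equal norms and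
    orthogonality, and the total 2 makes each squared norm 1. *)
Lemma St2_iff q : smooth_C2 q ->
  (St2 q <-> RInt (fun t => sqnorm (q t)) 0 2 = 2 /\ vRInt (fun t => col1 (Hopf (q t))) 0 2 = v0).
Proof.
  intros [Hs1 Hs2]. unfold St2.
  pose proof (L2_coord _ _ Hs1 Hs1) as L11. pose proof (L2_coord _ _ Hs2 Hs2) as L22.
  pose proof (L2_coord _ _ Hs1 Hs2) as L12.
  destruct Hs1 as [H1 H2], Hs2 as [H3 H4].
  set (a := fun t => fst (fst (q t))) in *. set (b := fun t => snd (fst (q t))) in *.
  set (c := fun t => fst (snd (q t))) in *. set (d := fun t => snd (snd (q t))) in *.
  change (smooth a) in H1. change (smooth b) in H2. change (smooth c) in H3. change (smooth d) in H4.
  change (L2 (comp1 q) (comp1 q) = (RInt (fun t => a t * a t - b t * - b t) 0 2, RInt (fun t => a t * - b t + b t * a t) 0 2)) in L11.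
  change (L2 (comp2 q) (comp2 q) = (RInt (fun t => c t * c t - d t * - d t) 0 2, RInt (fun t => c t * - d t + d t * c t) 0 2)) in L22.
  change (L2 (comp1 q) (comp2 q) = (RInt (fun t => a t * c t - b t * - d t) 0 2, RInt (fun t => a t * - d t + b t * c t) 0 2)) in L12.
  rewrite L11, L22, L12. unfold RtoC. clear L11 L22 L12.
  assert (Hq : forall t, q t = ((a t, b t), (c t, d t))).
  { intros t. unfold a, b, c, d. now destruct (q t) as [[? ?] [? ?]]. }
  rewrite (RInt_ext_R (fun t => sqnorm (q t)) (fun t => (a t * a t - b t * - b t) + (c t * c t - d t * - d t)))
    by (intros; rewrite Hq, sqnorm_coord; ring).
  rewrite (RInt_plus_R (fun t => a t * a t - b t * - b t) (fun t => c t * c t - d t * - d t)) by sm1.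
  rewrite (RInt_ext_R (fun t => a t * - b t + b t * a t) (fun _ => 0)) by (intros; ring).
  rewrite (RInt_ext_R (fun t => c t * - d t + d t * c t) (fun _ => 0)) by (intros; ring).
  rewrite RInt_0_R.
  assert (Hv : vRInt (fun t => col1 (Hopf (q t))) 0 2 =
    (RInt (fun t => a t * a t - b t * - b t) 0 2 + -1 * RInt (fun t => c t * c t - d t * - d t) 0 2,
     2 * RInt (fun t => a t * - d t + b t * c t) 0 2, 2 * RInt (fun t => a t * c t - b t * - d t) 0 2)).
  { rewrite <- !RInt_scal_R, <- RInt_plus_R by sm1. unfold vRInt.
    pairs; apply RInt_ext_R; intros t; rewrite Hq, Hopf_coord; unfold col1, vx, vy, vz; simpl fst; simpl snd; ring. }
  rewrite Hv. unfold v0. clear Hv.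
  set (I1 := RInt (fun t => a t * a t - b t * - b t) 0 2). set (I2 := RInt (fun t => c t * c t - d t * - d t) 0 2).
  set (I3 := RInt (fun t => a t * - d t + b t * c t) 0 2). set (I4 := RInt (fun t => a t * c t - b t * - d t) 0 2).
  split.
  - intros (E1 & E2 & E3). injection E1; injection E2; injection E3; intros.
    split; [lra |]. pairs; lra.
  - intros (E1 & E2). injection E2; intros. repeat split; pairs; lra.
Qed.

(** * Framed loops of spin curves *)

(** The rotation and the constant twist allowed by [rep_by] are already absorbed in [q], while the
    scale of [x] stays free. *)
Definition spin_of (K : component) (q : R -> C2) (x : framed) : Prop :=
  mem_V2 K q /\ (forall t, sqnorm (q t) = 1) /\
  forall t, tangent (fst x) t = col1 (Hopf (q t)) /\ snd x t = col2 (Hopf (q t)).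

Lemma RInt_of_unit q : (forall t, sqnorm (q t) = 1) -> RInt (fun t => sqnorm (q t)) 0 2 = 2.
Proof.
  intros Hq. rewrite (RInt_ext_R _ (fun _ => 1)) by (intros; apply Hq). rewrite RInt_const_R. Rring.
Qed.

Lemma H_unit q t : sqnorm (q t) = 1 -> H q t = (Hopf (q t), 1).
Proof.
  intros E. unfold H. rewrite E, Rinv_1. f_equal. unfold mscal. rewrite !vscal_1.
  now destruct (Hopf (q t)) as [[? ?] ?].
Qed.

(** [Hhat] equates the squared norm of [Phi] with the speed of its framed loop, which is constant on
    the level; the total 2 for an orthonormal pair makes that constant 1. *)
Lemma rep_by_level K Phi x : mem (Gr2o K) Phi -> framed_loop x -> level_one x -> rep_by Phi x ->
  (forall t, sqnorm (Phi t) = 1) /\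
  exists A th, SO3 A /\ forall t, tangent (fst x) t = mapp A (col1 (Hopf (Phi t))) /\
    snd x t = mapp A (vadd (vscal (cos (2 * th)) (col2 (Hopf (Phi t))))
                     (vscal (sin (2 * th)) (col3 (Hopf (Phi t))))).
Proof.
  intros [[HV HSt] Hnz] Hx Hl (y & [Hy HF] & Hs).
  assert (Hly : level_one y) by now apply (same_framed_level y x).
  destruct (framed_loop_smooth y Hy) as (Hgy & Hiy & HLy).
  pose proof (framed_loop_level y Hy Hly) as Hty.
  apply mem_V2_iff in HV. apply (St2_iff _ (proj1 HV)) in HSt.
  destruct x as [g V], y as [g' V'], Hs as (A & r & th & HA & Hr & Eg & EV).
  assert (HN : forall t, sqnorm (Phi t) = length g' / 2).
  { intros t. pose proof (f_equal snd (HF t)) as EN. change (vnorm (vderive g' t) = sqnorm (Phi t)) in EN.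
    rewrite <- EN. apply Hty. }
  assert (HN1 : forall t, sqnorm (Phi t) = 1).
  { destruct HSt as [HSt _]. rewrite (RInt_ext_R _ (fun _ => length g' / 2)), RInt_const_R in HSt by (intros; apply HN).
    intros t. rewrite HN. lra. }
  split; trivial. exists A, th. split; trivial. intros t. specialize (HF t). rewrite H_unit in HF by trivial.
  pose proof (f_equal fst HF) as EF.
  change ((tangent g' t, V' t, cross (tangent g' t) (V' t)) = Hopf (Phi t)) in EF.
  rewrite EV. simpl fst; simpl snd.
  rewrite <- EF. unfold col1, col2, col3; simpl fst; simpl snd. split; trivial.
  rewrite <- (tangent_mapp A r) by trivial. unfold tangent. now rewrite (vderive_ext _ _ t Eg).
Qed.

(** A representative [Phi] has the frame of [x] up to a rotation and a constant twist; the first is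
    absorbed by right, the second by left multiplication. *)
Lemma spin_exists K x : mem_M K x -> level_one x -> exists q, spin_of K q x.
Proof.
  intros [Hx (Phi & HPhi & Hrep)] Hl.
  destruct (rep_by_level K Phi x HPhi Hx Hl Hrep) as (HN & A & th & HA & E).
  destruct (Hopf_surj A HA) as (p & Hp & HpA).
  (* The argument is [- th], since [Hopf_umul] twists by the conjugate of [u ^ 2]. *)
  set (u := (cos th, - sin th) : C).
  assert (Hu2 : Re u * Re u + Im u * Im u = 1).
  { unfold u, Re, Im; simpl. pose proof (sin2_cos2 th) as Hsc. unfold Rsqr in Hsc. lra. }
  assert (Hu : Cmod u = 1).
  { pose proof (Cmod_sqr u). pose proof (Cmod_ge_0 u). nra. }
  exists (fun t => qmul (umul u (Phi t)) p). split; [| split].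
  - apply mem_V2_qmul, mem_V2_umul_const. apply HPhi.
  - intros t. rewrite sqnorm_qmul, sqnorm_umul, Hu, HN, Hp. ring.
  - intros t. destruct (E t) as [E1 E2]. rewrite Hopf_qmul, HpA, Hopf_umul by trivial.
    unfold mmul, col1, col2; simpl fst; simpl snd. split; [exact E1 |].
    rewrite E2. do 3 f_equal.
    + unfold u; simpl. rewrite cos_2a. ring.
    + unfold u; simpl. rewrite sin_2a. ring.
Qed.

Lemma same_framed_refl x : same_framed x x.
Proof.
  destruct x as [g V].
  exists ((1, 0, 0), (0, 1, 0), (0, 0, 1)), 1, 0. split; [apply SO3_1 | split; [lra |]].
  split; intros t; rewrite mapp_1, ?vscal_1; trivial.
  replace (2 * 0) with 0 by ring. rewrite cos_0, sin_0. now rewrite vadd_1_0.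
Qed.

(** Integrating the first vector of the frame gives a unit speed curve, closed because the integral
    over a period vanishes; its length is already 2, so normalization changes nothing. *)
Lemma Hhat_of_spin (K : component) q : mem_V2 K q -> (forall t, sqnorm (q t) = 1) ->
  vRInt (fun t => col1 (Hopf (q t))) 0 2 = v0 ->
  let x := (vRInt (fun t => col1 (Hopf (q t))) 0, fun t => col2 (Hopf (q t))) : framed in
  framed_loop x /\ Hhat q x /\ mem (Gr2o K) q /\ mem_M K x /\ level_one x /\
  (forall t, vderive (fst x) t = col1 (Hopf (q t))) /\ forall t, forget x t = fst x t.
Proof.
  intros HV HN Hcl x.
  destruct (smooth_loop_Hopf K q HV) as [HT HV2].
  set (g := vRInt (fun t => col1 (Hopf (q t))) 0) in *.
  assert (HTs := HT). apply smooth_loop_V3_iff in HTs. destruct HTs as [(Tx & Ty & Tz) Tp].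
  assert (HdR : forall f t, smooth f -> is_derive (RInt f 0) t (f t)).
  { intros f t Hf. apply (is_derive_RInt f _ 0 t).
    - apply filter_forall. intros u. apply (RInt_correct (V := R_CompleteNormedModule)). now apply smooth_ex_RInt.
    - now apply smooth_continuous. }
  assert (Hd : forall t, vderive g t = col1 (Hopf (q t))).
  { intros t. apply V3_ext; apply is_derive_unique; apply HdR; trivial. }
  assert (HsR : forall f, smooth f -> smooth (RInt f 0)).
  { intros f Hf. apply (smooth_family_slice0 0 (fun _ t => RInt f 0 t)).
    apply (smooth_family_RInt 0 (fun _ => f)). now apply smooth_family_of_smooth. }
  assert (Hgs : smooth_V3 g) by (split; [| split]; apply HsR; trivial).
  assert (Hgp : forall t, g (t + 2) = g t).
  { assert (HP : forall f : R -> R, smooth f -> (forall t, f (t + 2) = f t) -> RInt f 0 2 = 0 ->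
      forall t, RInt f 0 (t + 2) = RInt f 0 t).
    { intros f Hf Hper Hz t.
      rewrite <- (RInt_Chasles (V := R_CompleteNormedModule) f 0 2 (t + 2)) by now apply smooth_ex_RInt.
      rewrite Hz. unfold plus; simpl. rewrite Rplus_0_l.
      pose proof (RInt_comp_lin (V := R_CompleteNormedModule) f 1 2 0 t (smooth_ex_RInt _ _ _ Hf)) as E.
      replace (1 * 0 + 2) with 2 in E by ring. replace (1 * t + 2) with (t + 2) in E by ring.
      rewrite <- E. apply RInt_ext_R. intros y.
      unfold scal; simpl; unfold mult; simpl. rewrite !Rmult_1_l. apply Hper. }
    unfold v0 in Hcl. injection Hcl. intros Z3 Z2 Z1.
    intros t. apply V3_ext; apply HP; trivial; intros u; now rewrite Tp. }
  assert (Hd1 : forall t, vnorm (vderive g t) = 1).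
  { intros t. rewrite Hd. apply vnorm_eq1. destruct (Hopf_products (q t)) as (-> & _). rewrite HN. ring. }
  assert (HL : length g = 2) by (rewrite (length_const_speed g 1); trivial; ring).
  assert (Hng : forall t, normalize g t = g t).
  { intros t. unfold normalize. rewrite HL. replace (2 / 2) with 1 by field. apply vscal_1. }
  assert (Hfl : framed_loop x).
  { split; [now apply smooth_loop_V3_iff | split; [exact HV2 |]]. split; [| split; [| split]].
    - intros t E. specialize (Hd1 t). rewrite E in Hd1. apply vnorm_eq1 in Hd1. vunfold in Hd1. lra.
    - intros t. apply vnorm_eq1. destruct (Hopf_products (q t)) as (_ & -> & _). rewrite HN. ring.
    - intros t. rewrite Hd. destruct (Hopf_products (q t)) as (_ & _ & E & _). now rewrite dot_comm.
    - unfold g, vRInt. rewrite !RInt_point. reflexivity. }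
  assert (Htan : forall t, tangent g t = col1 (Hopf (q t))).
  { intros t. unfold tangent. rewrite Hd1, Rinv_1, vscal_1. apply Hd. }
  assert (HH : Hhat q x).
  { split; trivial. intros t. rewrite H_unit by trivial. unfold F, x. rewrite Htan, Hd1.
    apply (f_equal (fun m => (m, 1))). symmetry. exact (Hopf_unit (q t) (HN t)). }
  assert (HG : mem (Gr2o K) q).
  { split; [split; trivial |].
    - apply mem_V2_iff in HV. apply St2_iff; [apply HV |]. split; trivial. now apply RInt_of_unit.
    - intros t E. specialize (HN t). rewrite E in HN. unfold sqnorm in HN; simpl in HN. rewrite Cmod_0 in HN. lra. }
  split; [exact Hfl | split; [exact HH | split; [exact HG | split; [| split; [| split]]]]].
  - split; trivial. exists q. split; trivial. exists x. split; [exact HH | apply same_framed_refl].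
  - apply level_one_speed; [exact Hgs | apply Hfl |]. intros t.
    change (vnorm (vderive (normalize g) t) = 1). rewrite (vderive_ext _ _ t Hng). apply Hd1.
  - exact Hd.
  - exact Hng.
Qed.

(** * Lifting families of loops *)

(** Periodicity brings every [t] into the compact interval [[0, 2]], where [f s0] has a positive
    minimum and [f s] is uniformly close to [f s0] for [s] near [s0]. *)
Lemma positive_tube s0 f : smooth_family s0 f -> locally s0 (fun s => forall t, f s (t + 2) = f s t) ->
  (forall t, 0 < f s0 t) -> locally s0 (fun s => forall t, 0 < f s t).
Proof.
  intros Hf Hp Hpos.
  destruct (continuity_ab_min (f s0) 0 2) as [m [Hm _]]; [lra | |].
  { intros c _. apply smooth_continuity. now apply (smooth_family_slice0 s0). }
  destruct (uniform_continuity_2d_1d' f 0 2 s0 (fun t _ => smooth_family_continuity s0 f t Hf)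
    (mkposreal _ (Hpos m))) as [d Hd]. simpl in Hd.
  apply (filter_imp (fun s => ball s0 d s /\ forall t, f s (t + 2) = f s t)).
  - intros s [Hs Hps] t. destruct (periodic_reduce (f s) Hps t) as [u [Hu <-]].
    assert (Hb : Rabs (s - s0) < d) by exact Hs. apply Rabs_lt_between in Hb.
    pose proof (cond_pos d).
    specialize (Hd u s0 u s). rewrite Rminus_diag, Rabs_R0 in Hd.
    assert (Hlt : Rabs (f s u - f s0 u) < f s0 m) by (apply Hd; lra).
    apply Rabs_lt_between in Hlt. specialize (Hm u). lra.
  - apply filter_and; trivial. apply locally_ball_R.
Qed.

(** Multiplication by [e^(i pi t / 2)] maps LC onto AC. *)
Definition phase (K : component) (t : R) : C :=
  match K with od => RtoC 1 | ev => (cos (PI / 2 * t), sin (PI / 2 * t)) end.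

Lemma in_V_phase K : in_V K (phase K).
Proof.
  destruct K.
  - split; [apply smooth_C_const | reflexivity].
  - destruct (smooth_cos_sin (PI / 2)). split; [now split |]. intros t. unfold phase, Copp; simpl.
    replace (PI / 2 * (t + 2)) with (PI / 2 * t + PI) by field. now rewrite neg_cos, neg_sin.
Qed.

Lemma Cmod_phase K t : Cmod (phase K t) = 1.
Proof.
  destruct K; [apply Cmod_1 |].
  pose proof (Cmod_sqr (phase ev t)) as E. pose proof (Cmod_ge_0 (phase ev t)).
  unfold phase, Re, Im in *; simpl fst in E; simpl snd in E.
  pose proof (sin2_cos2 (PI / 2 * t)) as Hsc. unfold Rsqr in Hsc. nra.
Qed.

(** A lift through [Hopf] of all unit vectors except the opposite of the first vector of [Hopf b]. *)
Definition lift (K : component) (b : C2) (v : V3) (t : R) : C2 :=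
  umul (phase K t) (qmul (spin (mapp (mtrans (Hopf b)) v)) b).

Lemma vx_mtrans A v : vx (mapp (mtrans A) v) = dot (col1 A) v.
Proof. destruct A as [[[[a1 a2] a3] [[b1 b2] b3]] [[c1 c2] c3]]. unfold mtrans, col1. vunfold. ring. Qed.

Lemma lift_spec K b v t : sqnorm b = 1 -> dot v v = 1 -> 0 < 1 + dot (col1 (Hopf b)) v ->
  sqnorm (lift K b v t) = 1 /\ col1 (Hopf (lift K b v t)) = v.
Proof.
  intros Hb Hv Hp. pose proof (SO3_Hopf b Hb) as HA.
  destruct (spin_spec (mapp (mtrans (Hopf b)) v)) as [H1 H2].
  - rewrite dot_mapp; trivial. now apply SO3_mtrans.
  - now rewrite vx_mtrans.
  - unfold lift. split.
    + rewrite sqnorm_umul, sqnorm_qmul, Cmod_phase, H1, Hb. ring.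
    + rewrite (proj1 (col_Hopf_umul _ _ (Cmod_phase K t))), (proj1 (col_Hopf_qmul _ _)), H2.
      now apply mapp_mtrans_r.
Qed.

Lemma smooth_family_C2_qmul s0 c p : smooth_family_C2 s0 c -> smooth_family_C2 s0 (fun s t => qmul (c s t) p).
Proof. intros [[H1 H2] [H3 H4]]. cunfold. repeat split; smf. Qed.

Lemma smooth_family_C2_umul s0 u c : smooth_C u -> smooth_family_C2 s0 c ->
  smooth_family_C2 s0 (fun s t => umul (u t) (c s t)).
Proof.
  intros [H5 H6] [[H1 H2] [H3 H4]].
  apply (smooth_family_of_smooth s0) in H5. apply (smooth_family_of_smooth s0) in H6.
  cunfold. repeat split; smf.
Qed.

Lemma smooth_family_V3_mapp s0 A c : smooth_family_V3 s0 c -> smooth_family_V3 s0 (fun s t => mapp A (c s t)).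
Proof.
  intros (Hx & Hy & Hz). split; [| split]; unfold mapp, vadd, vscal, vx, vy, vz in *; simpl in *; smf.
Qed.

Lemma smooth_family_V3_Hopf s0 c : smooth_family_C2 s0 c ->
  smooth_family_V3 s0 (fun s t => col1 (Hopf (c s t))) /\
  smooth_family_V3 s0 (fun s t => col2 (Hopf (c s t))).
Proof.
  intros [[H1 H2] [H3 H4]].
  assert (E : forall f g : R -> R -> V3, (forall s t, f s t = g s t) -> smooth_family_V3 s0 f -> smooth_family_V3 s0 g).
  { intros f g Hfg (Hx & Hy & Hz). split; [| split];
      (eapply smooth_family_ext; [apply filter_forall; intros s t; rewrite <- Hfg; reflexivity |]); assumption. }
  split; (eapply E; [intros s t; rewrite Hopf_eta, Hopf_coord; unfold col1, col2; simpl fst; simpl snd; reflexivity |]);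
    cunfold; unfold smooth_family_V3, vx, vy, vz; simpl fst; simpl snd; repeat split; smf.
Qed.

Lemma smooth_family_spin s0 c : smooth_family_V3 s0 c ->
  locally s0 (fun s => forall t, 0 < 1 + vx (c s t)) -> smooth_family_C2 s0 (fun s t => spin (c s t)).
Proof.
  intros (Hx & Hy & Hz) Hp.
  assert (Hn : smooth_family s0 (fun s t => / sqrt (2 * (1 + vx (c s t))))).
  { apply (smooth_family_inv s0 (fun s t => sqrt (2 * (1 + vx (c s t))))).
    - apply (smooth_family_sqrt s0 (fun s t => 2 * (1 + vx (c s t)))); [smf |].
      apply filter_imp with (2 := Hp). intros s Hs t. specialize (Hs t). lra.
    - apply filter_imp with (2 := Hp). intros s Hs t. apply Rgt_not_eq, sqrt_lt_R0. specialize (Hs t). lra. }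
  unfold smooth_family_C2, smooth_family_C, comp1, comp2, spin, Re, Im; simpl fst; simpl snd.
  repeat split; smf.
Qed.

Lemma smooth_family_lift K s0 b c : smooth_family_V3 s0 c ->
  locally s0 (fun s => forall t, 0 < 1 + dot (col1 (Hopf b)) (c s t)) ->
  smooth_family_C2 s0 (fun s t => lift K b (c s t) t).
Proof.
  intros Hc Hp. unfold lift.
  apply (smooth_family_C2_umul s0 (phase K) (fun s t => qmul (spin (mapp (mtrans (Hopf b)) (c s t))) b)).
  - pose proof (in_V_phase K) as Hph. apply in_V_iff in Hph. apply Hph.
  - apply (smooth_family_C2_qmul s0 (fun s t => spin (mapp (mtrans (Hopf b)) (c s t)))).
    apply (smooth_family_spin s0 (fun s t => mapp (mtrans (Hopf b)) (c s t))).
    + now apply smooth_family_V3_mapp.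
    + apply filter_imp with (2 := Hp). intros s Hs t. rewrite vx_mtrans. apply Hs.
Qed.

Lemma smooth_family_C2_slice s0 c : smooth_family_C2 s0 c -> locally s0 (fun s => smooth_C2 (c s)).
Proof.
  intros [[H1 H2] [H3 H4]]. apply smooth_family_slice in H1, H2, H3, H4.
  generalize (filter_and _ _ (filter_and _ _ H1 H2) (filter_and _ _ H3 H4)).
  apply filter_imp. intros s [[? ?] [? ?]]. repeat split; trivial.
Qed.

(** The closing condition on [c] is included so that each [q s] is an orthonormal pair by [St2_iff]
    and integrates to a framed loop. *)
Definition lifts (K : component) (s0 : R) (q : R -> R -> C2) (c : R -> R -> V3) : Prop :=
  smooth_family_C2 s0 q /\
  locally s0 (fun s => mem_V2 K (q s) /\ (forall t, sqnorm (q s t) = 1) /\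
    (forall t, col1 (Hopf (q s t)) = c s t) /\ vRInt (c s) 0 2 = v0).

(** The direction has to be missed at [s0] only; by [positive_tube] nearby loops miss it too, so
    that one formula lifts the whole germ. *)
Lemma lifts_lift K s0 b c : sqnorm b = 1 -> curve LS2 s0 c ->
  locally s0 (fun s => vRInt (c s) 0 2 = v0) ->
  (forall t, c s0 t <> vscal (-1) (col1 (Hopf b))) ->
  lifts K s0 (fun s t => lift K b (c s t) t) c.
Proof.
  intros Hb [Hmem Hc] Hz Hb0.
  set (e := col1 (Hopf b)) in *.
  assert (He : dot e e = 1).
  { destruct (Hopf_products b) as (E & _). fold e in E. rewrite E, Hb. ring. }
  assert (Hp : locally s0 (fun s => forall t, 0 < 1 + dot e (c s t))).
  { apply (positive_tube s0 (fun s t => 1 + dot e (c s t))).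
    - destruct Hc as (Hx & Hy & Hz'). unfold dot. smf.
    - apply filter_imp with (2 := Hmem). intros s [Hs _] t. apply smooth_loop_V3_iff in Hs. now rewrite (proj2 Hs).
    - intros t. destruct (locally_singleton _ _ Hmem) as [_ Hn]. specialize (Hn t). apply vnorm_eq1 in Hn.
      specialize (Hb0 t). apply Rnot_le_lt. intros Hle. apply Hb0.
      apply V3_eq_of_dot; trivial.
      + rewrite <- He. unfold dot, vscal, vx, vy, vz; simpl. ring.
      (* Nonnegativity of [|e + c|^2 = 2 + 2 dot e c] forces the product to be exactly [-1]. *)
      + assert (Hsq : 0 <= dot (vadd e (c s0 t)) (vadd e (c s0 t))).
        { generalize (vadd e (c s0 t)). intros [[x y] z]. vunfold. nra. }
        replace (dot (vadd e (c s0 t)) (vadd e (c s0 t))) with (dot e e + dot (c s0 t) (c s0 t) + 2 * dot e (c s0 t)) in Hsq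
          by (vunfold; ring).
        replace (dot (c s0 t) (vscal (-1) e)) with (- dot e (c s0 t)) by (vunfold; ring). lra. }
  pose proof (smooth_family_lift K s0 b c Hc Hp) as Hq. split; trivial.
  generalize (filter_and _ _ (filter_and _ _ Hmem Hp) (filter_and _ _ Hz (smooth_family_C2_slice _ _ Hq))).
  apply filter_imp. intros s [[[Hl Hn] Hps] [Hzs Hqs]].
  assert (Hsp : forall t, sqnorm (lift K b (c s t) t) = 1 /\ col1 (Hopf (lift K b (c s t) t)) = c s t).
  { intros t. exact (lift_spec K b (c s t) t Hb (proj1 (vnorm_eq1 _) (Hn t)) (Hps t)). }
  split; [| split; [| split]]; trivial; try (intros t; apply Hsp).
  apply mem_V2_iff. split; trivial. intros t.
  apply smooth_loop_V3_iff in Hl. rewrite (proj2 Hl). unfold lift. rewrite umul_umul. f_equal.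
  pose proof (in_V_phase K) as Hph. apply in_V_iff in Hph. apply Hph.
Qed.

Lemma smooth_loop_misses_Hopf sigma : smooth_loop_V3 sigma ->
  exists b, sqnorm b = 1 /\ forall t, sigma t <> vscal (-1) (col1 (Hopf b)).
Proof.
  intros Hs. destruct (smooth_loop_misses sigma Hs) as (m & Hm & Hmiss).
  destruct (Hopf_col1_surj (vscal (-1) m)) as (b & Hb & E).
  - rewrite <- Hm. vunfold; ring.
  - exists b. split; trivial. intros t. rewrite E, vscal_vscal.
    replace (-1 * -1) with 1 by ring. rewrite vscal_1. apply Hmiss.
Qed.

Definition framed_of (q : R -> C2) : framed :=
  (vRInt (fun t => col1 (Hopf (q t))) 0, fun t => col2 (Hopf (q t))).

(** This is [Hhat_of_spin] for each [s]; the loops form a smooth family because they are primitives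
    of one. *)
Lemma lifts_framed K s0 q c : lifts K s0 q c ->
  curve (M K) s0 (fun s => framed_of (q s)) /\
  locally s0 (fun s => framed_loop (framed_of (q s)) /\ Hhat (q s) (framed_of (q s)) /\
    mem (Gr2o K) (q s) /\ mem_M K (framed_of (q s)) /\
    level_one (framed_of (q s)) /\ forall t, vderive (forget (framed_of (q s))) t = c s t).
Proof.
  intros [Hq Hloc].
  assert (Hl : locally s0 (fun s => framed_loop (framed_of (q s)) /\ Hhat (q s) (framed_of (q s)) /\
    mem (Gr2o K) (q s) /\ mem_M K (framed_of (q s)) /\
    level_one (framed_of (q s)) /\ forall t, vderive (forget (framed_of (q s))) t = c s t)).
  { apply filter_imp with (2 := Hloc). intros s (HV & HN & E & Hz).
    rewrite <- (vRInt_ext _ _ 0 2 E) in Hz.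
    destruct (Hhat_of_spin K (q s) HV HN Hz) as (H1 & H2 & H3 & H4 & H5 & H6 & H7).
    fold (framed_of (q s)) in *. repeat (split; [assumption |]).
    intros t. rewrite (vderive_ext _ _ t H7), H6. apply E. }
  split; trivial.
  destruct (smooth_family_V3_Hopf s0 q Hq) as [(T1 & T2 & T3) HV].
  exists (fun s => framed_of (q s)). split; [| split; [exact HV |]].
  - split; [| split]; apply smooth_family_RInt; assumption.
  - apply filter_imp with (2 := Hl). intros s (_ & _ & _ & H4 & _). repeat (split; [exact H4 |]). apply same_framed_refl.
Qed.

(** * Unit speed loops and their derivatives *)

Lemma IsoImm_eq_of_vderive g h : smooth_V3 g -> smooth_V3 h -> g 0 = h 0 ->
  (forall t, vderive g t = vderive h t) -> forall t, g t = h t.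
Proof.
  assert (HI : forall f : R -> R, smooth f -> forall t, f t = f 0 + RInt (Derive f) 0 t).
  { intros f Hf t. rewrite RInt_Derive; [ring | |].
    - intros x _. now apply smooth_ex_derive.
    - intros x _. now apply (smooth_continuous (Derive f)), smooth_Derive. }
  intros (G1 & G2 & G3) (H1 & H2 & H3) E0 E t.
  apply V3_ext; [rewrite (HI _ G1), (HI _ H1) | rewrite (HI _ G2), (HI _ H2) | rewrite (HI _ G3), (HI _ H3)];
    rewrite E0; f_equal; apply RInt_ext_R; intros u; specialize (E u); unfold vderive in E; now injection E.
Qed.

Lemma mem_IsoImm_LS2 g : mem_IsoImm g -> mem_LS2 (vderive g) /\ vRInt (vderive g) 0 2 = v0.
Proof.
  intros (Hg & Hn & _). split; [split; trivial; now apply smooth_loop_vderive |].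
  apply smooth_loop_V3_iff in Hg. destruct Hg as [(G1 & G2 & G3) Hp].
  assert (HI : forall f : R -> R, smooth f -> f (0 + 2) = f 0 -> RInt (Derive f) 0 2 = 0).
  { intros f Hf E. rewrite RInt_Derive.
    - rewrite Rplus_0_l in E. rewrite E. Rring.
    - intros x _. now apply smooth_ex_derive.
    - intros x _. now apply (smooth_continuous (Derive f)), smooth_Derive. }
  apply V3_ext; [apply (HI _ G1) | apply (HI _ G2) | apply (HI _ G3)]; now rewrite Hp.
Qed.

Lemma curve_LS2_vderive s0 c : smooth_family_V3 s0 c -> locally s0 (fun s => mem_IsoImm (c s)) ->
  curve LS2 s0 (fun s => vderive (c s)) /\ locally s0 (fun s => vRInt (vderive (c s)) 0 2 = v0).
Proof.
  intros (H1 & H2 & H3) Hm. split; [split |].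
  - apply filter_imp with (2 := Hm). intros s Hs. now apply mem_IsoImm_LS2.
  - split; [| split]; apply smooth_family_partial_t; assumption.
  - apply filter_imp with (2 := Hm). intros s Hs. now apply mem_IsoImm_LS2.
Qed.

(** Two framings of congruent loops with the same parity differ by [u^2] for a loop [u]: both have spin
    lifts in the same space, and the quotient of the lifts is [u]. *)
Lemma same_of_forget K x y : mem_M K x -> level_one x -> mem_M K y -> level_one y ->
  same_SO3 (forget x) (forget y) -> exists u, LS1 u /\ same_framed (twist u x) y.
Proof.
  intros Hx Lx Hy Ly (A & HA & E).
  destruct (spin_exists K x Hx Lx) as (q & Hq & Nq & Sq).
  destruct (spin_exists K y Hy Ly) as (q' & Hq' & Nq' & Sq').
  destruct (Hopf_surj A HA) as (p & Np & Hp).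
  destruct (framed_loop_smooth x (proj1 Hx)) as (Gx & _ & HLx).
  destruct (framed_loop_smooth y (proj1 Hy)) as (Gy & _ & HLy).
  set (u := fun t => fst (qmul (q' t) (qconj (qmul (q t) p)))).
  assert (Hu : forall t, Cmod (u t) = 1 /\ q' t = umul (u t) (qmul (q t) p)).
  { intros t. apply Hopf_col1_eq; trivial.
    - now rewrite sqnorm_qmul, Nq, Np, Rmult_1_l.
    - destruct (Sq t) as [E1 _], (Sq' t) as [E2 _]. rewrite <- E2.
      rewrite (proj1 (col_Hopf_qmul _ _)), Hp, <- E1.
      rewrite <- (proj1 (framed_loop_level y (proj1 Hy) Ly t)), <- (proj1 (framed_loop_level x (proj1 Hx) Lx t)).
      rewrite (vderive_ext _ _ t E). symmetry. apply vderive_mapp.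
      apply smooth_V3_ex_vderive. unfold forget, normalize. now apply smooth_V3_vscal. }
  exists u. split.
  - split; [| intros t; apply Hu].
    apply (LS1_ratio K (fun t => qmul (q t) p) q'); trivial. now apply mem_V2_qmul.
  - destruct x as [g V], y as [g' V']. simpl fst in *. simpl snd in *.
    exists A, (length g' / length g), 0. split; [trivial | split; [now apply Rdiv_lt_0_compat |]]. split.
    + intros t. specialize (E t). unfold forget, normalize in E; simpl fst in E.
      transitivity (vscal (length g' / 2) (vscal (2 / length g') (g' t))).
      * rewrite vscal_vscal. rewrite <- (vscal_1 (g' t)) at 1. f_equal. field. lra.
      * rewrite E, !mapp_vscal, vscal_vscal. f_equal. field. lra.
    + intros t. destruct (Hu t) as [Hu1 Hu2]. destruct (Sq t) as [E1 E2], (Sq' t) as [_ E3].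
      destruct (col_Hopf_qmul (q t) p) as (_ & C2q & C3q).
      rewrite E3, Hu2, (proj2 (col_Hopf_umul _ _ Hu1)), C2q, C3q, Hp.
      replace (2 * 0) with 0 by ring. rewrite cos_0, sin_0.
      rewrite <- !mapp_vscal, <- mapp_vadd. f_equal.
      replace (col3 (Hopf (q t))) with (cross (tangent g t) (V t)).
      2:{ rewrite E1, E2. destruct (Hopf_products (q t)) as (_ & _ & _ & ->). now rewrite Nq, vscal_1. }
      rewrite <- E2, vadd_1_0. reflexivity.
Qed.

(** * Forgetting the framing as a diffeomorphism *)

Lemma forget_of_same x y u : framed_loop x -> same_framed (twist u x) y -> same_SO3 (forget x) (forget y).
Proof.
  intros Hx Hs. destruct (framed_loop_smooth x Hx) as (Gx & _ & HLx). destruct x as [g V].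
  exact (same_framed_forget (twist u (g, V)) y Gx HLx Hs).
Qed.

Lemma mem_M_red_IsoImm K x : mem (M_red K) x -> mem_IsoImm (forget x).
Proof. intros [[Hx _] Hl]. now apply forget_IsoImm. Qed.

Lemma curve_M_red_IsoImm K s0 d : curve (M_red K) s0 d -> curve IsoImm s0 (fun s => forget (d s)).
Proof.
  intros (c & (c' & Hc1 & _ & Hc3) & Hloc).
  (* On the level this equals the normalizing factor [2 / length], but it is read off at the single
     time 0, so its smoothness in [s] follows from [smooth_family_at]. *)
  set (r := fun s => / vnorm (vderive (fst (c' s)) 0)).
  assert (Hr : smooth_family s0 (fun s _ => r s)).
  { destruct Hc1 as (H1 & H2 & H3).
    apply smooth_family_partial_t in H1, H2, H3.
    apply (smooth_family_at s0 _ 0) in H1, H2, H3.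
    assert (Hpos : locally s0 (fun s => 0 < dot (vderive (fst (c' s)) 0) (vderive (fst (c' s)) 0))).
    { apply filter_imp with (2 := Hc3). intros s ([Hf _] & _).
      destruct (framed_loop_smooth _ Hf) as (_ & Hi & _). specialize (Hi 0).
      assert (Hne : dot (vderive (fst (c' s)) 0) (vderive (fst (c' s)) 0) <> 0)
        by (intros E; apply Hi; now apply dot_self_eq0).
      destruct (vderive (fst (c' s)) 0) as [[a b] e]. vunfold. vunfold in Hne. nra. }
    unfold r.
    apply (smooth_family_inv s0 (fun s _ => vnorm (vderive (fst (c' s)) 0))).
    - apply (smooth_family_sqrt s0 (fun s _ => dot (vderive (fst (c' s)) 0) (vderive (fst (c' s)) 0))).
      + unfold dot. smf.
      + apply filter_imp with (2 := Hpos). trivial.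
    - apply filter_imp with (2 := Hpos). intros s Hs _. apply Rgt_not_eq. now apply sqrt_lt_R0. }
  exists (fun s t => vscal (r s) (fst (c' s) t)). split.
  - destruct Hc1 as (H1 & H2 & H3). unfold vscal. split; [| split]; unfold vx at 1, vy at 1, vz at 1; simpl fst; simpl snd; smf.
  - generalize (filter_and _ _ Hc3 Hloc). apply filter_imp.
    intros s ((Hm' & _ & Hs) & ((Hm & Hl) & Hd & (u & _ & Hu))).
    (* The smooth curve [c'] is only equivalent to the curve [c] in the level; the level is
       invariant under that equivalence. *)
    assert (Hl' : level_one (c' s)) by (apply (same_framed_level _ _ (proj1 Hm') (proj1 Hm) Hs); trivial).
    destruct (framed_loop_smooth _ (proj1 Hm')) as (Gx & _ & HLx).
    assert (E : (fun t => vscal (r s) (fst (c' s) t)) = forget (c' s)).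
    { apply functional_extensionality. intros t. unfold forget, normalize. f_equal. unfold r.
      rewrite (proj2 (framed_loop_level _ (proj1 Hm') Hl' 0)). field. lra. }
    rewrite E. split; [now apply forget_IsoImm; [apply Hm' |] | split].
    + now apply (mem_M_red_IsoImm K).
    + apply same_SO3_trans with (forget (c s)).
      * now apply same_framed_forget.
      * apply (forget_of_same _ _ u); trivial. apply Hm.
Qed.

(** Turns a lift of a curve of spherical loops into a smooth curve of framed loops representing [d].
    The curve [d] enters only through the congruence class of its loops for each [s], so nothing is
    assumed about its dependence on [s]. *)
Lemma lift_to_M_red K s0 q c d : lifts K s0 q c -> locally s0 (fun s => mem (M_red K) (d s)) ->
  locally s0 (fun s => same_SO3 (c s) (vderive (forget (d s)))) ->
  curve (M K) s0 (fun s => framed_of (q s)) /\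
  locally s0 (fun s => mem (M_red K) (framed_of (q s)) /\ mem (M_red K) (d s) /\
     same (M_red K) (framed_of (q s)) (d s)).
Proof.
  intros Hl Hd Hs. destruct (lifts_framed K s0 q c Hl) as [Hc Hloc]. split; trivial.
  generalize (filter_and _ _ Hloc (filter_and _ _ Hd Hs)). apply filter_imp.
  intros s ((Hf & _ & _ & Hm & Hlev & Hv) & ((Hdm & Hdl) & (A & HA & E))).
  split; [now split | split; [now split |]].
  apply (same_of_forget K); trivial.
  exists A. split; trivial. apply IsoImm_eq_of_vderive.
  - destruct (framed_loop_smooth _ (proj1 Hdm)) as (G & _). now apply smooth_V3_vscal.
  - destruct (framed_loop_smooth _ Hf) as (G & _). now apply smooth_V3_mapp, smooth_V3_vscal.
  - destruct (forget_IsoImm _ (proj1 Hdm) Hdl) as (_ & _ & ->).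
    destruct (forget_IsoImm _ Hf Hlev) as (_ & _ & ->). now rewrite mapp_v0.
  - intros t. destruct (framed_loop_smooth _ Hf) as (G & _).
    rewrite E, vderive_mapp by (apply smooth_V3_ex_vderive; now apply smooth_V3_vscal). now rewrite Hv.
Qed.

Lemma curve_IsoImm_M_red K s0 d : locally s0 (fun s => mem (M_red K) (d s)) ->
  curve IsoImm s0 (fun s => forget (d s)) -> curve (M_red K) s0 d.
Proof.
  intros Hd (c & Hc & Hloc).
  assert (Hm : locally s0 (fun s => mem_IsoImm (c s))) by (apply filter_imp with (2 := Hloc); tauto).
  destruct (curve_LS2_vderive s0 c Hc Hm) as [HL Hz].
  destruct (smooth_loop_misses_Hopf (vderive (c s0))) as (b & Hb & Hmiss).
  { apply (locally_singleton _ _ (proj1 HL)). }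
  pose proof (lifts_lift K s0 b _ Hb HL Hz Hmiss) as Hl.
  eexists. apply (lift_to_M_red K s0 _ _ d Hl Hd).
  apply filter_imp with (2 := Hloc). intros s (H1 & _ & H3).
  apply same_SO3_vderive; trivial. destruct H1 as [H1 _]. now apply smooth_loop_V3_iff in H1.
Qed.

Lemma forget_diffeomorphism K : diffeomorphism (M_red K) IsoImm forget.
Proof.
  split; [| split; [| split]].
  - apply mem_M_red_IsoImm.
  - intros x y [Hx Lx] [Hy Ly]. split.
    + intros (u & _ & Hu). apply (forget_of_same _ _ u); trivial. apply Hx.
    + intros Hs. now apply (same_of_forget K).
  - intros g Hg. destruct (mem_IsoImm_LS2 g Hg) as [Hs Hz].
    destruct (smooth_loop_misses_Hopf (vderive g) (proj1 Hs)) as (b & Hb & Hmiss).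
    (* A single loop is treated as a curve constant in [s], so that the construction for families
       also gives surjectivity. *)
    assert (HL : lifts K 0 (fun _ t => lift K b (vderive g t) t) (fun _ => vderive g)).
    { apply lifts_lift; trivial.
      - split; [now apply filter_forall |]. destruct Hs as [Hs _]. apply smooth_loop_V3_iff in Hs.
        destruct Hs as [(H1 & H2 & H3) _]. split; [| split]; now apply smooth_family_of_smooth.
      - now apply filter_forall. }
    apply lifts_framed in HL. destruct HL as [_ HL]. apply locally_singleton in HL.
    destruct HL as (Hf & _ & _ & Hm & Hl & Hv).
    eexists. split; [split; [exact Hm | exact Hl] |].
    apply same_SO3_refl. apply IsoImm_eq_of_vderive.
    + destruct (framed_loop_smooth _ Hf) as (G & _). now apply smooth_V3_vscal.
    + destruct Hg as [Hg _]. now apply smooth_loop_V3_iff in Hg.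
    + destruct (forget_IsoImm _ Hf Hl) as (_ & _ & ->). destruct Hg as (_ & _ & ->). reflexivity.
    + exact Hv.
  - intros s0 d Hd. split; [apply curve_M_red_IsoImm | now apply curve_IsoImm_M_red].
Qed.

(** * Infinitesimal rotations *)

Lemma Derive_dot f g s : ex_vderive f s -> ex_vderive g s ->
  Derive (fun x => dot (f x) (g x)) s = dot (vderive f s) (g s) + dot (f s) (vderive g s).
Proof.
  intros (F1 & F2 & F3) (G1 & G2 & G3). apply is_derive_unique.
  apply Derive_correct in F1, F2, F3, G1, G2, G3.
  set (a1 := Derive _ s) in F1. set (a2 := Derive _ s) in F2. set (a3 := Derive _ s) in F3.
  set (b1 := Derive _ s) in G1. set (b2 := Derive _ s) in G2. set (b3 := Derive _ s) in G3.
  change (vderive f s) with (a1, a2, a3). change (vderive g s) with (b1, b2, b3).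
  replace (dot (a1, a2, a3) (g s) + dot (f s) (b1, b2, b3)) with
    (plus (plus (a1 * vx (g s) + vx (f s) * b1) (a2 * vy (g s) + vy (f s) * b2)) (a3 * vz (g s) + vz (f s) * b3))
    by (unfold plus; simpl; unfold dot, vx, vy, vz; simpl; ring).
  unfold dot.
  apply (is_derive_plus (fun x => vx (f x) * vx (g x) + vy (f x) * vy (g x)) (fun x => vz (f x) * vz (g x))).
  - apply (is_derive_plus (fun x => vx (f x) * vx (g x)) (fun x => vy (f x) * vy (g x)));
      apply (is_derive_mult (K := R_AbsRing)); trivial; intros; apply Rmult_comm.
  - apply (is_derive_mult (K := R_AbsRing)); trivial; intros; apply Rmult_comm.
Qed.

Lemma Derive_minor (f1 f2 g1 g2 : R -> R) s : ex_derive f1 s -> ex_derive f2 s -> ex_derive g1 s -> ex_derive g2 s ->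
  ex_derive (fun x => f1 x * g2 x - f2 x * g1 x) s /\
  Derive (fun x => f1 x * g2 x - f2 x * g1 x) s
  = (Derive f1 s * g2 s - Derive f2 s * g1 s) + (f1 s * Derive g2 s - f2 s * Derive g1 s).
Proof.
  intros H1 H2 H3 H4. split; [auto_derive; tauto |]. apply is_derive_unique. auto_derive; [tauto |].
  change (fun x => f1 x) with f1. change (fun x => f2 x) with f2.
  change (fun x => g1 x) with g1. change (fun x => g2 x) with g2. ring.
Qed.

Lemma vderive_cross f g s : ex_vderive f s -> ex_vderive g s ->
  ex_vderive (fun x => cross (f x) (g x)) s /\
  vderive (fun x => cross (f x) (g x)) s = vadd (cross (vderive f s) (g s)) (cross (f s) (vderive g s)).
Proof.
  intros (F1 & F2 & F3) (G1 & G2 & G3).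
  destruct (Derive_minor _ _ _ _ s F2 F3 G2 G3) as [E1 D1].
  destruct (Derive_minor _ _ _ _ s F3 F1 G3 G1) as [E2 D2].
  destruct (Derive_minor _ _ _ _ s F1 F2 G1 G2) as [E3 D3].
  split; [split; [exact E1 | split; [exact E2 | exact E3]] |].
  apply V3_ext; [exact D1 | exact D2 | exact D3].
Qed.

(** The angular velocity [x] of the frame [e1], [e2], [cross e1 e2]: its coordinates in this frame
    are read from [d1 = cross x e1] and [d2 = cross x e2]. *)
Definition xi (e1 e2 d1 d2 : V3) : V3 :=
  vadd (vscal (dot d2 (cross e1 e2)) e1)
    (vadd (vscal (- dot d1 (cross e1 e2)) e2) (vscal (dot d1 e2) (cross e1 e2))).

(** A first-order motion [delta] preserving the products with the moving vectors
    [e1 + s d1], [e2 + s d2] is the infinitesimal rotation determined by these two. *)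
Lemma infinitesimal_rotation e1 e2 d1 d2 sigma delta :
  dot e1 e1 = 1 -> dot e2 e2 = 1 -> dot e1 e2 = 0 ->
  dot d1 e1 = 0 -> dot d2 e2 = 0 -> dot d1 e2 + dot e1 d2 = 0 ->
  dot delta e1 + dot sigma d1 = 0 -> dot delta e2 + dot sigma d2 = 0 ->
  dot delta (cross e1 e2) + dot sigma (vadd (cross d1 e2) (cross e1 d2)) = 0 ->
  delta = cross (xi e1 e2 d1 d2) sigma.
Proof.
  intros H1 H2 H12 K1 K2 K12 L1 L2 L3.
  pose proof (SO3_of_cross e1 e2 H1 H2 H12) as HE.
  pose proof (SO3_mtrans _ HE) as HR.
  (* The rotation [Q] carries the frame to the standard basis, where the hypotheses become linear
     equations in coordinates. *)
  remember (mtrans (e1, e2, cross e1 e2)) as Q eqn:EQ.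
  assert (Q1 : mapp Q e1 = (1, 0, 0)).
  { rewrite EQ. transitivity (mapp (mtrans (e1, e2, cross e1 e2)) (mapp (e1, e2, cross e1 e2) (1, 0, 0))).
    - f_equal. clear. destruct e1 as [[a b] c]. veq.
    - now apply mapp_mtrans_l. }
  assert (Q2 : mapp Q e2 = (0, 1, 0)).
  { rewrite EQ. transitivity (mapp (mtrans (e1, e2, cross e1 e2)) (mapp (e1, e2, cross e1 e2) (0, 1, 0))).
    - f_equal. clear. destruct e2 as [[a b] c]. veq.
    - now apply mapp_mtrans_l. }
  assert (Hinj : forall v w, mapp Q v = mapp Q w -> v = w).
  { intros v w E. rewrite <- (mapp_mtrans_l Q v), <- (mapp_mtrans_l Q w) by trivial. now rewrite E. }
  apply Hinj. rewrite <- cross_mapp by trivial.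
  rewrite <- (dot_mapp Q d1 e1 HR) in K1. rewrite <- (dot_mapp Q d2 e2 HR) in K2.
  rewrite <- (dot_mapp Q d1 e2 HR), <- (dot_mapp Q e1 d2 HR) in K12.
  rewrite <- (dot_mapp Q delta e1 HR), <- (dot_mapp Q sigma d1 HR) in L1.
  rewrite <- (dot_mapp Q delta e2 HR), <- (dot_mapp Q sigma d2 HR) in L2.
  rewrite <- (dot_mapp Q delta (cross e1 e2) HR), <- (dot_mapp Q sigma (vadd _ _) HR), mapp_vadd, <- !cross_mapp in L3 by trivial.
  unfold xi. rewrite !mapp_vadd, !mapp_vscal.
  rewrite <- (dot_mapp Q d2 (cross e1 e2) HR), <- (dot_mapp Q d1 (cross e1 e2) HR), <- (dot_mapp Q d1 e2 HR), <- !cross_mapp by trivial.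
  rewrite Q1, Q2 in *.
  destruct (mapp Q d1) as [[a1 a2] a3], (mapp Q d2) as [[b1 b2] b3].
  destruct (mapp Q sigma) as [[s1 s2] s3], (mapp Q delta) as [[t1 t2] t3].
  clear - K1 K2 K12 L1 L2 L3.
  unfold dot, cross, vadd, vscal, vx, vy, vz in *; simpl in *.
  assert (a1 = 0) as -> by lra. assert (b2 = 0) as -> by lra. assert (b1 = - a2) as -> by lra.
  pairs; lra.
Qed.

(** * The reduced form on the loop space of the sphere is well defined *)

Lemma smooth_family_V3_ex_vderive s0 c t : smooth_family_V3 s0 c -> ex_vderive (fun s => c s t) s0.
Proof. intros (H1 & H2 & H3). split; [| split].
  - exact (smooth_family_ex_derive s0 _ t H1).
  - exact (smooth_family_ex_derive s0 _ t H2).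
  - exact (smooth_family_ex_derive s0 _ t H3).
Qed.

Lemma smooth_velocity c : smooth_family_V3 0 c -> smooth_V3 (velocity_V3 c).
Proof.
  intros (H1 & H2 & H3). apply smooth_family_partial_s in H1, H2, H3. split; [| split].
  - exact (smooth_family_slice0 0 _ H1).
  - exact (smooth_family_slice0 0 _ H2).
  - exact (smooth_family_slice0 0 _ H3).
Qed.

Lemma smooth_family_V3_slice0 s0 c : smooth_family_V3 s0 c -> smooth_V3 (c s0).
Proof. intros (H1 & H2 & H3). split; [| split].
  - exact (smooth_family_slice0 s0 _ H1).
  - exact (smooth_family_slice0 s0 _ H2).
  - exact (smooth_family_slice0 s0 _ H3).
Qed.

Lemma closed_velocity c : smooth_family_V3 0 c -> locally 0 (fun s => vRInt (c s) 0 2 = v0) ->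
  vRInt (velocity_V3 c) 0 2 = v0.
Proof.
  intros (H1 & H2 & H3) Hz.
  assert (HI : forall f, smooth_family 0 f -> locally 0 (fun s => RInt (f s) 0 2 = 0) ->
    RInt (fun t => Derive (fun s => f s t) 0) 0 2 = 0).
  { intros f Hf Hl. rewrite <- (is_derive_unique _ _ _ (smooth_family_is_derive_RInt 0 f 0 2 Hf)).
    rewrite (Derive_ext_loc _ (fun _ => 0)) by exact Hl. apply Derive_const. }
  apply V3_ext; (apply HI; [assumption |]); apply filter_imp with (2 := Hz); intros s E;
    [apply (f_equal vx) in E | apply (f_equal vy) in E | apply (f_equal vz) in E]; exact E.
Qed.

(** The function [dot (sigma 0) (sigma t)] equals 1 at 0 and has mean 0, so it is somewhere
    nonpositive and has a zero in between. This supplies an orthonormal pair of points on the loop,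
    whose motion determines an infinitesimal rotation. *)
Lemma closed_orthogonal sigma : smooth_V3 sigma -> (forall t, dot (sigma t) (sigma t) = 1) ->
  vRInt sigma 0 2 = v0 -> exists t, dot (sigma 0) (sigma t) = 0.
Proof.
  intros (H1 & H2 & H3) Hn Hz.
  set (f := fun t => dot (sigma 0) (sigma t)).
  assert (Hf : smooth f) by (unfold f, dot; sm1).
  assert (HI : RInt f 0 2 = 0).
  { transitivity (RInt (fun t => vx (sigma t) * vx (sigma 0) + (vy (sigma t) * vy (sigma 0) + vz (sigma t) * vz (sigma 0))) 0 2).
    - apply RInt_ext_R. intros t. unfold f, dot. ring.
    - rewrite (RInt_lin3 _ _ _ _ _ _ 0 2 H1 H2 H3).
      unfold vRInt, v0 in Hz. injection Hz. intros -> -> ->. Rring. }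
  assert (Hex : exists t, f t <= 0).
  { apply NNPP. intros Hno.
    assert (0 < RInt f 0 2); [| lra].
    apply RInt_gt_0; [lra | |].
    - intros t _. apply Rnot_le_lt. intros Hle. apply Hno. now exists t.
    - intros t _. now apply smooth_continuous. }
  destruct Hex as [t Ht].
  destruct (IVT_gen f 0 t 0 (smooth_continuity f Hf)) as [u [_ Hu]]; [| now exists u].
  assert (f 0 = 1) by apply Hn. unfold Rmin, Rmax. destruct (Rle_dec (f 0) (f t)); lra.
Qed.

(** The rotation taking one curve to the other exists for each [s] without any regularity in [s].
    Products of two points and triple products are invariant and smooth, so their derivatives agree
    and give the linear conditions of [infinitesimal_rotation] for the difference of the
    velocities. *)
Lemma velocity_rotation c c' : smooth_family_V3 0 c -> smooth_family_V3 0 c' ->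
  (forall t, dot (c 0 t) (c 0 t) = 1) -> vRInt (c 0) 0 2 = v0 ->
  (forall t, c 0 t = c' 0 t) -> locally 0 (fun s => same_SO3 (c s) (c' s)) ->
  exists x, forall t, velocity_V3 c' t = vadd (velocity_V3 c t) (cross x (c 0 t)).
Proof.
  intros Hc Hc' Hn Hz H0 Hs.
  destruct (closed_orthogonal (c 0) (smooth_family_V3_slice0 0 c Hc) Hn Hz) as [t2 Ht2].
  set (delta := fun t => vadd (velocity_V3 c' t) (vscal (-1) (velocity_V3 c t))).
  assert (R1 : forall t u, dot (delta t) (c 0 u) + dot (c 0 t) (delta u) = 0).
  { intros t u.
    assert (E : Derive (fun s => dot (c' s t) (c' s u)) 0 = Derive (fun s => dot (c s t) (c s u)) 0).
    { apply Derive_ext_loc, filter_imp with (2 := Hs). intros s (A & HA & E). now rewrite !E, dot_mapp. }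
    rewrite (Derive_dot (fun s => c' s t) (fun s => c' s u)), (Derive_dot (fun s => c s t) (fun s => c s u)) in E
      by (now apply smooth_family_V3_ex_vderive).
    rewrite <- !H0 in E.
    change (dot (velocity_V3 c' t) (c 0 u) + dot (c 0 t) (velocity_V3 c' u)
      = dot (velocity_V3 c t) (c 0 u) + dot (c 0 t) (velocity_V3 c u)) in E.
    unfold delta.
    transitivity (dot (velocity_V3 c' t) (c 0 u) + dot (c 0 t) (velocity_V3 c' u)
      - (dot (velocity_V3 c t) (c 0 u) + dot (c 0 t) (velocity_V3 c u))); [| rewrite E; ring].
    unfold dot, vadd, vscal, vx, vy, vz; simpl. ring. }
  assert (R2 : forall t, dot (delta t) (cross (c 0 0) (c 0 t2))
     + dot (c 0 t) (vadd (cross (delta 0) (c 0 t2)) (cross (c 0 0) (delta t2))) = 0).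
  { intros t.
    assert (E : Derive (fun s => dot (c' s t) (cross (c' s 0) (c' s t2))) 0
              = Derive (fun s => dot (c s t) (cross (c s 0) (c s t2))) 0).
    { apply Derive_ext_loc, filter_imp with (2 := Hs). intros s (A & HA & E).
      now rewrite !E, cross_mapp, dot_mapp. }
    destruct (vderive_cross (fun s => c' s 0) (fun s => c' s t2) 0) as [X' D'];
      try (now apply smooth_family_V3_ex_vderive).
    destruct (vderive_cross (fun s => c s 0) (fun s => c s t2) 0) as [X D];
      try (now apply smooth_family_V3_ex_vderive).
    rewrite (Derive_dot (fun s => c' s t) (fun s => cross (c' s 0) (c' s t2))),
      (Derive_dot (fun s => c s t) (fun s => cross (c s 0) (c s t2))) in E
      by (trivial; now apply smooth_family_V3_ex_vderive).
    rewrite D, D' in E. rewrite <- !H0 in E.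
    change (dot (velocity_V3 c' t) (cross (c 0 0) (c 0 t2))
        + dot (c 0 t) (vadd (cross (velocity_V3 c' 0) (c 0 t2)) (cross (c 0 0) (velocity_V3 c' t2)))
      = dot (velocity_V3 c t) (cross (c 0 0) (c 0 t2))
        + dot (c 0 t) (vadd (cross (velocity_V3 c 0) (c 0 t2)) (cross (c 0 0) (velocity_V3 c t2)))) in E.
    unfold delta. revert E.
    generalize (velocity_V3 c' t), (velocity_V3 c' 0), (velocity_V3 c' t2),
      (velocity_V3 c t), (velocity_V3 c 0), (velocity_V3 c t2), (c 0 t), (c 0 0), (c 0 t2).
    clear. intros u' a' b' u a b s e f E.
    transitivity (dot u' (cross e f) + dot s (vadd (cross a' f) (cross e b'))
      - (dot u (cross e f) + dot s (vadd (cross a f) (cross e b)))); [| rewrite E; ring].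
    unfold dot, cross, vadd, vscal, vx, vy, vz; simpl. ring. }
  (* The points at times 0 and [t2] are orthonormal, and their own motions determine the rotation
     for all [t]. *)
  exists (xi (c 0 0) (c 0 t2) (delta 0) (delta t2)). intros t.
  rewrite <- (infinitesimal_rotation (c 0 0) (c 0 t2) (delta 0) (delta t2) (c 0 t) (delta t)); trivial.
  - unfold delta. generalize (velocity_V3 c' t), (velocity_V3 c t). intros [[? ?] ?] [[? ?] ?]. veq.
  - pose proof (R1 0 0) as E. rewrite (dot_comm (c 0 0)) in E. lra.
  - pose proof (R1 t2 t2) as E. rewrite (dot_comm (c 0 t2)) in E. lra.
Qed.

(** Rotational directions are degenerate on the zero level of the momentum map: after expansion
    every extra term is a constant vector paired with [sigma], [u1] or [u2], all of which integrate
    to zero. *)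
Lemma Omega_rotation sigma u1 u2 x1 x2 : smooth_V3 sigma -> smooth_V3 u1 -> smooth_V3 u2 ->
  (forall t, dot (sigma t) (sigma t) = 1) -> (forall t, dot (sigma t) (u1 t) = 0) ->
  (forall t, dot (sigma t) (u2 t) = 0) ->
  vRInt sigma 0 2 = v0 -> vRInt u1 0 2 = v0 -> vRInt u2 0 2 = v0 ->
  Omega sigma (fun t => vadd (u1 t) (cross x1 (sigma t))) (fun t => vadd (u2 t) (cross x2 (sigma t)))
  = Omega sigma u1 u2.
Proof.
  intros Hs Hu Hv Hn N1 N2 Is Iu Iv.
  assert (HI : forall w x, smooth_V3 w -> vRInt w 0 2 = v0 -> RInt (fun t => dot x (w t)) 0 2 = 0).
  { intros w x (W1 & W2 & W3) Iw.
    rewrite (RInt_ext_R _ (fun t => vx (w t) * vx x + (vy (w t) * vy x + vz (w t) * vz x)))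
      by (intros; unfold dot; ring).
    rewrite RInt_lin3 by trivial. unfold vRInt, v0 in Iw. injection Iw. intros -> -> ->. Rring. }
  assert (HS : forall w x, smooth_V3 w -> smooth (fun t => dot x (w t))).
  { intros w x (W1 & W2 & W3). unfold dot. sm1. }
  assert (H0 : smooth (fun t => dot (sigma t) (cross (u1 t) (u2 t)))).
  { destruct Hs as (S1 & S2 & S3), Hu as (U1 & U2 & U3), Hv as (W1 & W2 & W3).
    unfold dot, cross. unfold vx, vy, vz in *; simpl fst in *; simpl snd in *. sm1. }
  unfold Omega.
  rewrite (RInt_ext_R _ (fun t => dot (sigma t) (cross (u1 t) (u2 t)) +
     (dot x1 (u2 t) + (dot (vscal (-1) x2) (u1 t) + dot (cross x1 x2) (sigma t))))).
  - rewrite RInt_plus_R by (sm1; now apply HS). rewrite RInt_plus_R by (sm1; now apply HS).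
    rewrite RInt_plus_R by (now apply HS). rewrite !HI by trivial. Rring.
  - intros t. specialize (Hn t). specialize (N1 t). specialize (N2 t). revert Hn N1 N2.
    generalize (sigma t), (u1 t), (u2 t). clear. intros s u v Hn N1 N2.
    transitivity (dot s (cross u v) + (dot s s * dot x1 v - dot s x1 * dot s v) + (- (dot s s * dot x2 u) + dot s x2 * dot s u)
      + dot s s * dot (cross x1 x2) s).
    + unfold dot, cross, vadd, vx, vy, vz; simpl. ring.
    + rewrite Hn, N1, N2. unfold dot, vscal, vx, vy, vz; simpl. ring.
Qed.

Lemma normal_velocity c : smooth_family_V3 0 c -> locally 0 (fun s => mem_LS2 (c s)) ->
  forall t, dot (c 0 t) (velocity_V3 c t) = 0.
Proof.
  intros Hc Hm t.
  assert (E : Derive (fun s => dot (c s t) (c s t)) 0 = 0).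
  { rewrite (Derive_ext_loc _ (fun _ => 1)); [apply Derive_const |].
    apply filter_imp with (2 := Hm). intros s [_ Hn]. now apply vnorm_eq1. }
  rewrite (Derive_dot (fun s => c s t) (fun s => c s t)) in E by (now apply smooth_family_V3_ex_vderive).
  change (dot (velocity_V3 c t) (c 0 t) + dot (c 0 t) (velocity_V3 c t) = 0) in E.
  rewrite (dot_comm (velocity_V3 c t)) in E. lra.
Qed.

Lemma Omega_ext s s' u u' v v' : (forall t, s t = s' t) -> (forall t, u t = u' t) -> (forall t, v t = v' t) ->
  Omega s u v = Omega s' u' v'.
Proof. intros E1 E2 E3. apply RInt_ext_R. intros t. now rewrite E1, E2, E3. Qed.

Lemma same_SO3_mapp A g h : SO3 A -> same_SO3 g h -> same_SO3 (fun t => mapp A (g t)) h.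
Proof.
  intros HA Hs. apply same_SO3_trans with g; trivial. apply same_SO3_sym. now exists A.
Qed.

Lemma curve_LS2_mapp A s0 c : SO3 A -> curve LS2 s0 c -> curve LS2 s0 (fun s t => mapp A (c s t)).
Proof.
  intros HA [Hm Hc]. split; [| now apply smooth_family_V3_mapp].
  apply filter_imp with (2 := Hm). intros s [Hs Hn]. apply smooth_loop_V3_iff in Hs. split.
  - apply smooth_loop_V3_iff. split; [now apply smooth_V3_mapp |]. intros t. now rewrite (proj2 Hs).
  - intros t. now rewrite vnorm_mapp.
Qed.

Lemma closed_mapp A c : SO3 A -> smooth_V3 c -> vRInt c 0 2 = v0 -> vRInt (fun t => mapp A (c t)) 0 2 = v0.
Proof. intros HA Hc E. rewrite vRInt_mapp, E by trivial. apply mapp_v0. Qed.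

Lemma mem_LS2_smooth c : mem_LS2 c -> smooth_V3 c.
Proof. intros [Hs _]. now apply smooth_loop_V3_iff in Hs. Qed.

Lemma Omega_well_defined c1 c2 c1' c2' :
  curve LS2 0 c1 -> curve LS2 0 c2 -> curve LS2 0 c1' -> curve LS2 0 c2' ->
  locally 0 (fun s => vRInt (c1 s) 0 2 = v0) -> locally 0 (fun s => vRInt (c2 s) 0 2 = v0) ->
  (forall t, c1 0 t = c2 0 t) -> (forall t, c1' 0 t = c2' 0 t) ->
  locally 0 (fun s => same_SO3 (c1 s) (c1' s)) -> locally 0 (fun s => same_SO3 (c2 s) (c2' s)) ->
  Omega (c1 0) (velocity_V3 c1) (velocity_V3 c2) = Omega (c1' 0) (velocity_V3 c1') (velocity_V3 c2').
Proof.
  intros Hc1 Hc2 [_ Hc1'] [_ Hc2'] Z1 Z2 H0 H0' S1 S2.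
  destruct (locally_singleton _ _ S1) as (A & HA & EA).
  (* A constant rotation, which leaves [Omega] unchanged, first makes the loops at [s = 0] coincide,
     as [velocity_rotation] requires; the same [A] serves both curves because they start at the same
     loop. *)
  set (b1 := fun s t => mapp A (c1 s t)). set (b2 := fun s t => mapp A (c2 s t)).
  assert (Hb1 : curve LS2 0 b1) by now apply curve_LS2_mapp.
  assert (Hb2 : curve LS2 0 b2) by now apply curve_LS2_mapp.
  assert (T1 : locally 0 (fun s => vRInt (b1 s) 0 2 = v0)).
  { generalize (filter_and _ _ Z1 (proj1 Hc1)). apply filter_imp. intros s [Hz Hm].
    apply closed_mapp; trivial. now apply mem_LS2_smooth. }
  assert (T2 : locally 0 (fun s => vRInt (b2 s) 0 2 = v0)).
  { generalize (filter_and _ _ Z2 (proj1 Hc2)). apply filter_imp. intros s [Hz Hm].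
    apply closed_mapp; trivial. now apply mem_LS2_smooth. }
  assert (Q1 : locally 0 (fun s => same_SO3 (b1 s) (c1' s))).
  { apply filter_imp with (2 := S1). intros s Hs. now apply same_SO3_mapp. }
  assert (Q2 : locally 0 (fun s => same_SO3 (b2 s) (c2' s))).
  { apply filter_imp with (2 := S2). intros s Hs. now apply same_SO3_mapp. }
  assert (B1 : forall t, b1 0 t = c1' 0 t) by (intros; unfold b1; now rewrite EA).
  assert (B12 : forall t, b1 0 t = b2 0 t) by (intros; unfold b1, b2; now rewrite H0).
  assert (B2 : forall t, b2 0 t = c2' 0 t) by (intros; now rewrite <- B12, B1).
  assert (N1 : forall t, dot (b1 0 t) (b1 0 t) = 1).
  { intros t. destruct (locally_singleton _ _ (proj1 Hb1)) as [_ Hn]. now apply vnorm_eq1. }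
  assert (N2 : forall t, dot (b2 0 t) (b2 0 t) = 1) by (intros; now rewrite <- B12).
  transitivity (Omega (b1 0) (velocity_V3 b1) (velocity_V3 b2)).
  - apply RInt_ext_R. intros t.
    assert (V1 : velocity_V3 b1 t = mapp A (velocity_V3 c1 t)).
    { apply (vderive_mapp A (fun s => c1 s t)). apply smooth_family_V3_ex_vderive, Hc1. }
    assert (V2 : velocity_V3 b2 t = mapp A (velocity_V3 c2 t)).
    { apply (vderive_mapp A (fun s => c2 s t)). apply smooth_family_V3_ex_vderive, Hc2. }
    rewrite V1, V2. unfold b1. now rewrite cross_mapp, dot_mapp.
  - destruct (velocity_rotation b1 c1') as [x1 X1]; trivial; [apply Hb1 | exact (locally_singleton _ _ T1) |].
    destruct (velocity_rotation b2 c2') as [x2 X2]; trivial; [apply Hb2 | exact (locally_singleton _ _ T2) |].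
    rewrite (Omega_ext (c1' 0) (b1 0) (velocity_V3 c1') (fun t => vadd (velocity_V3 b1 t) (cross x1 (b1 0 t)))
      (velocity_V3 c2') (fun t => vadd (velocity_V3 b2 t) (cross x2 (b1 0 t)))); trivial.
    + symmetry. apply Omega_rotation; trivial.
      * exact (smooth_family_V3_slice0 0 b1 (proj2 Hb1)).
      * apply smooth_velocity, Hb1.
      * apply smooth_velocity, Hb2.
      * apply normal_velocity; apply Hb1.
      * intros t. rewrite B12. apply normal_velocity; apply Hb2.
      * exact (locally_singleton _ _ T1).
      * apply closed_velocity; [apply Hb1 | trivial].
      * apply closed_velocity; [apply Hb2 | trivial].
    + intros t. now rewrite B12, X2.
Qed.

(** * Comparison of the two forms *)

Lemma velocity_Hopf q t : smooth_family_C2 0 q ->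
  let '((a, b), (c, d)) := q 0 t in let '((a', b'), (c', d')) := velocity_C2 q t in
  velocity_V3 (fun s t => col1 (Hopf (q s t))) t =
  (2 * (a * a' + b * b' - c * c' - d * d'), 2 * (b' * c + b * c' - a' * d - a * d'),
   2 * (b' * d + b * d' + a' * c + a * c')).
Proof.
  intros [[H1 H2] [H3 H4]].
  apply (smooth_family_ex_derive 0 _ t) in H1, H2, H3, H4.
  destruct (q 0 t) as [[a b] [c d]] eqn:E0. unfold velocity_C2, velocity_C.
  set (fa := fun s => Re (fst (q s t))). set (fb := fun s => Im (fst (q s t))).
  set (fc := fun s => Re (snd (q s t))). set (fd := fun s => Im (snd (q s t))).
  change (ex_derive fa 0) in H1. change (ex_derive fb 0) in H2. change (ex_derive fc 0) in H3. change (ex_derive fd 0) in H4.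
  assert (Eq : forall s, q s t = ((fa s, fb s), (fc s, fd s))).
  { intros s. unfold fa, fb, fc, fd, Re, Im. now destruct (q s t) as [[? ?] [? ?]]. }
  pose proof (Eq 0) as E. rewrite E0 in E. injection E. intros Ed Ec Eb Ea. clear E E0.
  unfold velocity_V3.
  rewrite (vderive_ext _ (fun s => (fa s * fa s + fb s * fb s - fc s * fc s - fd s * fd s,
     2 * (fb s * fc s - fa s * fd s), 2 * (fb s * fd s + fa s * fc s)))) by (intros s; rewrite Eq, Hopf_coord; reflexivity).
  clearbody fa fb fc fd. rewrite Ea, Eb, Ec, Ed.
  apply V3_ext; unfold vderive, vx, vy, vz; simpl fst; simpl snd; apply is_derive_unique;
    (auto_derive; [tauto |]);
    change (fun x => fa x) with fa; change (fun x => fb x) with fb; change (fun x => fc x) with fc; change (fun x => fd x) with fd;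
    ring.
Qed.

Lemma Omega_omega K q1 q2 c1 c2 : lifts K 0 q1 c1 -> lifts K 0 q2 c2 -> (forall t, q1 0 t = q2 0 t) ->
  Omega (c1 0) (velocity_V3 c1) (velocity_V3 c2) = 4 * omega_L2 (velocity_C2 q1) (velocity_C2 q2).
Proof.
  intros [Hq1 L1] [Hq2 L2] H0.
  assert (Hv : forall q, smooth_family_C2 0 q -> smooth_C2 (velocity_C2 q)).
  { intros q [[H1 H2] [H3 H4]]. apply smooth_family_partial_s, smooth_family_slice0 in H1, H2, H3, H4.
    repeat split; assumption. }
  pose proof (Hv q1 Hq1) as [V11 V12]. pose proof (Hv q2 Hq2) as [V21 V22].
  (* Differentiating the unit norm makes the velocity orthogonal to [q], that is, an imaginary
     quaternion times [q]. *)
  assert (HN : forall q c, smooth_family_C2 0 q -> locally 0 (fun s => mem_V2 K (q s) /\ (forall t, sqnorm (q s t) = 1) /\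
    (forall t, col1 (Hopf (q s t)) = c s t) /\ vRInt (c s) 0 2 = v0) -> forall t,
    let '((a, b), (c, d)) := q 0 t in let '((a', b'), (c', d')) := velocity_C2 q t in
    a * a + b * b + c * c + d * d = 1 /\ a * a' + b * b' + c * c' + d * d' = 0).
  { intros q c [[H1 H2] [H3 H4]] Hl t.
    apply (smooth_family_ex_derive 0 _ t) in H1, H2, H3, H4.
    destruct (q 0 t) as [[a b] [e d]] eqn:E0. unfold velocity_C2, velocity_C.
    set (fa := fun s => Re (fst (q s t))). set (fb := fun s => Im (fst (q s t))).
    set (fc := fun s => Re (snd (q s t))). set (fd := fun s => Im (snd (q s t))).
    change (ex_derive fa 0) in H1. change (ex_derive fb 0) in H2. change (ex_derive fc 0) in H3. change (ex_derive fd 0) in H4.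
    assert (Eq : forall s, q s t = ((fa s, fb s), (fc s, fd s))).
    { intros s. unfold fa, fb, fc, fd, Re, Im. now destruct (q s t) as [[? ?] [? ?]]. }
    pose proof (Eq 0) as E. rewrite E0 in E. injection E. intros Ed Ec Eb Ea. clear E E0.
    assert (Hc : locally 0 (fun s => fa s * fa s + fb s * fb s + fc s * fc s + fd s * fd s = 1)).
    { apply filter_imp with (2 := Hl). intros s (_ & Hs & _). specialize (Hs t). now rewrite Eq, sqnorm_coord in Hs. }
    clearbody fa fb fc fd. split.
    - rewrite Ea, Eb, Ec, Ed. exact (locally_singleton _ _ Hc).
    - assert (ED : Derive (fun s => fa s * fa s + fb s * fb s + fc s * fc s + fd s * fd s) 0 = 0).
      { rewrite (Derive_ext_loc _ (fun _ => 1)) by exact Hc. apply Derive_const. }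
      assert (ED' : Derive (fun s => fa s * fa s + fb s * fb s + fc s * fc s + fd s * fd s) 0
        = 2 * (fa 0 * Derive fa 0 + fb 0 * Derive fb 0 + fc 0 * Derive fc 0 + fd 0 * Derive fd 0)).
      { apply is_derive_unique. auto_derive; [tauto |].
        change (fun x => fa x) with fa; change (fun x => fb x) with fb; change (fun x => fc x) with fc; change (fun x => fd x) with fd.
        ring. }
      rewrite Ea, Eb, Ec, Ed. lra. }
  pose proof (HN q1 c1 Hq1 L1) as N1. pose proof (HN q2 c2 Hq2 L2) as N2. clear HN.
  assert (Hloc : forall q c, locally 0 (fun s => mem_V2 K (q s) /\ (forall t, sqnorm (q s t) = 1) /\
    (forall t, col1 (Hopf (q s t)) = c s t) /\ vRInt (c s) 0 2 = v0) -> forall t,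
    velocity_V3 c t = velocity_V3 (fun s t => col1 (Hopf (q s t))) t).
  { intros q c Hl t. apply V3_ext; apply Derive_ext_loc, filter_imp with (2 := Hl); intros s (_ & _ & E & _);
      now rewrite E. }
  rewrite (Omega_ext (c1 0) (fun t => col1 (Hopf (q1 0 t))) (velocity_V3 c1) (velocity_V3 (fun s t => col1 (Hopf (q1 s t))))
    (velocity_V3 c2) (velocity_V3 (fun s t => col1 (Hopf (q2 s t))))); try (now apply Hloc).
  2:{ intros t. destruct (locally_singleton _ _ L1) as (_ & _ & E & _). now rewrite E. }
  unfold omega_L2. rewrite !L2_coord by trivial. unfold Cplus, Im at 1; simpl fst; simpl snd.
  unfold Omega.
  destruct V11 as [A1 A2], V12 as [A3 A4], V21 as [B1 B2], V22 as [B3 B4].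
  rewrite <- RInt_plus_R by sm1.
  (* [f] is the imaginary part of the Hermitian product, and [omega_L2] carries the opposite sign,
     whence [-4]. *)
  set (f := fun t => _ + _). transitivity (RInt (fun t => -4 * f t) 0 2).
  2:{ rewrite RInt_scal_R by (unfold f; sm1). Rring. }
  apply RInt_ext_R. intros t. unfold f.
  pose proof (velocity_Hopf q1 t Hq1) as W1. pose proof (velocity_Hopf q2 t Hq2) as W2.
  specialize (N1 t). specialize (N2 t). rewrite <- (H0 t) in *.
  change (dot (col1 (Hopf (q1 0 t))) (cross (velocity_V3 (fun s t => col1 (Hopf (q1 s t))) t)
      (velocity_V3 (fun s t => col1 (Hopf (q2 s t))) t)) =
    -4 * (fst (fst (velocity_C2 q1 t)) * - snd (fst (velocity_C2 q2 t))
      + snd (fst (velocity_C2 q1 t)) * fst (fst (velocity_C2 q2 t))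
      + (fst (snd (velocity_C2 q1 t)) * - snd (snd (velocity_C2 q2 t))
      + snd (snd (velocity_C2 q1 t)) * fst (snd (velocity_C2 q2 t))))).
  destruct (q1 0 t) as [[a b] [c d]], (velocity_C2 q1 t) as [[a' b'] [c' d']], (velocity_C2 q2 t) as [[a2 b2] [e2 d2]].
  destruct N1 as [N P1], N2 as [_ P2]. rewrite W1, W2, Hopf_coord. clear - N P1 P2.
  unfold col1, dot, cross, vx, vy, vz; simpl fst; simpl snd.
  (* Let [x] and [y] be the two velocities times [conj q]; their real parts are the two sums that
     vanish. The outer bracket is the [i]-component of the cross product of their imaginary parts,
     expressed through the velocities without using the unit norm, so that the identity is
     polynomial. *)
  transitivity (4 * (a * a + b * b + c * c + d * d) * ((a * a + b * b + c * c + d * d) *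
     (a' * b2 - b' * a2 + c' * d2 - d' * e2)
     - (a * a' + b * b' + c * c' + d * d') * (b2 * a - a2 * b + d2 * c - e2 * d)
     + (a * a2 + b * b2 + c * e2 + d * d2) * (b' * a - a' * b + d' * c - c' * d))); [| rewrite N, P1, P2]; ring.
Qed.

(** * The induced form and the Millson-Zombro form *)

Lemma form_IsoImm_unique d1 d2 w w' : form IsoImm d1 d2 w -> form IsoImm d1 d2 w' -> w = w'.
Proof.
  intros (c1 & c2 & [Hc1 L1] & [Hc2 L2] & H0 & ->) (c1' & c2' & [Hc1' L1'] & [Hc2' L2'] & H0' & ->).
  apply Omega_well_defined; trivial.
  - apply filter_imp with (2 := L1). intros s ((_ & Hz) & _). exact Hz.
  - apply filter_imp with (2 := L2). intros s ((_ & Hz) & _). exact Hz.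
  - generalize (filter_and _ _ L1 L1'). apply filter_imp. intros s ((_ & _ & A & HA & EA) & (_ & _ & B & HB & EB)).
    apply same_SO3_trans with (vderive (d1 s)); [now exists A | apply same_SO3_sym; now exists B].
  - generalize (filter_and _ _ L2 L2'). apply filter_imp. intros s ((_ & _ & A & HA & EA) & (_ & _ & B & HB & EB)).
    apply same_SO3_trans with (vderive (d2 s)); [now exists A | apply same_SO3_sym; now exists B].
Qed.

(** The lift [e] differs from [Phi] by a unitary matrix for each [s]. By [U2_factor] this changes
    the first vector of the frame by a rotation only, so the loops of [e] stay congruent to those of
    [d], and smoothness in [s] is taken from [e] alone. *)
Lemma lifts_of_Gr2 K c d Phi e :
  locally 0 (fun s => mem (M_red K) (c s) /\ mem (M_red K) (d s) /\ same (M_red K) (c s) (d s)) ->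
  curve (Gr2o K) 0 Phi -> locally 0 (fun s => rep_by (Phi s) (c s)) ->
  curve (V2 K) 0 e -> locally 0 (fun s => mem (Gr2 K) (e s) /\ mem (Gr2 K) (Phi s) /\ same (Gr2 K) (e s) (Phi s)) ->
  lifts K 0 e (fun s t => col1 (Hopf (e s t))) /\
  locally 0 (fun s => same_SO3 (fun t => col1 (Hopf (e s t))) (vderive (forget (d s)))).
Proof.
  intros Hcd [_ Hnz] Hrep [_ He] Hse.
  assert (Hall : locally 0 (fun s => (mem_V2 K (e s) /\ (forall t, sqnorm (e s t) = 1) /\
    (forall t, col1 (Hopf (e s t)) = col1 (Hopf (e s t))) /\ vRInt (fun t => col1 (Hopf (e s t))) 0 2 = v0) /\
    same_SO3 (fun t => col1 (Hopf (e s t))) (vderive (forget (d s))))).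
  { generalize (filter_and _ _ (filter_and _ _ Hcd Hnz) (filter_and _ _ Hrep Hse)). apply filter_imp.
    intros s ((((Hc & Lc) & (Hd & Ld) & (u & _ & Hu)) & Hn) & (Hr & ((HeV & HeS) & HP & (U & HU & EU)))).
    destruct (rep_by_level K (Phi s) (c s)) as (N & A & th & HA & ET); trivial; [now split | apply Hc |].
    destruct (U2_factor U HU) as (l & p & Hl & Hp & EU').
    assert (EP : forall t, Phi s t = umul l (qmul (e s t) p)) by (intros; now rewrite <- EU').
    assert (Ne : forall t, sqnorm (e s t) = 1).
    { intros t. specialize (N t). rewrite EP, sqnorm_umul, sqnorm_qmul, Hl, Hp in N. lra. }
    split; [split; [exact HeV | split; [exact Ne | split; [reflexivity |]]] |].
    - apply mem_V2_iff in HeV. now apply (St2_iff _ (proj1 HeV)).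
    - apply same_SO3_trans with (vderive (forget (c s))).
      + exists (mmul A (Hopf p)). split; [apply SO3_mmul; trivial; now apply SO3_Hopf |].
        intros t. rewrite (proj1 (framed_loop_level _ (proj1 Hc) Lc t)), (proj1 (ET t)), EP.
        now rewrite (proj1 (col_Hopf_umul _ _ Hl)), (proj1 (col_Hopf_qmul _ _)), mapp_mmul.
      + apply same_SO3_vderive.
        * destruct (framed_loop_smooth _ (proj1 Hc)) as (G & _). now apply smooth_V3_vscal.
        * apply (forget_of_same _ _ u); trivial. apply Hc. }
  split.
  - split; [exact He |]. apply filter_imp with (2 := Hall). tauto.
  - apply filter_imp with (2 := Hall). tauto.
Qed.

Lemma curve_LS2_lifts K q c : lifts K 0 q (fun s t => c s t) -> smooth_family_V3 0 c -> curve LS2 0 c.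
Proof.
  intros [_ Hl] Hc. split; trivial. apply filter_imp with (2 := Hl). intros s (HV & HN & E & _).
  assert (Ec : c s = fun t => col1 (Hopf (q s t))) by (apply functional_extensionality; intros; now rewrite E).
  rewrite Ec. split; [apply (smooth_loop_Hopf K _ HV) |]. intros t. apply vnorm_eq1.
  destruct (Hopf_products (q s t)) as (-> & _). rewrite HN. ring.
Qed.

Lemma form_M_red_IsoImm K d1 d2 w : form (M_red K) d1 d2 w ->
  form IsoImm (fun s => forget (d1 s)) (fun s => forget (d2 s)) (4 * w).
Proof.
  intros (c1 & c2 & [_ Hl1] & [_ Hl2] & _ & (Phi1 & Phi2 & HP1 & HP2 & HR1 & HR2 & _ &
    (e1 & e2 & [He1 Hs1] & [He2 Hs2] & H0 & ->))).
  destruct (lifts_of_Gr2 K c1 d1 Phi1 e1 Hl1 HP1 HR1 He1 Hs1) as [L1 S1].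
  destruct (lifts_of_Gr2 K c2 d2 Phi2 e2 Hl2 HP2 HR2 He2 Hs2) as [L2 S2].
  assert (HL : forall c d e, lifts K 0 e (fun s t => col1 (Hopf (e s t))) ->
    locally 0 (fun s => mem (M_red K) (c s) /\ mem (M_red K) (d s) /\ same (M_red K) (c s) (d s)) ->
    locally 0 (fun s => same_SO3 (fun t => col1 (Hopf (e s t))) (vderive (forget (d s)))) ->
    curve LS2 0 (fun s t => col1 (Hopf (e s t))) /\
    locally 0 (fun s => mem LS2_red (fun t => col1 (Hopf (e s t))) /\
      mem LS2_red (vderive (forget (d s))) /\
      same LS2_red (fun t => col1 (Hopf (e s t))) (vderive (forget (d s))))).
  { intros c d e He Hl Hs.
    assert (Hc : curve LS2 0 (fun s t => col1 (Hopf (e s t)))).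
    { apply (curve_LS2_lifts K e); trivial. exact (proj1 (smooth_family_V3_Hopf 0 e (proj1 He))). }
    split; trivial.
    generalize (filter_and _ _ (filter_and _ _ (proj1 Hc) (proj2 He)) (filter_and _ _ Hl Hs)).
    apply filter_imp. intros s ((Hm & (_ & _ & _ & Hz)) & ((_ & Hd & _) & (A & HA & E))).
    split; [now split | split].
    - apply mem_IsoImm_LS2. now apply (mem_M_red_IsoImm K).
    - exists A. split; trivial. intros t. now rewrite E. }
  (* The representatives on the sphere come from the very lifts on which the value on [M] is
     computed. *)
  exists (fun s t => col1 (Hopf (e1 s t))), (fun s t => col1 (Hopf (e2 s t))).
  split; [now apply (HL c1) | split; [now apply (HL c2) | split]].
  - intros t. change (col1 (Hopf (e1 0 t)) = col1 (Hopf (e2 0 t))). now rewrite H0.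
  - exact (eq_sym (Omega_omega K e1 e2 _ _ L1 L2 H0)).
Qed.

(** Reflexivity of the relation in a reduced space has to be witnessed by a group element. *)
Definition U2_id : C2 * C2 := ((RtoC 1, RtoC 0), (RtoC 0, RtoC 1)).

Lemma U2_U2_id : U2 U2_id.
Proof. unfold U2, U2_id. repeat split; cunfold; f_equal; ring. Qed.

Lemma right_mul_id Phi t : right_mul U2_id Phi t = Phi t.
Proof. unfold right_mul, U2_id. destruct (Phi t). simpl. f_equal; ring. Qed.

Lemma curve_Gr2_lifts K q c : lifts K 0 q c ->
  curve (V2 K) 0 q /\
  locally 0 (fun s => mem (Gr2 K) (q s) /\ mem (Gr2 K) (q s) /\ same (Gr2 K) (q s) (q s)) /\
  curve (Gr2o K) 0 q.
Proof.
  intros HL. destruct (lifts_framed K 0 q c HL) as [_ Hloc]. destruct HL as [Hq Hl].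
  assert (HV : curve (V2 K) 0 q) by (split; [apply filter_imp with (2 := Hl); tauto | exact Hq]).
  assert (HG : locally 0 (fun s => mem (Gr2 K) (q s) /\ mem (Gr2 K) (q s) /\ same (Gr2 K) (q s) (q s))).
  { apply filter_imp with (2 := Hloc). intros s (_ & _ & [Hm _] & _). split; [exact Hm | split; [exact Hm |]].
    exists U2_id. split; [apply U2_U2_id |]. intros t. apply right_mul_id. }
  split; [exact HV | split; [exact HG |]]. split.
  - exists q. now split.
  - apply filter_imp with (2 := Hloc). intros s (_ & _ & [_ Hn] & _). exact Hn.
Qed.

Lemma form_IsoImm_M_red K d1 d2 w : curve (M_red K) 0 d1 -> curve (M_red K) 0 d2 ->
  form IsoImm (fun s => forget (d1 s)) (fun s => forget (d2 s)) w ->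
  form (M_red K) d1 d2 (/ 4 * w).
Proof.
  intros (x1 & _ & Hd1) (x2 & _ & Hd2) (c1 & c2 & [Hc1 L1] & [Hc2 L2] & H0 & ->).
  (* Both curves start at the same loop, so one [b] serves both and their lifts agree at [s = 0], as
     the forms on [M] and [V2] demand. *)
  destruct (smooth_loop_misses_Hopf (c1 0)) as (b & Hb & Hmiss).
  { apply (locally_singleton _ _ (proj1 Hc1)). }
  set (q1 := fun s t => lift K b (c1 s t) t). set (q2 := fun s t => lift K b (c2 s t) t).
  assert (Q1 : lifts K 0 q1 c1).
  { apply (lifts_lift K 0 b c1 Hb Hc1); [| exact Hmiss]. apply filter_imp with (2 := L1). intros s ((_ & Hz) & _). exact Hz. }
  assert (Q2 : lifts K 0 q2 c2).
  { apply (lifts_lift K 0 b c2 Hb Hc2).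
    - apply filter_imp with (2 := L2). intros s ((_ & Hz) & _). exact Hz.
    - intros t. rewrite <- (H0 t). apply Hmiss. }
  assert (E0 : q1 0 = q2 0).
  { apply functional_extensionality. intros t. unfold q1, q2. now rewrite (H0 t). }
  assert (HM : forall c d q, lifts K 0 q c ->
    locally 0 (fun s => mem LS2_red (c s) /\ mem LS2_red (vderive (forget (d s))) /\ same LS2_red (c s) (vderive (forget (d s)))) ->
    locally 0 (fun s => mem (M_red K) (d s)) ->
    curve (M K) 0 (fun s => framed_of (q s)) /\
    locally 0 (fun s => mem (M_red K) (framed_of (q s)) /\ mem (M_red K) (d s) /\
     same (M_red K) (framed_of (q s)) (d s))).
  { intros c d q HL Hl Hd. apply (lift_to_M_red K 0 q c d HL Hd).
    apply filter_imp with (2 := Hl). intros s (_ & _ & A & HA & E). exists A. split; trivial.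
    intros t. symmetry. apply E. }
  exists (fun s => framed_of (q1 s)), (fun s => framed_of (q2 s)).
  split; [| split; [| split]].
  - apply (HM c1); trivial. apply filter_imp with (2 := Hd1). intros s (_ & Hm & _). exact Hm.
  - apply (HM c2); trivial. apply filter_imp with (2 := Hd2). intros s (_ & Hm & _). exact Hm.
  - rewrite E0. apply same_framed_refl.
  - destruct (curve_Gr2_lifts K q1 c1 Q1) as (V1 & G1 & O1). destruct (curve_Gr2_lifts K q2 c2 Q2) as (V2 & G2 & O2).
    assert (HR : forall q c, lifts K 0 q c -> locally 0 (fun s => rep_by (q s) (framed_of (q s)))).
    { intros q c HL. destruct (lifts_framed K 0 q c HL) as [_ Hloc]. apply filter_imp with (2 := Hloc).
      intros s (_ & HH & _). exists (framed_of (q s)). split; [exact HH | apply same_framed_refl]. }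
    (* The same lifts represent the curves in the Grassmannian and in [V2], with the identity as
       unitary factor. *)
    exists q1, q2. split; [exact O1 | split; [exact O2 | split; [now apply (HR q1 c1) | split; [now apply (HR q2 c2) | split]]]].
    + exists U2_id. split; [apply U2_U2_id |]. intros t. change (right_mul U2_id (q1 0) t = q2 0 t). now rewrite right_mul_id, E0.
    + exists q1, q2. split; [now split | split; [now split | split]].
      * intros t. change (q1 0 t = q2 0 t). now rewrite E0.
      * change (/ 4 * Omega (c1 0) (velocity_V3 c1) (velocity_V3 c2) = omega_L2 (velocity_C2 q1) (velocity_C2 q2)).
        rewrite (Omega_omega K q1 q2 c1 c2 Q1 Q2); [field |]. intros t. now rewrite E0.
Qed.

(** The form asks for representatives with a common value at 0, but [d1 0] and [d2 0] are only
    congruent; a constant rotation of the second curve repairs this. *)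
Lemma form_IsoImm_exists d1 d2 : curve IsoImm 0 d1 -> curve IsoImm 0 d2 -> same IsoImm (d1 0) (d2 0) ->
  exists w, form IsoImm d1 d2 w.
Proof.
  intros (e1 & He1 & L1) (e2 & He2 & L2) Hs.
  assert (M1 : locally 0 (fun s => mem_IsoImm (e1 s))) by (apply filter_imp with (2 := L1); tauto).
  assert (M2 : locally 0 (fun s => mem_IsoImm (e2 s))) by (apply filter_imp with (2 := L2); tauto).
  destruct (curve_LS2_vderive 0 e1 He1 M1) as [C1 Z1]. destruct (curve_LS2_vderive 0 e2 He2 M2) as [C2 Z2].
  assert (HS : same_SO3 (e2 0) (e1 0)).
  { apply same_SO3_trans with (d2 0); [apply (locally_singleton _ _ L2) |].
    apply same_SO3_trans with (d1 0); [now apply same_SO3_sym |].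
    apply same_SO3_sym. apply (locally_singleton _ _ L1). }
  apply (same_SO3_vderive _ _ (smooth_family_V3_slice0 0 e2 He2)) in HS.
  destruct HS as (A & HA & EA).
  eexists. exists (fun s => vderive (e1 s)), (fun s t => mapp A (vderive (e2 s) t)).
  split; [| split; [| split; [| reflexivity]]].
  - split; [exact C1 |]. generalize (filter_and _ _ L1 (filter_and _ _ (proj1 C1) Z1)). apply filter_imp.
    intros s ((Hm & Hd & HSs) & (Hc & Hz)). split; [now split | split; [now apply mem_IsoImm_LS2 |]].
    destruct (same_SO3_vderive _ _ (proj1 (proj1 (smooth_loop_V3_iff _) (proj1 Hm))) HSs) as (B & HB & EB).
    exists B. split; trivial. intros t. symmetry. apply EB.
  - split; [now apply (curve_LS2_mapp A 0 (fun s => vderive (e2 s))) |].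
    generalize (filter_and _ _ L2 (filter_and _ _ (proj1 C2) (filter_and _ _ Z2 (proj1 (curve_LS2_mapp A 0 _ HA C2))))). apply filter_imp.
    intros s ((Hm & Hd & HSs) & (Hc & Hz & Hc')). split; [split; [exact Hc' |] | split; [now apply mem_IsoImm_LS2 |]].
    + apply (closed_mapp A (vderive (e2 s))); trivial. now apply mem_LS2_smooth.
    + pose proof (same_SO3_vderive _ _ (proj1 (proj1 (smooth_loop_V3_iff _) (proj1 Hm))) HSs) as HV.
      destruct (same_SO3_mapp A _ _ HA HV) as (B & HB & EB).
      exists B. split; trivial. intros t. symmetry. apply EB.
  - intros t. apply EA.
Qed.

Theorem theorem4p7 :
  forall K : component,
    diffeomorphism (M_red K) IsoImm forget /\
    (forall d1 d2 : R -> framed,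
       curve (M_red K) 0 d1 -> curve (M_red K) 0 d2 -> same (M_red K) (d1 0) (d2 0) ->
       exists! w : R, form (M_red K) d1 d2 w) /\
    exists c : R, c <> 0 /\
      forall d1 d2 : R -> framed,
        curve (M_red K) 0 d1 -> curve (M_red K) 0 d2 ->
        forall w : R,
          form (M_red K) d1 d2 (c * w) <->
          form IsoImm (fun s => forget (d1 s)) (fun s => forget (d2 s)) w.
Proof.
  intros K. split; [apply forget_diffeomorphism | split].
  - intros d1 d2 H1 H2 Hs.
    assert (HC1 := curve_M_red_IsoImm K 0 d1 H1). assert (HC2 := curve_M_red_IsoImm K 0 d2 H2).
    destruct (form_IsoImm_exists _ _ HC1 HC2) as [w Hw].
    { destruct H1 as (x1 & _ & L1), H2 as (x2 & _ & L2).
      destruct (locally_singleton _ _ L1) as (_ & M1 & _). destruct (locally_singleton _ _ L2) as (_ & M2 & _).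
      now apply (proj1 (proj2 (forget_diffeomorphism K))). }
    exists (/ 4 * w). split; [now apply form_IsoImm_M_red |].
    (* Uniqueness is pulled back: any value on [M_red] gives four times itself on [IsoImm], where
       values are unique. *)
    intros w' Hw'. apply form_M_red_IsoImm in Hw'.
    pose proof (form_IsoImm_unique _ _ _ _ Hw Hw'). lra.
  - exists (/ 4). split; [lra |]. intros d1 d2 H1 H2 w. split; intros Hw.
    + apply form_M_red_IsoImm in Hw. now replace w with (4 * (/ 4 * w)) by field.
    + now apply form_IsoImm_M_red.
Qed.
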